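(* Let $\mathcal{A}$ be a finite (nonempty) alphabet and let $d\geq 2$. For any right-recursively enumerable real number $h$ such that $0\leq h\leq\log_2(|\mathcal{A}|)$, there exists a $d$-dimensional subshift of finite type $X\subset\mathcal{A}^{\mathbb{Z}^d}$ of topological entropy $h(X)=h$.
   Context: A subshift of finite type on $\mathcal{A}^{\mathbb{Z}^d}$ is the set of configurations $x\in\mathcal{A}^{\mathbb{Z}^d}$ avoiding all translates of a given finite set of finite patterns. The topological entropy is $h(X)=\lim_{n\to\infty}\frac{\log_2 N_X(n,\dots,n)}{n^d}$, where $N_X(n,\dots,n)$ is the number of patterns of support $\{0,\dots,n-1\}^d$ appearing in configurations of $X$. A real number is right-recursively enumerable ($\Pi_1$-computable) if there is a decreasing computable sequence of rationals converging to it. *)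

(* Defs.v *)
From HB Require Import structures.
From mathcomp Require Import all_boot all_order all_algebra finmap.
From mathcomp Require Import all_classical all_reals all_analysis.
Set Implicit Arguments.
Unset Strict Implicit.
Unset Printing Implicit Defensive.
Import Order.TTheory GRing.Theory Num.Theory.
Import numFieldNormedType.Exports.
Local Open Scope classical_set_scope.
Local Open Scope ring_scope.

(* Kleene's total recursive functions.  Minimization is only applied to regular
   functions; by the normal form theorem this yields exactly the total
   computable functions. *)
Inductive recursive : forall n, (n.-tuple nat -> nat) -> Prop :=
| rec_zero n : @recursive n (fun _ => 0%N)
| rec_succ : @recursive 1 (fun v => (thead v).+1)
| rec_proj n (i : 'I_n) : @recursive n (fun v => tnth v i)
| rec_comp m n (f : m.-tuple nat -> nat) (g : 'I_m -> n.-tuple nat -> nat) :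
    recursive f -> (forall i, recursive (g i)) ->
    recursive (fun v => f [tuple g i v | i < m])
| rec_prim n (f : n.-tuple nat -> nat) (g : n.+2.-tuple nat -> nat) :
    recursive f -> recursive g ->
    @recursive n.+1 (fun v =>
      nat_rec (fun _ => nat) (f [tuple of behead v])
        (fun k r => g [tuple of k :: r :: behead v]) (thead v))
| rec_min n (f : n.+1.-tuple nat -> nat)
    (regular : forall v : n.-tuple nat,
      exists k, f [tuple of k :: v] == 0%N) :
    recursive f -> recursive (fun v => ex_minn (regular v)).

Definition computable_nat_seq (f : nat -> nat) : Prop :=
  @recursive 1 (fun v => f (thead v)).

Definition computable_rat_seq (q : nat -> rat) : Prop :=
  exists a b c : nat -> nat,
    [/\ computable_nat_seq a, computable_nat_seq b, computable_nat_seq c &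
        forall n, q n = ((a n)%:R - (b n)%:R) / (c n).+1%:R].

Definition right_recursively_enumerable (R : realType) (h : R) : Prop :=
  exists q : nat -> rat,
    [/\ computable_rat_seq q, nonincreasing_seq q &
        (fun n => ratr (q n) : R) @ \oo --> h].

Definition configuration (A : finType) (d : nat) : Type := 'rV[int]_d -> A.

Definition pattern (A : finType) (d : nat) := {fmap 'rV[int]_d -> A}.

Definition appears_at (A : finType) (d : nat) (p : pattern A d)
    (x : configuration A d) (u : 'rV[int]_d) : Prop :=
  forall v : domf p, x (u + val v) = p v.

Definition sft_of (A : finType) (d : nat) (F : seq (pattern A d)) :
    set (configuration A d) :=
  [set x | forall p, p \in F -> forall u, ~ appears_at p x u].

Definition is_sft (A : finType) (d : nat) (X : set (configuration A d)) :
    Prop :=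
  exists F : seq (pattern A d), X = sft_of F.

Definition cube_pattern (A : finType) (d n : nat) := {ffun 'rV['I_n]_d -> A}.

Definition cube_point (d n : nat) (k : 'rV['I_n]_d) : 'rV[int]_d :=
  map_mx (fun i : 'I_n => (i : nat)%:Z) k.

Definition in_language (A : finType) (d n : nat)
    (X : set (configuration A d)) (p : cube_pattern A d n) : Prop :=
  exists2 x, X x & exists u, forall k, x (u + cube_point k) = p k.

Definition pattern_count (A : finType) (d : nat) (X : set (configuration A d))
    (n : nat) : nat :=
  #|[set p : cube_pattern A d n | `[< in_language X p >]]%SET|.

(* As [lne 0 = -oo], the empty subshift has entropy [-oo], not [0]. *)
Definition log2 (R : realType) (x : \bar R) : \bar R :=
  (lne x * ((ln 2)^-1)%:E)%E.

Definition has_topological_entropy (R : realType) (A : finType) (d : nat)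
    (X : set (configuration A d)) (h : \bar R) : Prop :=
  (fun n => log2 (pattern_count X n)%:R%:E * ((n%:R ^+ d)^-1)%:E)%E @ \oo --> h.

(* Main.v *)
(* If h = log2 |A|, take the full shift.  Otherwise let rho < 1 be rational with
   h < rho log2 |A|, and let theta = h / (rho log2 |A|).

   The sites (x, y) of the plane are organised in a hierarchy of crosses, one at each site
   where x and y have the same 2-adic valuation; local rules enforce it because the even
   sites of a valid tiling, after a shift, again form a valid tiling.  A column of valuation
   j carries a tape with j cells, cell i being repeated on the crosses of level i next to
   this column: adjacent cells meet through a cross and its parent, and the tapes of
   neighbouring columns of valuations j and j + 1 are compared through messages along rows,
   so that the tapes are the successive states of a machine.  Rows of valuation i all carry
   the same bit b_i, which the machine reads from the cells i as an oracle; it checks that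
   sum_(i < n) b_i 2^(-i-1) * rho log2 |A| <= q_n for each n, where q_n decreases to h.

   Each tile is coded by an L x L cell over A, in which a proportion rho of the positions is
   free when the bit of the row is set, and constant otherwise.  A tiling of a square of side
   2^k is determined by its frame, so that the tiles have zero entropy, and the entropy is
   the supremum of (sum b_i 2^(-i-1)) * rho log2 |A| over the accepted bits: at most h, by
   the tests, and at least h, by taking the binary digits of theta.  In dimension d > 2 the
   slices along the first two coordinates are taken independent. *)
Require Import Defs.
From mathcomp Require Import all_boot all_order all_algebra finmap.
From mathcomp Require Import all_classical all_reals all_analysis.
From mathcomp Require Import zify ring lra.
Set Implicit Arguments.
Unset Strict Implicit.
Unset Printing Implicit Defensive.

(** As [h] is only known from above, its digits cannot be computed: a machine can only refute bits
    whose partial sums are too large. The bits are therefore guessed, one per level, and the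
    entropy, governed by the richest configurations, selects the largest accepted sum by itself.
    Refutation has to work in every configuration: whatever the tiling, it contains columns of
    valuations 1, ..., J whose tapes form the run up to time J, for each J, so that the machine can
    never die. Next to a column of valuation j there are crosses of the levels i < j only, which is
    why the tape gains one cell per step; the registers of a counter machine grow no faster, hence
    fit in unary. Guessing is cheap: in a square of side 2^k only k bits and the valuation of one
    row are unknown, and the frame has O(2^k) tiles, against 4^k cells. Finally, marks and tile
    codes occupy part of each cell, which forces rho < 1 and the separate treatment of the maximal
    entropy. *)

(* A run of a machine as a triangle: [t i j], for [i < j], is the cell [i] of the tape at
   time [j], and carries the oracle bit [b i].  The tape grows by one cell at each step. *)
Record trisys := TriSys {
  tsym :> finType;
  tbit : tsym -> bool;
  tleft : tsym -> bool;
  tini : tsym -> bool;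
  tlast : tsym -> bool;
  tadj : tsym -> tsym -> bool;
  tstep : tsym -> tsym -> bool }.

(** [tstep] relates a cell only to itself one step later, and [tadj] is the sole exchange between
    neighbouring cells. Everything stops at time [J], because a tiling will yield such an array for
    each [J] separately. *)
Definition tri_array (W : trisys) (b : nat -> bool) (J : nat)
    (t : nat -> nat -> W) : Prop :=
  [/\ forall i j, (i < j <= J)%N -> tbit (t i j) = b i,
      forall j, (0 < j <= J)%N -> tleft (t 0%N j) /\ tlast (t j.-1 j),
      (0 < J)%N -> tini (t 0%N 1%N),
      forall i j, (i.+1 < j <= J)%N -> tadj (t i j) (t i.+1 j) &
      forall i j, (i < j < J)%N -> tstep (t i j) (t i j.+1)].

(** * Counter machines with an oracle *)

Inductive instr :=
| Inc of nat & nat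
| Djz of nat & nat & nat
| Qry of nat & nat & nat
| Jmp of nat
| Die.

Definition upd (R : nat -> nat) r v : nat -> nat := fun q => if q == r then v else R q.

(* [Djz r l0 l1] jumps to [l0] when register [r] is null, and else decrements it and
   jumps to [l1]; [Qry r l0 l1] asks the oracle [b] for the bit of index [r]. *)
Definition mstep (b : nat -> bool) (code : seq instr) (s : nat * (nat -> nat)) :
    option (nat * (nat -> nat)) :=
  let: (pc, R) := s in
  match nth Die code pc with
  | Inc r l => Some (l, upd R r (R r).+1)
  | Djz r l0 l1 => Some (if R r == 0 then l0 else l1, upd R r (R r).-1)
  | Qry r l0 l1 => Some (if b (R r) then l1 else l0, R)
  | Jmp l => Some (l, R)
  | Die => None
  end.

Definition runs b code k := iter k (obind (mstep b code)) (Some (0, fun _ => 0)).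

Definition instr_bound N (c : instr) : bool :=
  match c with
  | Inc r l => (r < N) && (l < N)
  | Djz r l0 l1 => [&& r < N, l0 < N & l1 < N]
  | Qry r l0 l1 => [&& r < N, l0 < N & l1 < N]
  | Jmp l => l < N
  | Die => true
  end.

Lemma code_bound code : exists N, all (instr_bound N.+1) code.
Proof.
have mono N M c : N <= M -> instr_bound N c -> instr_bound M c.
  by case: c => //=; lia.
elim: code => [|c code [N IH]]; first by exists 0.
have [M hM] : exists M, instr_bound M.+1 c.
  case: c => [r l|r l m|r l m|l|]; [exists (r + l) | exists (r + l + m) |
    exists (r + l + m) | exists l | exists 0] => //=; lia.
exists (N + M) => /=; rewrite (mono _ _ _ _ hM) /=; last by lia.
by apply: sub_all IH => i; apply: mono; lia.
Qed.

Section Machine.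
Variables (code : seq instr) (N' : nat).
Local Notation N := N'.+1.
Hypothesis codeN : all (instr_bound N) code.

(** A cell is compared with a single cell of the previous tape, so the program counter and the
    answer of the oracle are copied all along the tape. Registers are in unary: [s_le] at a cell is
    [s_lt] at the cell to its left, which lets a decrement move the end of a register by one
    cell. *)
Definition msym : finType :=
  ('I_N * bool * bool * bool * {ffun 'I_N -> bool} * {ffun 'I_N -> bool})%type.
Definition s_pc (s : msym) : nat := s.1.1.1.1.1.
Definition s_ans (s : msym) : bool := s.1.1.1.1.2.
Definition s_left (s : msym) : bool := s.1.1.1.2.
Definition s_bit (s : msym) : bool := s.1.1.2.
Definition s_lt (s : msym) (r : 'I_N) : bool := s.1.2 r.
Definition s_le (s : msym) (r : 'I_N) : bool := s.2 r.

Definition same_lt (s s' : msym) (P : pred nat) : bool :=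
  [forall r : 'I_N, P r ==> (s_lt s' r == s_lt s r)].

(* The cell [i] of the tape at time [j] records, for every register, whether it is
   [> i] and whether it is [>= i]. *)
Definition msystem : trisys := @TriSys msym s_bit
  (fun s => s_left s && [forall r, s_le s r])
  (fun s => (s_pc s == 0) && [forall r, ~~ s_lt s r])
  (fun s => [forall r, ~~ s_lt s r])
  (fun s s' => [&& s_pc s == s_pc s', s_ans s == s_ans s', ~~ s_left s' &
                [forall r, s_lt s r == s_le s' r]])
  (fun s s' => match nth Die code (s_pc s) with
    | Inc r l => [&& s_pc s' == l, same_lt s s' (predC1 r) &
        s_lt s' (inord r) == s_le s (inord r)]
    | Djz r l0 l1 => [&& same_lt s s' (predC1 r),
        s_lt s' (inord r) ==> s_lt s (inord r),
        ~~ s_left s' ==> (s_le s' (inord r) == s_lt s (inord r)) &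
        s_left s ==> (s_pc s' == if s_lt s (inord r) then l1 else l0)]
    | Qry r l0 l1 => [&& same_lt s s' predT,
        s_le s (inord r) && ~~ s_lt s (inord r) ==> (s_ans s == s_bit s) &
        s_left s ==> (s_pc s' == if s_ans s then l1 else l0)]
    | Jmp l => same_lt s s' predT && (s_pc s' == l)
    | Die => false
    end).

Lemma runsS b k : runs b code k.+1 = obind (mstep b code) (runs b code k).
Proof. by []. Qed.

Lemma instr_ok pc : instr_bound N (nth Die code pc).
Proof.
have [lt|ge] := ltnP pc (size code); last by rewrite nth_default.
exact: (all_nthP _ codeN).
Qed.

(** A register grows by at most one per step, hence fits on a tape that gains one cell per step. *)
Lemma runs_bound b k pc R : runs b code k = Some (pc, R) ->
  pc < N /\ forall r, R r <= k.
Proof.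
elim: k pc R => [|k IH] pc R; first by case=> <- <-.
rewrite runsS; case E: (runs b code k) => [[pc0 R0]|] //=.
have [lt le] := IH _ _ E; have := instr_ok pc0; case: nth => //= [r l|r l m|r l m|l].
- move=> h [<- <-]; split=> [|q]; first by lia.
  by rewrite /upd; case: eqP => _; have := le q; have := le r; lia.
- move=> h [<- <-]; split=> [|q]; first by case: ifP; lia.
  by rewrite /upd; case: eqP => _; have := le q; have := le r; lia.
- by move=> h [<- <-]; split=> [|q]; [case: ifP; lia | have := le q; lia].
- by move=> h [<- <-]; split=> // q; have := le q; lia.
Qed.

Section Sound.
Variables (b : nat -> bool) (J : nat) (t : nat -> nat -> msystem).
Hypothesis tA : tri_array b J t.

Definition row_spec j pc (R : nat -> nat) : Prop :=
  (forall i, i < j -> s_pc (t i j) = pc) /\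
  (forall i (r : 'I_N), i < j -> s_lt (t i j) r = (i < R r)).

Lemma row_left i j : i < j <= J -> s_left (t i j) = (i == 0).
Proof.
case: tA => _ L _ A _; case: i => [|i] lt; first by case: (L j lt) => /= /andP[].
by have /= /and4P[_ _ /negbTE] := A i j lt.
Qed.

Lemma row_le i j pc R (r : 'I_N) : row_spec j pc R -> i < j <= J ->
  s_le (t i j) r = (i <= R r).
Proof.
case: tA => _ L _ A _ [_ H]; case: i => [|i] lt.
  by case: (L j lt) => /= /andP[_ /forallP/(_ r) ->].
have /= /and4P[_ _ _ /forallP/(_ r)/eqP <-] := A i j lt.
by rewrite H //; lia.
Qed.

Lemma row_ans i j : i < j <= J -> s_ans (t i j) = s_ans (t 0 j).
Proof.
case: tA => _ _ _ A _; elim: i => [|i IH] lt //.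
have /= /and4P[_ /eqP <- _ _] := A i j lt.
by apply: IH; lia.
Qed.

Lemma row_pc i j : i < j <= J -> s_pc (t i j) = s_pc (t 0 j).
Proof.
case: tA => _ _ _ A _; elim: i => [|i IH] lt //.
have /= /and4P[/eqP <- _ _ _] := A i j lt.
by apply: IH; lia.
Qed.

Lemma array_runs j : j < J -> exists pc R,
  runs b code j = Some (pc, R) /\ row_spec j.+1 pc R.
Proof.
elim: j => [|j IH] lt.
  exists 0, (fun _ => 0); split=> //; case: tA => _ _ /(_ lt) /= /andP[/eqP p0 /forallP z] _ _.
  by split=> [[|i]|[|i] r] // _; apply/negbTE.
have [|pc [R [E S]]] := IH; first by lia.
have lt0 i : i < j.+1 -> i < j.+1 <= J by lia.
have [_ Rb] := runs_bound E; have [Spc Slt] := S.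
(* [tstep] says nothing of the cell created at this step; [tlast] does: no register exceeds its
   index. *)
have last r : s_lt (t j.+1 j.+2) r = false.
  case: tA => _ /(_ j.+2) L _ _ _; case: L => [|_ /= /forallP/(_ r)/negbTE //]; lia.
have st i : i < j.+1 -> tstep (t i j.+1) (t i j.+2).
  by move=> h; case: tA => _ _ _ _; apply; lia.
have left' i : i < j.+2 -> s_left (t i j.+2) = (i == 0) by move=> h; apply: row_left; lia.
rewrite runsS E /=; have := instr_ok pc.
have same r P (R' : nat -> nat) i : (forall i, i < j.+1 -> same_lt (t i j.+1) (t i j.+2) P) ->
    P (nat_of_ord r) -> R' r = R r -> i < j.+2 -> s_lt (t i j.+2) r = (i < R' r).
  move=> Q Pr ->; rewrite ltnS leq_eqVlt => /predU1P[->|h]; last first.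
    by have /forallP/(_ r) := Q i h; rewrite Pr /= => /eqP ->; apply: Slt.
  by rewrite last; have := Rb r; lia.
have rowpc l : s_pc (t 0 j.+2) = l -> forall i, i < j.+2 -> s_pc (t i j.+2) = l.
  by move=> <- i h; apply: row_pc; lia.
case I: (nth Die code pc) => [r l|r l0 l1|r l0 l1|l|] /= B.
- exists l, (upd R r (R r).+1); split=> //; have /andP[rN lN] := B.
  have st' i (h : i < j.+1) := st i h; have {}st i : i < j.+1 ->
     [&& s_pc (t i j.+2) == l, same_lt (t i j.+1) (t i j.+2) (predC1 r) &
        s_lt (t i j.+2) (inord r) == s_le (t i j.+1) (inord r)].
    by move=> h; have := st i h; rewrite /= Spc // I.
  split; first by apply: rowpc; have /and3P[/eqP] := st 0 isT.
  move=> i q h; have [e|ne] := eqVneq (q : nat) r; last first.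
    apply: (@same _ (predC1 r)) => //; first by move=> k hk; case/and3P: (st k hk).
    by rewrite /upd (negbTE ne).
  have eq : q = inord r by apply: val_inj; rewrite /= inordK.
  rewrite /upd e eqxx ltnS; move: h; rewrite ltnS leq_eqVlt => /predU1P[->|h].
    by rewrite last; have := Rb r; lia.
  have /and3P[_ _ /eqP] := st i h; rewrite -eq => ->.
  by rewrite (row_le _ S) ?lt0 // e.
- exists (if R r == 0 then l0 else l1), (upd R r (R r).-1); split=> //.
  have /and3P[rN _ _] := B.
  have {}st i : i < j.+1 -> [&& same_lt (t i j.+1) (t i j.+2) (predC1 r),
        s_lt (t i j.+2) (inord r) ==> s_lt (t i j.+1) (inord r),
        ~~ s_left (t i j.+2) ==> (s_le (t i j.+2) (inord r) == s_lt (t i j.+1) (inord r)) &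
        s_left (t i j.+1) ==> (s_pc (t i j.+2) == if s_lt (t i j.+1) (inord r) then l1 else l0)].
    by move=> h; have := st i h; rewrite /= Spc // I.
  split.
    apply: rowpc; have /and4P[_ _ _] := st 0 isT; rewrite row_left ?lt0 //= => /eqP ->.
    by rewrite Slt // inordK // lt0n; case: eqP.
  move=> i q h; have [e|ne] := eqVneq (q : nat) r; last first.
    apply: (@same _ (predC1 r)) => //; first by move=> k hk; case/and4P: (st k hk).
    by rewrite /upd (negbTE ne).
  have eq : q = inord r by apply: val_inj; rewrite /= inordK.
  rewrite /upd e eqxx; move: h; rewrite ltnS leq_eqVlt => /predU1P[->|h].
    by rewrite last; have := Rb r; lia.
  (* The new bit of cell [i] is obtained from the old cell [i + 1], which exists unless [i = j];
     there the implication in the rule forces false, the register being at most [j]. *)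
  have [e'|ne'] := eqVneq i j.
    have /and4P[_ + _ _] := st i h; rewrite -eq Slt // e.
    by case: s_lt => /= Q; have := Rb r; lia.
  have h' : i.+1 < j.+1 by lia.
  have /and4P[_ _ + _] := st i.+1 h'; rewrite left' // -eq /= Slt // e => /eqP.
  have : tadj (t i j.+2) (t i.+1 j.+2) by case: tA => _ _ _ A _; apply: A; lia.
  move=> /= /and4P[_ _ _ /forallP/(_ q)/eqP ->] ->; lia.
- exists (if b (R r) then l1 else l0), R; split=> //.
  have /and3P[rN _ _] := B.
  have {}st i : i < j.+1 -> [&& same_lt (t i j.+1) (t i j.+2) predT,
        s_le (t i j.+1) (inord r) && ~~ s_lt (t i j.+1) (inord r) ==> (s_ans (t i j.+1) == s_bit (t i j.+1)) &
        s_left (t i j.+1) ==> (s_pc (t i j.+2) == if s_ans (t i j.+1) then l1 else l0)].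
    by move=> h; have := st i h; rewrite /= Spc // I.
  split; last first.
    by move=> i q h; apply: (@same _ predT) => // k hk; case/and3P: (st k hk).
  apply: rowpc; have /and3P[_ _] := st 0 isT; rewrite row_left ?lt0 //= => /eqP ->.
  (* The cell whose index is the value of the register lies on the tape; it alone satisfies [s_le]
     and not [s_lt], and it puts its oracle bit into the common answer. *)
  have rj : R r < j.+1 by have := Rb r; lia.
  have /and3P[_ + _] := st _ rj.
  rewrite (row_le _ S) ?lt0 // Slt // inordK // leqnn ltnn /= => /eqP.
  rewrite row_ans ?lt0 // => ->.
  by case: tA => /= -> //; apply: lt0.
- exists l, R; split=> //.
  have {}st i : i < j.+1 -> same_lt (t i j.+1) (t i j.+2) predT && (s_pc (t i j.+2) == l).
    by move=> h; have := st i h; rewrite /= Spc // I.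
  split; first by apply: rowpc; have /andP[_ /eqP] := st 0 isT.
  by move=> i q h; apply: (@same _ predT) => // k hk; case/andP: (st k hk).
- by have := st 0 isT; rewrite /= Spc // I.
Qed.

End Sound.

Section Complete.
Variables (b : nat -> bool).
Hypothesis alive : forall k, runs b code k <> None.

Definition conf k : nat * (nat -> nat) :=
  if runs b code k is Some s then s else (0, fun _ => 0).

Lemma confE k : runs b code k = Some (conf k).
Proof. by rewrite /conf; case E: (runs b code k) => //; case: (alive E). Qed.

Definition conf_sym i j : msystem :=
  let: (pc, R) := conf j.-1 in
  (inord pc, if nth Die code pc is Qry r _ _ then b (R r) else false, i == 0, b i,
   [ffun r : 'I_N => i < R r], [ffun r : 'I_N => i <= R r]).

Lemma conf_array J : tri_array b J conf_sym.
Proof.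
have cb k : (conf k).1 < N /\ forall r, (conf k).2 r <= k.
  by apply: (@runs_bound b); rewrite confE -surjective_pairing.
rewrite /conf_sym; split.
- by move=> i j _; case: (conf j.-1).
- move=> j lt /=; have := cb j.-1; case: (conf j.-1) => pc R /= [_ Rb]; split.
    by apply/forallP => r; rewrite /s_le /= ffunE.
  by apply/forallP => r; rewrite /s_lt /= ffunE -leqNgt.
- move=> _ /=; rewrite /s_pc /= inordK //=.
  by apply/forallP => r; rewrite /s_lt /= ffunE.
- move=> i j _ /=; case: (conf j.-1) => pc R /=; rewrite /s_pc /s_ans !eqxx /=.
  by apply/forallP => r; rewrite /s_lt /s_le /= !ffunE.
- move=> i j /andP[ij _] /=.
  have jE : j = j.-1.+1 by lia.
  have S : conf j = odflt (conf j) (mstep b code (conf j.-1)) /\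
      mstep b code (conf j.-1) <> None.
    have := confE j; rewrite {1}jE runsS confE /= => E.
    by rewrite E.
  have [lt Rb] := cb j.-1; have [lt' Rb'] := cb j.
  move: S lt Rb lt' Rb'; case: (conf j.-1) => pc R; case: (conf j) => pc' R' /=.
  have := instr_ok pc; case I: (nth Die code pc) => [r l|r l0 l1|r l0 l1|l|] /= B [] //.
  + move=> [-> ->] _ lt Rb lt' Rb'; have /andP[rN _] := B.
    rewrite /s_pc /= inordK // I inordK // eqxx /=; apply/andP; split.
      apply/forallP => q; apply/implyP => /= nq; rewrite /s_lt /= !ffunE /upd (negbTE nq) //.
    by rewrite /s_lt /s_le /= !ffunE inordK // /upd eqxx.
  + move=> [-> ->] _ lt Rb lt' Rb'; have /and3P[rN _ _] := B.
    rewrite /s_pc /= inordK // I inordK //; apply/and4P; split.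
    * apply/forallP => q; apply/implyP => /= nq; rewrite /s_lt /= !ffunE /upd (negbTE nq) //.
    * by rewrite /s_lt /= !ffunE inordK // /upd eqxx; lia.
    * rewrite /s_left /s_lt /s_le /= !ffunE inordK // /upd eqxx; lia.
    * rewrite /s_left /s_lt /= ffunE inordK //; apply/implyP => /eqP ->.
      by rewrite lt0n; case: (R r == 0).
  + move=> [-> ->] _ lt Rb lt' Rb'; have /and3P[rN _ _] := B.
    rewrite /s_pc /= inordK // I inordK //; apply/and3P; split.
    * by apply/forallP => q; rewrite /s_lt /= !ffunE.
    * rewrite /s_left /s_lt /s_le /s_ans /s_bit /= !ffunE inordK // ?I.
      apply/implyP => /andP[h1 h2]; have -> : R r = i by lia.
      by [].
    * by rewrite /s_left /s_ans /= ?I eqxx implybT.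
  + move=> [-> ->] _ lt Rb lt' Rb'.
    rewrite /s_pc /= inordK // I inordK // eqxx andbT.
    by apply/forallP => q; rewrite /s_lt /= !ffunE.
Qed.

End Complete.
End Machine.

(** Soundness must be usable from finite arrays, one for each [J] and unrelated to each other;
    completeness provides a single infinite array, from which a whole tiling can be written down. *)
Theorem machine_system (code : seq instr) : exists W : trisys, forall b : nat -> bool,
  ((forall J, exists t : nat -> nat -> W, tri_array b J t) ->
     forall k, runs b code k <> None) /\
  ((forall k, runs b code k <> None) ->
     exists t : nat -> nat -> W, forall J, tri_array b J t).
Proof.
have [N cN] := code_bound code.
exists (msystem code N) => b; split=> [H k|H]; last first.
  by exists (conf_sym code N b) => J; apply: conf_array.
have [t tA] := H k.+1.
by have [pc [R [-> _]]] := array_runs cN tA (ltnSn k).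
Qed.

(** * Compilation of recursive functions *)

(* [Loop r c] is [while r <> 0 do (r := r - 1; c)]; [Ask r o] increments [o] if the
   oracle bit of index [r] is set. *)
Inductive cmd :=
| Skip
| Incr of nat
| Seq of cmd & cmd
| Loop of nat & cmd
| Ask of nat & nat.

Notation store := (nat -> nat).

Section Exec.
Variable b : nat -> bool.

Inductive exec : cmd -> store -> store -> Prop :=
| exec_skip R : exec Skip R R
| exec_incr R r : exec (Incr r) R (upd R r (R r).+1)
| exec_seq c1 c2 R R1 R2 : exec c1 R R1 -> exec c2 R1 R2 -> exec (Seq c1 c2) R R2
| exec_loop0 r c R : R r = 0 -> exec (Loop r c) R (upd R r (R r).-1)
| exec_loopS r c R R1 R2 : R r <> 0 -> exec c (upd R r (R r).-1) R1 ->
    exec (Loop r c) R1 R2 -> exec (Loop r c) R R2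
| exec_ask r o R : exec (Ask r o) R (if b (R r) then upd R o (R o).+1 else R).

Lemma updE R r v q : upd R r v q = if q == r then v else R q.
Proof. by []. Qed.

(** [Loop] imitates [Djz], which updates the register even when it is null; the final store
    therefore agrees only pointwise with the one of the invariant. *)
Lemma loop_inv r c (P : nat -> store -> Prop) :
  (forall i R, P i R -> R r = i) ->
  (forall i R, P i.+1 R -> exists2 R1, exec c (upd R r i) R1 & P i R1) ->
  forall i R, P i R -> exists R' R0, [/\ exec (Loop r c) R R', P 0 R0 & R' =1 R0].
Proof.
move=> Pr step; elim=> [|i IH] R PR.
  exists (upd R r (R r).-1), R; split=> //; first by apply: exec_loop0; apply: Pr PR.
  by move=> q; rewrite updE; case: eqP => // ->; rewrite (Pr _ _ PR).
have [R1 E1 P1] := step _ _ PR; have [R' [R0 [E' P0 e]]] := IH _ P1.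
exists R', R0; split=> //; apply: exec_loopS E'; first by rewrite (Pr _ _ PR).
by rewrite (Pr _ _ PR).
Qed.

Lemma exec_clear r R : exists2 R', exec (Loop r Skip) R R' & R' =1 upd R r 0.
Proof.
have [|||R' [R0 [E [P0 P] e]]] := @loop_inv r Skip
  (fun i S => S r = i /\ forall q, q != r -> S q = R q) _ _ (R r) R.
- by move=> i S [].
- move=> i S [_ P]; exists (upd S r i); first exact: exec_skip.
  by split=> [|q nq]; rewrite updE ?eqxx // (negbTE nq) P.
- by [].
- exists R' => // q; rewrite e updE; case: eqP => [->//|/eqP]; exact: P.
Qed.

Definition copy src dst tmp :=
  Seq (Loop dst Skip) (Seq (Loop tmp Skip)
    (Seq (Loop src (Seq (Incr dst) (Incr tmp))) (Loop tmp (Incr src)))).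

Lemma exec_copy src dst tmp R : src != dst -> src != tmp -> dst != tmp ->
  exists R', [/\ exec (copy src dst tmp) R R', R' dst = R src &
    forall r, r != dst -> r != tmp -> R' r = R r].
Proof.
move=> sd st dt.
have [R1 E1 e1] := exec_clear dst R; have [R2 E2 e2] := exec_clear tmp R1.
have [|||R3 [R30 [E3 [a3 b3 c3 d3] e3]]] := @loop_inv src (Seq (Incr dst) (Incr tmp))
  (fun i S => [/\ S src = i, S dst + i = R src, S tmp + i = R src &
     forall q, q != src -> q != dst -> q != tmp -> S q = R q]) _ _ (R src) R2.
- by move=> i S [].
- move=> i S [p1 p2 p3 p4]; eexists; first by apply: exec_seq; apply: exec_incr.
  split=> [|||q n1 n2 n3]; rewrite !updE ?eqxx ?(negbTE sd) ?(negbTE st) ?(negbTE dt) //.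
  + by rewrite eq_sym (negbTE sd); lia.
  + by rewrite eq_sym (negbTE dt) eq_sym (negbTE st); lia.
  + by rewrite (negbTE n3) (negbTE n2) (negbTE n1) p4.
- split=> [|||q n1 n2 n3]; rewrite e2 updE e1 updE.
  + by rewrite (negbTE st) (negbTE sd).
  + by rewrite (negbTE dt) eqxx.
  + by rewrite eqxx.
  + by rewrite (negbTE n3) (negbTE n2).
have [|||R4 [R40 [E4 [a4 b4 c4] e4]]] := @loop_inv tmp (Incr src)
  (fun i S => [/\ S tmp = i, S src + i = R src &
     forall q, q != src -> q != tmp -> S q = R3 q]) _ _ (R src) R3.
- by move=> i S [].
- move=> i S [p1 p2 p3]; eexists; first by apply: exec_incr.
  split=> [||q n1 n2]; rewrite !updE ?eqxx ?(negbTE st) //.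
  + by rewrite eq_sym (negbTE st).
  + by lia.
  + by rewrite (negbTE n2) (negbTE n1) p3.
- by split=> //; rewrite e3; lia.
exists R4; split=> [||r n1 n2].
- by do 3 (apply: exec_seq; eauto).
- by rewrite e4 c4 1?eq_sym // 1?eq_sym // e3; lia.
- rewrite e4; have [->|ns] := eqVneq r src; first by lia.
  by rewrite c4 // e3 d3.
Qed.

End Exec.

Lemma map_tuple_eq n (ins : n.-tuple nat) (R R' : store) :
  {in ins, R =1 R'} -> map_tuple R ins = map_tuple R' ins.
Proof. by move=> e; apply: val_inj; apply/eq_in_map. Qed.

(** Registers from [base] on are scratch space, and below [base] only [out] may change: this makes
    programs composable. One program serves every oracle. *)
Definition computable_by n (f : n.-tuple nat -> nat) : Prop :=
  forall (ins : n.-tuple nat) (out base : nat), all (fun r => r < base) ins ->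
    out < base -> out \notin (ins : seq nat) ->
  exists c, forall b R, exists R', [/\ exec b c R R', R' out = f (map_tuple R ins) &
    forall r, r < base -> r != out -> R' r = R r].

Lemma computable_zero n : @computable_by n (fun _ => 0).
Proof.
move=> ins out base _ _ _; exists (Loop out Skip) => b R.
have [R' E e] := exec_clear b out R; exists R'; split=> // [|r _ ne]; rewrite e updE ?eqxx //.
by rewrite (negbTE ne).
Qed.

Lemma computable_proj n (i : 'I_n) : computable_by (fun v : n.-tuple nat => tnth v i).
Proof.
move=> ins out base /allP insb ob oni; exists (copy (tnth ins i) out base) => b R.
have ti := mem_tnth i ins; have := insb _ ti => tb.
have [|||R' [E e1 e2]] := @exec_copy b (tnth ins i) out base R.
- by apply: contraNneq oni => <-.
- by rewrite ltn_eqF.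
- by rewrite ltn_eqF.
exists R'; split=> // [|r rb ne]; first by rewrite tnth_map.
by rewrite e2 // ltn_eqF.
Qed.

Lemma computable_succ : computable_by (fun v : 1.-tuple nat => (thead v).+1).
Proof.
move=> ins out base insb ob oni.
have [c H] := computable_proj ord0 insb ob oni.
exists (Seq c (Incr out)) => b R; have [R' [E e1 e2]] := H b R.
exists (upd R' out (R' out).+1); split.
- exact: exec_seq E (exec_incr _ _ _).
- by rewrite updE eqxx e1.
- by move=> r rb ne; rewrite updE (negbTE ne) e2.
Qed.

Lemma computable_comp m n (f : m.-tuple nat -> nat) (g : 'I_m -> n.-tuple nat -> nat) :
  computable_by f -> (forall i, computable_by (g i)) ->
  computable_by (fun v => f [tuple g i v | i < m]).
Proof.
move=> Cf Cg ins out base /allP insb ob oni.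
have args l : l <= m -> exists c, forall b R, exists R', [/\ exec b c R R',
    forall i : 'I_m, i < l -> R' (base + i) = g i (map_tuple R ins) &
    forall r, r < base -> R' r = R r].
  elim: l => [|l IH] lm.
    by exists Skip => b R; exists R; split=> //; apply: exec_skip.
  have [c Hc] := IH (ltnW lm).
  have [|||c' Hc'] := Cg (Ordinal lm) ins (base + l) (base + m).
  - by apply/allP => r /insb; lia.
  - by rewrite ltn_add2l.
  - by apply/negP => /insb; lia.
  exists (Seq c c') => b R; have [R1 [E1 p1 q1]] := Hc b R.
  have [R2 [E2 p2 q2]] := Hc' b R1; exists R2; split.
  - exact: exec_seq E1 E2.
  - have mE : map_tuple R1 ins = map_tuple R ins.
      by apply: map_tuple_eq => r /insb; apply: q1.
    move=> i; rewrite ltnS leq_eqVlt => /predU1P[e|lt].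
      have -> : i = Ordinal lm by apply: val_inj.
      by rewrite p2 mE.
    by rewrite q2 ?p1 //; have := ltn_ord i; lia.
  - by move=> r rb; rewrite q2 ?q1 //; lia.
have [c Hc] := args m (leqnn m).
have [|||c' Hc'] := Cf [tuple base + i | i < m] out (base + m).
- by apply/allP => r /mapP[i _ ->]; rewrite ltn_add2l.
- by lia.
- by apply/negP => /mapP[i _]; lia.
exists (Seq c c') => b R; have [R1 [E1 p1 q1]] := Hc b R.
have [R2 [E2 p2 q2]] := Hc' b R1; exists R2; split.
- exact: exec_seq E1 E2.
- rewrite p2; congr f; apply: eq_from_tnth => i.
  by rewrite tnth_map !tnth_mktuple p1.
- by move=> r rb ne; rewrite q2 ?q1 //; lia.
Qed.

(** [Loop] counts down while the step function expects an increasing index, so [cnt] decreases as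
    [k] increases. The result goes through [new], because an output register may not be an input. *)
Lemma computable_prim n (f : n.-tuple nat -> nat) (g : n.+2.-tuple nat -> nat) :
  computable_by f -> computable_by g ->
  computable_by (fun v : n.+1.-tuple nat =>
      nat_rec (fun _ => nat) (f [tuple of behead v])
        (fun k r => g [tuple of k :: r :: behead v]) (thead v)).
Proof.
move=> Cf Cg; case/tupleP=> x w out base /= /andP[xb /allP wb] ob.
rewrite inE negb_or => /andP[ox onw].
pose k := base; pose r := base.+1; pose cnt := base.+2; pose new := base.+3.
pose B := base.+4.
have [|||cf Hf] := Cf w r B; rewrite /r /B.
- by apply/allP => q /wb; lia.
- by lia.
- by apply/negP => /wb; lia.
have [|||cg Hg] := Cg [tuple of k :: r :: w] new B; rewrite /k /r /new /B.
- by rewrite /=; apply/and3P; split; [lia|lia|apply/allP => q /wb; lia].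
- by lia.
- by rewrite !inE !negb_or; apply/and3P; split; [lia|lia|apply/negP => /wb; lia].
rewrite -/k -/r -/new -/B in Hf Hg.
exists (Seq cf (Seq (Loop k Skip) (Seq (copy x cnt B)
  (Seq (Loop cnt (Seq cg (Seq (copy new r B) (Incr k)))) (copy r out B))))) => b R.
pose W := map_tuple R w.
pose G := nat_rec (fun _ => nat) (f W) (fun k r => g [tuple of k :: r :: W]).
have [R1 [E1 p1 q1]] := Hf b R.
have [R2 E2 e2] := exec_clear b k R1.
have [|||R3 [E3 p3 q3]] := @exec_copy b x cnt B R2; rewrite /cnt /B; try lia.
rewrite -/cnt -/B in E3 p3 q3.
have [|||R4 [R40 [E4 [a4 b4 c4 d4] e4]]] := @loop_inv b cnt (Seq cg (Seq (copy new r B) (Incr k)))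
  (fun i S => [/\ S cnt = i, S k + i = R x, S r = G (S k) &
     forall q, q < base -> S q = R q]) _ _ (R x) R3.
- by move=> i S [].
- move=> i S [s1 s2 s3 s4].
  have [S1 [F1 t1 u1]] := Hg b (upd S cnt i).
  have [|||S2 [F2 t2 u2]] := @exec_copy b new r B S1; rewrite /r /new /B; try lia.
  rewrite -/r -/new -/B in F2 t2 u2.
  exists (upd S2 k (S2 k).+1).
    by apply: exec_seq F1 _; apply: exec_seq F2 _; apply: exec_incr.
  have S2k : S2 k = S k by rewrite u2 ?u1 ?updE /k /r /new /B /cnt; try lia; rewrite ifF //; lia.
  split=> [|||q qb]; rewrite !updE.
  + rewrite ifF ?u2 ?u1 ?updE ?eqxx // /k /r /new /B /cnt; lia.
  + rewrite eqxx S2k; lia.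
  + rewrite eqxx ifF; last by rewrite /r /k; lia.
    rewrite t2 t1 S2k /=; congr g; apply: val_inj; rewrite /= !updE.
    rewrite ifF; last by rewrite /k /cnt; lia.
    rewrite ifF; last by rewrite /r /cnt; lia.
    rewrite s3; do 2 congr cons; apply/eq_in_map => q /wb qb.
    by rewrite updE ifF ?s4 // /cnt; lia.
  + by rewrite ifF ?u2 ?u1 ?updE ?ifF ?s4 // /k /r /new /B /cnt; lia.
- split.
  + by rewrite p3 e2 updE ifF ?q1 // /k /r; lia.
  + by rewrite q3 ?e2 ?updE ?eqxx // /k /cnt /B; lia.
  + have k0 : R3 k = 0 by rewrite q3 ?e2 ?updE ?eqxx // /k /cnt /B; lia.
    by rewrite k0 q3 ?e2 ?updE ?ifF ?p1 // /k /r /cnt /B; lia.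
  + by move=> q qb; rewrite q3 ?e2 ?updE ?ifF ?q1 // /k /r /cnt /B; lia.
have [|||R5 [E5 p5 q5]] := @exec_copy b r out B R4; rewrite /r /B; try lia.
rewrite -/r -/B in E5 p5 q5.
exists R5; split.
- by do 4 (apply: exec_seq; eauto).
- have kx : R40 k = R x by lia.
  rewrite p5 e4 c4 kx /G /W /thead tnth_map tnth0 /=.
  have -> : [tuple of behead (map_tuple R [tuple of x :: w])] = map_tuple R w by apply: val_inj.
  elim: (R x) => //= i ->; congr g; apply: val_inj => //=.
- by move=> q qb ne; rewrite q5 ?e4 ?d4 // /B; lia.
Qed.

Lemma computable_min n (f : n.+1.-tuple nat -> nat)
    (regular : forall v : n.-tuple nat, exists k, f [tuple of k :: v] == 0) :
  computable_by f -> computable_by (fun v => ex_minn (regular v)).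
Proof.
move=> Cf ins out base /allP wb ob oni.
pose k := base; pose val := base.+1; pose B := base.+2.
have [|||cf Hf] := Cf [tuple of k :: ins] val B; rewrite /k /val /B.
- by rewrite /=; apply/andP; split; [lia|apply/allP => q /wb; lia].
- by lia.
- by rewrite inE negb_or; apply/andP; split; [lia|apply/negP => /wb; lia].
rewrite -/k -/val -/B in Hf.
exists (Seq (Loop k Skip) (Seq cf (Seq (Loop val (Seq (Incr k) cf)) (copy k out B)))) => b R.
have [R1 E1 e1] := exec_clear b k R.
have [R2 [E2 p2 q2]] := Hf b R1.
pose W := map_tuple R ins.
have fE S : (forall q, q < base -> S q = R q) ->
    f (map_tuple S [tuple of k :: ins]) = f [tuple of S k :: W].
  move=> h; congr f; apply: val_inj; rewrite /=; congr cons.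
  by apply/eq_in_map => q /wb; apply: h.
case: (ex_minnP (regular W)) => m /eqP fm mmin.
(* The loop is controlled by the value of [f], not by a countdown, so [loop_inv] does not apply; the
   induction is on the distance from [k] to the minimum [m]. *)
have loop d S : m - S k = d -> S k <= m -> (forall q, q < base -> S q = R q) ->
    S val = f [tuple of S k :: W] -> exists S', [/\ exec b (Loop val (Seq (Incr k) cf)) S S',
      S' k = m & forall q, q < base -> S' q = R q].
  have vk : (k == val) = false by rewrite /k /val; lia.
  have bk q : q < base -> (q == k) = false by rewrite /k; lia.
  have bv q : q < base -> (q == val) = false by rewrite /val; lia.
  elim: d S => [|d IH] S dE le h hv.
    have km : S k = m by lia.
    exists (upd S val (S val).-1); split.
    - by apply: exec_loop0; rewrite hv km.
    - by rewrite updE vk.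
    - by move=> q qb; rewrite updE bv // h.
  have nz : S val <> 0.
    move=> z; have := mmin (S k); rewrite -hv z eqxx => /(_ isT); lia.
  pose S1 := upd S val (S val).-1; pose S2 := upd S1 k (S1 k).+1.
  have S2k : S2 k = (S k).+1 by rewrite /S2 updE eqxx /S1 updE vk.
  have S2b q : q < base -> S2 q = R q.
    by move=> qb; rewrite /S2 updE bk // /S1 updE bv // h.
  have [S3 [F3 t3 u3]] := Hf b S2.
  have S3k : S3 k = (S k).+1 by rewrite u3 ?S2k ?vk // /k /B; lia.
  have [||||S' [F' v1 v2]] := IH S3.
  - by rewrite S3k; lia.
  - by rewrite S3k; lia.
  - by move=> q qb; rewrite u3 ?S2b ?bv // /B; lia.
  - by rewrite t3 fE // S2k S3k.
  exists S'; split=> //; apply: exec_loopS nz _ F'.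
  by apply: exec_seq F3; apply: exec_incr.
have R1b q : q < base -> R1 q = R q by move=> qb; rewrite e1 updE ifF // /k; lia.
have R2k : R2 k = 0 by rewrite q2 ?e1 ?updE ?eqxx // /k /B /val; lia.
have [||||R3 [E3 p3 q3]] := loop m R2.
- by rewrite R2k subn0.
- by rewrite R2k.
- by move=> q qb; rewrite q2 ?R1b // /B /val; lia.
- by rewrite p2 fE // R2k e1 updE eqxx.
have [|||R4 [E4 p4 q4]] := @exec_copy b k out B R3; rewrite /k /B; try lia.
rewrite -/k -/B in E4 p4 q4.
exists R4; split.
- by do 3 (apply: exec_seq; eauto).
- by rewrite p4.
- by move=> q qb ne; rewrite q4 ?q3 // /B; lia.
Qed.

Lemma recursive_computable n (f : n.-tuple nat -> nat) : recursive f -> computable_by f.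
Proof.
elim=> {n f} [n||n i|m n f g _ Cf _ Cg|n f g _ Cf _ Cg|n f reg _ Cf].
- exact: computable_zero.
- exact: computable_succ.
- exact: computable_proj.
- exact: computable_comp.
- exact: computable_prim.
- exact: computable_min.
Qed.

Fixpoint comp (pc : nat) (c : cmd) : seq instr :=
  match c with
  | Skip => [::]
  | Incr r => [:: Inc r pc.+1]
  | Seq c1 c2 => let p := comp pc c1 in p ++ comp (pc + size p) c2
  | Loop r c => let p := comp pc.+1 c in
      Djz r (pc + size p).+2 pc.+1 :: rcons p (Jmp pc)
  | Ask r o => [:: Qry r pc.+2 pc.+1; Inc o pc.+2]
  end.

Definition loads (code : seq instr) pc (l : seq instr) : Prop :=
  forall i, i < size l -> nth Die code (pc + i) = nth Die l i.

Lemma loads_cat code pc l1 l2 : loads code pc (l1 ++ l2) ->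
  loads code pc l1 /\ loads code (pc + size l1) l2.
Proof.
move=> H; split=> i lt.
  by rewrite H ?nth_cat ?lt // size_cat ltn_addr.
by rewrite -addnA H ?nth_cat ?size_cat ?ltn_add2l // ltnNge leq_addr /= addKn.
Qed.

Section Simulation.
Variables (b : nat -> bool) (code : seq instr).

Definition steps s s' := exists k, iter k (obind (mstep b code)) (Some s) = Some s'.

Lemma steps_trans s1 s2 s3 : steps s1 s2 -> steps s2 s3 -> steps s1 s3.
Proof. by move=> [k e] [l e']; exists (l + k); rewrite iterD e. Qed.

Lemma steps1 s s' : mstep b code s = Some s' -> steps s s'.
Proof. by move=> e; exists 1. Qed.

Lemma exec_steps c R R' : exec b c R R' -> forall pc, loads code pc (comp pc c) ->
  steps (pc, R) (pc + size (comp pc c), R').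
Proof.
elim=> {c R R'} [R|R r|c1 c2 R R1 R2 _ IH1 _ IH2|r c R z|r c R R1 R2 nz _ IH1 _ IH2|r o R] pc L /=.
- by exists 0; rewrite addn0.
- by apply: steps1; have /= := L 0 isT; rewrite addn0 => ->; rewrite addn1.
- have /= [L1 L2] := loads_cat L; rewrite size_cat addnA.
  by apply: steps_trans (IH2 _ L2); apply: IH1.
- have /= := L 0 isT; rewrite addn0 => I.
  by apply: steps1; rewrite /= I z eqxx size_rcons !addnS.
- have /= := L 0 isT; rewrite addn0 => I.
  have L1 : loads code pc.+1 (comp pc.+1 c).
    move=> i lt; have /= := L i.+1; rewrite size_rcons addnS -addSn => -> //; last by lia.
    by rewrite nth_rcons lt.
  apply: (@steps_trans _ (pc.+1, upd R r (R r).-1)).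
    by apply: steps1; rewrite /= I; case: eqP.
  apply: steps_trans (IH1 _ L1) _; apply: (@steps_trans _ (pc, R1)); last exact: IH2.
  have /= := L (size (comp pc.+1 c)).+1; rewrite size_rcons nth_rcons ltnn eqxx => J.
  by apply: steps1; rewrite /= addSn -addnS J.
- have /= I0 := L 0 isT; have /= I1 := L 1 isT; rewrite addn0 in I0; rewrite addn1 in I1.
  rewrite addn2; case: ifP => h; last by apply: steps1; rewrite /= I0 h.
  apply: (@steps_trans _ (pc.+1, R)); apply: steps1; first by rewrite /= I0 h.
  by rewrite /= I1.
Qed.

End Simulation.

(** The first [n] bits as a binary integer, most significant first: 2^n times the partial sum of the
    b_i 2^(-i-1). *)
Fixpoint prefix_code (b : nat -> bool) n : nat :=
  if n is n'.+1 then 2 * prefix_code b n' + b n' else 0.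

(** Register 0 holds [n] and register 1 the prefix code of length [n]; one query extends the
    prefix. *)
Definition update := Seq (copy 1 2 3) (Seq (Loop 2 (Incr 1)) (Seq (Ask 0 1) (Incr 0))).

Lemma exec_update b R : exists R', [/\ exec b update R R', R' 0 = (R 0).+1 &
  R' 1 = 2 * R 1 + b (R 0)].
Proof.
have [||| R1 [E1 p1 q1]] := @exec_copy b 1 2 3 R => //.
have [|||R2 [R20 [E2 [a2 b2 c2] e2]]] := @loop_inv b 2 (Incr 1)
  (fun i S => [/\ S 2 = i, S 1 + i = 2 * R 1 & S 0 = R 0]) _ _ (R 1) R1.
- by move=> i S [].
- move=> i S [s1 s2 s3]; eexists; first by apply: exec_incr.
  by split; rewrite !updE //=; lia.
- by split=> //; rewrite q1 //; lia.
eexists; split.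
- by apply: exec_seq E1 _; apply: exec_seq E2 _; apply: exec_seq; [apply: exec_ask | apply: exec_incr].
- by rewrite updE eqxx; case: ifP => _; rewrite ?updE /= e2 c2.
- rewrite updE /= e2 c2; case: ifP => _; rewrite ?updE /= e2; lia.
Qed.

Section Search.
Variables (test : 2.-tuple nat -> nat) (ct : cmd).
Hypothesis ctP : forall b R, exists R', [/\ exec b ct R R',
  R' 2 = test [tuple R 0; R 1] & forall r, r < 3 -> r != 2 -> R' r = R r].

Let k1 := size (comp 0 ct).
(** An endless loop over [n] whose only exit is [Die], at the first nonzero test: survival of the
    machine is the conjunction of all the tests. *)
Definition search_code : seq instr :=
  comp 0 ct ++ [:: Djz 2 k1.+2 k1.+1; Die] ++ comp k1.+2 update ++ [:: Jmp 0].

Variable b : nat -> bool.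
Local Notation holds n := (test [tuple n; prefix_code b n] = 0).

Lemma search_loads : [/\ loads search_code 0 (comp 0 ct),
  nth Die search_code k1 = Djz 2 k1.+2 k1.+1, nth Die search_code k1.+1 = Die,
  loads search_code k1.+2 (comp k1.+2 update) &
  nth Die search_code (k1.+2 + size (comp k1.+2 update)) = Jmp 0].
Proof.
have : loads search_code 0 search_code by [].
rewrite {2}/search_code => /loads_cat[La /loads_cat[L2 /loads_cat[Lb L4]]].
rewrite /= !add0n -/k1 addn2 in L2 Lb L4.
have := L2 0 isT; have := L2 1 isT; have := L4 0 isT.
by rewrite !addn0 addn1.
Qed.

(** The bound [n <= k] says that the loop head is visited arbitrarily late; as a dead machine stays
    dead, this gives survival at every time. *)
Lemma search_head n : (forall i, i < n -> holds i) ->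
  exists k R, [/\ n <= k, runs b search_code k = Some (0, R), R 0 = n & R 1 = prefix_code b n].
Proof.
have [L1 I1 _ L2 I2] := search_loads.
elim: n => [|n IH] H; first by exists 0, (fun _ => 0).
have [|k [R [nk E r0 r1]]] := IH; first by move=> i lt; apply: H; lia.
have [R1 [E1 p1 q1]] := ctP b R; have [R' [E' u0 u1]] := exec_update b (upd R1 2 (R1 2).-1).
have [i ei] := exec_steps E1 L1; rewrite add0n -/k1 in ei.
have [j ej] := exec_steps E' L2.
have z : R1 2 = 0 by rewrite p1 r0 r1 H.
exists (j + (i + k).+1).+1, R'; split.
- by lia.
- rewrite /runs iterS iterD iterS iterD.
  move: E; rewrite /runs => ->; rewrite ei /= I1 z eqxx.
  by move: ej; rewrite z => -> /=; rewrite I2.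
- by rewrite u0 updE /= q1 // r0.
- by rewrite u1 !updE /= !q1 // r0 r1.
Qed.

Lemma search_alive : (forall n, holds n) -> forall k, runs b search_code k <> None.
Proof.
move=> H k E; have [l [R [kl El _ _]]] := search_head (fun i (_ : i < k) => H i).
move: El; rewrite -(subnK kl) /runs iterD -/(runs _ _ _) E.
suff -> : iter (l - k) (obind (mstep b search_code)) None = None by [].
by elim: (l - k) => //= m ->.
Qed.

Lemma search_holds : (forall k, runs b search_code k <> None) -> forall n, holds n.
Proof.
move=> alive n; elim/ltn_ind: n => n IH.
have [k [R [_ E r0 r1]]] := search_head IH.
have [L1 I1 I2 _ _] := search_loads.
have [R1 [E1 p1 q1]] := ctP b R.
have [i ei] := exec_steps E1 L1; rewrite add0n -/k1 in ei.
apply/eqP/negP => nz; apply: (alive (i + k).+2).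
rewrite /runs 2!iterS iterD; move: E; rewrite /runs => ->; rewrite ei /= I1.
by rewrite p1 r0 r1; case: eqP nz => //= _ _; rewrite I2.
Qed.

End Search.

Theorem oracle_system (test : 2.-tuple nat -> nat) : recursive test ->
  exists W : trisys, forall b : nat -> bool,
  ((forall J, exists t : nat -> nat -> W, tri_array b J t) ->
     forall n, test [tuple n; prefix_code b n] = 0) /\
  ((forall n, test [tuple n; prefix_code b n] = 0) ->
     exists t : nat -> nat -> W, forall J, tri_array b J t).
Proof.
move=> /recursive_computable Ct.
have [||| ct H] := Ct [tuple 0; 1] 2 3 => //.
have ctP b R : exists R', [/\ exec b ct R R', R' 2 = test [tuple R 0; R 1] &
    forall r, r < 3 -> r != 2 -> R' r = R r].
  have [R' [E e q]] := H b R; exists R'; split=> //; rewrite e; congr test.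
  exact: val_inj.
have [W HW] := machine_system (search_code ct); exists W => b; have [H1 H2] := HW b.
split=> [/H1|h]; first exact: search_holds.
by apply: H2; apply: search_alive.
Qed.

(** * Recursiveness of the test *)

Section Closure.
Variable n : nat.
Implicit Types F G : n.-tuple nat -> nat.

Lemma recursive_app1 (op : nat -> nat) F : computable_nat_seq op ->
  recursive F -> recursive (fun v => op (F v)).
Proof.
move=> rop rF; have := rec_comp rop (fun _ : 'I_1 => rF); congr recursive.
by apply/funext => v /=; rewrite /thead tnth_mktuple.
Qed.

Definition recursive2 (op : nat -> nat -> nat) : Prop :=
  @recursive 2 (fun v => op (tnth v ord0) (tnth v (lift ord0 ord0))).

Lemma recursive_app2 op F G : recursive2 op ->
  recursive F -> recursive G -> recursive (fun v => op (F v) (G v)).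
Proof.
move=> rop rF rG.
have rFG (i : 'I_2) : recursive (if i == ord0 then F else G) by case: ifP.
have := rec_comp rop rFG; congr recursive.
by apply/funext => v; rewrite !tnth_mktuple.
Qed.

Lemma recursive_const m : recursive (fun _ : n.-tuple nat => m).
Proof.
elim: m => [|m IH]; first exact: rec_zero.
by have := recursive_app1 rec_succ IH.
Qed.

End Closure.

(** The recursion is on the first argument, whence the reversed arguments of exponentiation and
    subtraction below. *)
Lemma recursive2_prim (f : nat -> nat) (g : nat -> nat -> nat -> nat) op :
  computable_nat_seq f ->
  @recursive 3 (fun v => g (tnth v ord0) (tnth v (lift ord0 ord0)) (tnth v (lift ord0 (lift ord0 ord0)))) ->
  (forall x y, op x y = nat_rec (fun _ => nat) (f y) (fun k r => g k r y) x) ->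
  recursive2 op.
Proof.
move=> rf rg e; have := rec_prim rf rg; congr recursive; apply/funext => v.
rewrite e /thead; case/tupleP: v => x v; case/tupleP: v => y v; rewrite !tnth0 tnthS tnth0.
by congr (nat_rec _ _ _ _).
Qed.

Lemma recursive2_add : recursive2 addn.
Proof.
apply: (@recursive2_prim id (fun _ r _ => r.+1)) => [||x y].
- by have := @rec_proj 1 ord0; congr recursive.
- by apply: recursive_app1 rec_succ (rec_proj _).
- by elim: x => //= x <-.
Qed.

Lemma recursive2_mul : recursive2 muln.
Proof.
apply: (@recursive2_prim (fun _ => 0) (fun _ r y => r + y)) => [||x y].
- exact: rec_zero.
- by apply: recursive_app2 recursive2_add (rec_proj _) (rec_proj _).
- by elim: x => //= x <-; rewrite mulSn addnC.
Qed.

Lemma recursive2_exp : recursive2 (fun x y => y ^ x).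
Proof.
apply: (@recursive2_prim (fun _ => 1) (fun _ r y => r * y)) => [||x y].
- exact: (@recursive_const 1 1).
- by apply: recursive_app2 recursive2_mul (rec_proj _) (rec_proj _).
- by elim: x => //= x <-; rewrite expnSr.
Qed.

Lemma computable_pred : computable_nat_seq predn.
Proof.
have := @rec_prim 0 (fun _ => 0) (fun v => tnth v ord0) (rec_zero _) (rec_proj _).
by congr recursive; apply/funext => v; case: (thead v).
Qed.

Lemma recursive2_sub : recursive2 (fun x y => y - x).
Proof.
apply: (@recursive2_prim id (fun _ r _ => r.-1)) => [||x y].
- by have := @rec_proj 1 ord0; congr recursive.
- by apply: recursive_app1 computable_pred (rec_proj _).
- by elim: x => [|x /= <-]; rewrite ?subn0 // subnS.
Qed.

(* Tests whether [x / 2 ^ n * (u / w) * log2 al <= (a n - b n) / (c n + 1)] fails. *)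
Definition exceeds al u w (a b c : nat -> nat) n x : nat :=
  al ^ (x * u * (c n).+1) - 2 ^ ((a n - b n) * 2 ^ n * w).

Lemma recursive_exceeds al u w a b c : computable_nat_seq a -> computable_nat_seq b ->
  computable_nat_seq c -> recursive2 (exceeds al u w a b c).
Proof.
move=> ra rb rc; rewrite /recursive2 /exceeds.
have rn := @rec_proj 2 ord0; have rx := @rec_proj 2 (lift ord0 ord0).
have Cst m := @recursive_const 2 m.
apply: (recursive_app2 recursive2_sub).
  apply: (recursive_app2 recursive2_exp); last exact: Cst.
  apply: (recursive_app2 recursive2_mul); last exact: Cst.
  apply: (recursive_app2 recursive2_mul).
    by apply: (recursive_app2 recursive2_sub); apply: recursive_app1.
  exact: recursive_app2 recursive2_exp rn (Cst 2).
apply: (recursive_app2 recursive2_exp); last exact: Cst.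
apply: (recursive_app2 recursive2_mul); last first.
  by apply: recursive_app1 rec_succ _; apply: recursive_app1.
exact: recursive_app2 recursive2_mul rx (Cst u).
Qed.

Import Order.TTheory GRing.Theory Num.Theory.
Import numFieldNormedType.Exports.
Local Open Scope ring_scope.

(** * Hierarchical tilings *)

Definition sgn (a : bool) : int := if a then 1 else -1.

Definition shift X (p q : int) (f : int -> int -> X) (m n : int) := f (m + p) (n + q).

Definition dec X (f : int -> int -> X) (m n : int) := f (2 * m) (2 * n).

Lemma shiftE X p q (f : int -> int -> X) m n : shift p q f m n = f (m + p) (n + q).
Proof. by []. Qed.

Lemma int_step_eq X (s : int -> X) : (forall m, s (m + 1) = s m) -> forall m n, s m = s n.
Proof.
move=> H m n; suff E d : forall k, s (k + d%:Z) = s k.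
  have [le|le] := lerP m n.
    by rewrite -(E (absz (n - m)) m); congr s; lia.
  by rewrite -(E (absz (m - n)) n); congr s; lia.
elim: d => [|d IH] k; first by rewrite addr0.
by rewrite -(IH k) -(H (k + d%:Z)); congr s; lia.
Qed.

Lemma int_even_odd (m : int) : (exists k, m = 2 * k) \/ (exists k, m = 2 * k + 1).
Proof.
have := divz_eq m 2; have := modz_ge0 m (isT : 2 != 0 :> int).
have := ltz_pmod m (isT : 0 < 2 :> int).
move=> h1 h2 h3; have [e|e] : (m %% 2)%Z = 0 \/ (m %% 2)%Z = 1 by lia.
- by left; exists (m %/ 2)%Z; lia.
- by right; exists (m %/ 2)%Z; lia.
Qed.

Section Hier.
Variable W : trisys.

(* In the hierarchy, the tile at (x, y) records in [sym] the comparison of the 2-adic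
   valuations of x and y ([None] when they are equal, at the centre of a cross, and
   [Some true] when that of x is smaller), and labels the edges to its right ([hl]) and
   above it ([vl]) with the cross of which they are arms.  For a cross of level i, [ox] and
   [oy] tell whether its parent, of level i + 1, is to the right and above; [corner] copies
   [sym] at the four crossings of its neighbouring columns and rows at distance 2^i; [lf]
   and [rt] are the cells i of the tapes of these two columns, the tape of a column of
   valuation j being the one at time j; [msg] is the tape cell sent along the row above, if any. *)
Definition label : finType :=
  ((bool * bool) * {ffun bool * bool -> option bool} * (W * W) * option W)%type.

Definition ox (c : label) : bool := c.1.1.1.1.
Definition oy (c : label) : bool := c.1.1.1.2.
Definition corner (c : label) (a b : bool) : option bool := c.1.1.2 (a, b).
Definition lf (c : label) : W := c.1.2.1.
Definition rt (c : label) : W := c.1.2.2.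
Definition msg (c : label) : option W := c.2.

Definition tile : finType := ((bool * bool) * option bool * label * label)%type.
Definition px (t : tile) : bool := t.1.1.1.1.
Definition py (t : tile) : bool := t.1.1.1.2.
Definition sym (t : tile) : option bool := t.1.1.2.
Definition hl (t : tile) : label := t.1.2.
Definition vl (t : tile) : label := t.2.

(** For a cross of level i, the two lines that lead to the parent have valuation exactly i + 1 and
    the two opposite ones a larger valuation, which settles three of the four corners. If the parent
    is on the right, the right column has valuation i + 1 and its tape ends at cell i. *)
Definition cross_rule (c : label) : Prop :=
  [/\ corner c (ox c) (oy c) = None,
      corner c (~~ ox c) (oy c) = Some false,
      corner c (ox c) (~~ oy c) = Some true,
      tbit (lf c) = tbit (rt c) &
      ox c -> tlast (rt c)].

(** The remaining corner is also the corner of the parent in the same direction, and is inherited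
    from it. When the parent is on the right, child and parent have the same left column and show
    the cells i and i + 1 of its tape. *)
Definition parent_rule (P c : label) : Prop :=
  corner c (~~ ox c) (~~ oy c) = corner P (~~ ox c) (~~ oy c) /\
  (ox c -> tadj (lf c) (lf P)).

(** The wall is the row between the crosses [c1] below and [c2] above. If [c1] faces up, this is the
    row of their common parent, and the label [P] of its edges is that of the parent. *)
Definition hwall_rule (P c1 c2 : label) : Prop :=
  [/\ ox c1 = ox c2, oy c2 = ~~ oy c1, rt c1 = rt c2, lf c1 = lf c2 &
      oy c1 -> parent_rule P c1 /\ parent_rule P c2].

(** The corner is where the wall column meets the row above. On a row of valuation j, a message
    starts at a column of valuation j, crosses columns of smaller valuation and ends at the first
    one of larger valuation. The latter has valuation exactly j + 1 when the starting cross has its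
    parent on the right, and only then is a message sent. *)
Definition msg_rule (C c1 c2 : label) : Prop :=
  match corner c1 true true with
  | Some true => msg c2 = msg c1
  | None => msg c2 = if ox C then Some (rt c1) else None
  | Some false => msg c2 = None /\
      forall s, msg c1 = Some s -> tstep s (rt c1)
  end.

Definition vwall_rule (C c1 c2 : label) : Prop :=
  [/\ oy c1 = oy c2, ox c2 = ~~ ox c1, rt c1 = lf c2 & msg_rule C c1 c2].

Definition tile_rule (c l d : tile) : Prop :=
  match sym c with
  | None => [/\ hl l = hl c, vl c = hl c, vl d = hl c & cross_rule (hl c)]
  | Some true => hl l = hl c /\ hwall_rule (hl c) (vl d) (vl c)
  | Some false => vl d = vl c /\ vwall_rule (vl c) (hl l) (hl c)
  end.

Implicit Types f g : int -> int -> tile.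

Definition ruled f : Prop :=
  forall m n, tile_rule (f m n) (f (m - 1) n) (f m (n - 1)).

Definition crossed f : Prop := forall m n,
  [/\ sym (f (2 * m + 1) (2 * n + 1)) = None,
      sym (f (2 * m + 1) (2 * n)) = Some true,
      sym (f (2 * m) (2 * n + 1)) = Some false &
      forall a b, corner (hl (f (2 * m + 1) (2 * n + 1))) a b =
                  sym (f (2 * m + 1 + sgn a) (2 * n + 1 + sgn b))].

Definition cr f m n : label := hl (f (2 * m + 1) (2 * n + 1)).

Lemma ruledE f m n m' n' : ruled f -> m' + 1 = m -> n' + 1 = n ->
  tile_rule (f m n) (f m' n) (f m n').
Proof.
move=> /(_ m n) Rf em en.
have -> : m' = m - 1 by lia.
by have -> : n' = n - 1 by lia.
Qed.

Lemma ruled_shift f p q : ruled f -> ruled (shift p q f).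
Proof. by move=> Rf m n; apply: (ruledE Rf); lia. Qed.

Section Valid.
Variable f : int -> int -> tile.
Hypotheses (Rf : ruled f) (Zf : crossed f).

Lemma crossP m n : [/\ hl (f (2 * m) (2 * n + 1)) = cr f m n,
  vl (f (2 * m + 1) (2 * n + 1)) = cr f m n,
  vl (f (2 * m + 1) (2 * n)) = cr f m n & cross_rule (cr f m n)].
Proof.
have /= := @ruledE f (2 * m + 1) (2 * n + 1) (2 * m) (2 * n) Rf erefl erefl.
by rewrite /tile_rule; case: (Zf m n) => ->.
Qed.

Lemma hwallP m n : hl (f (2 * m + 1) (2 * n)) = hl (f (2 * m) (2 * n)) /\
  hwall_rule (hl (f (2 * m) (2 * n))) (cr f m (n - 1)) (cr f m n).
Proof.
have := @ruledE f (2 * m + 1) (2 * n) (2 * m) (2 * (n - 1) + 1) Rf erefl ltac:(lia).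
rewrite /tile_rule; case: (Zf m n) => _ -> _ _ [-> hw].
by case: (crossP m n) => _ _ <- _; case: (crossP m (n - 1)) => _ <- _ _.
Qed.

Lemma vwallP m n : vl (f (2 * m) (2 * n + 1)) = vl (f (2 * m) (2 * n)) /\
  vwall_rule (vl (f (2 * m) (2 * n))) (cr f (m - 1) n) (cr f m n).
Proof.
have := @ruledE f (2 * m) (2 * n + 1) (2 * (m - 1) + 1) (2 * n) Rf ltac:(lia) erefl.
rewrite /tile_rule; case: (Zf m n) => _ _ -> _ [-> hw].
by case: (crossP m n) => <- _ _ _.
Qed.

Lemma cornerE (m n : int) (a b : bool) (m' n' : int) :
  m' = m + a%:Z -> n' = n + b%:Z ->
  corner (cr f m n) a b = sym (f (2 * m') (2 * n')).
Proof.
move=> -> ->; case: (Zf m n) => _ _ _ ->.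
by congr (sym (f _ _)); case: a b => [] []; rewrite /sgn; lia.
Qed.

Lemma ruled_dec : ruled (dec f).
Proof.
move=> m n; rewrite /dec.
have := @ruledE f (2 * m) (2 * n) (2 * (m - 1) + 1) (2 * (n - 1) + 1) Rf
  ltac:(lia) ltac:(lia).
rewrite /tile_rule.
have [-> _] := hwallP (m - 1) n; have [-> _] := vwallP m (n - 1).
by [].
Qed.

Lemma ox_col m n n' : ox (cr f m n) = ox (cr f m n').
Proof.
apply: (int_step_eq (s := fun n => ox (cr f m n))) => k.
by have [_ []] := hwallP m (k + 1); rewrite addrK => ->.
Qed.

Lemma rt_col m n n' : rt (cr f m n) = rt (cr f m n').
Proof.
apply: (int_step_eq (s := fun n => rt (cr f m n))) => k.
by have [_ []] := hwallP m (k + 1); rewrite addrK => _ _ ->.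
Qed.

Lemma lf_rt m n : lf (cr f m n) = rt (cr f (m - 1) n).
Proof. by have [_ [_ _ ->]] := vwallP m n. Qed.

Lemma oy_row m m' n : oy (cr f m n) = oy (cr f m' n).
Proof.
apply: (int_step_eq (s := fun m => oy (cr f m n))) => k.
by have [_ []] := vwallP (k + 1) n; rewrite addrK => ->.
Qed.

Lemma tbit_cr m n m' n' : tbit (rt (cr f m n)) = tbit (rt (cr f m' n')).
Proof.
rewrite (rt_col m' n' n).
apply: (int_step_eq (s := fun m => tbit (rt (cr f m n)))) => k.
by have [_ _ _ [_ _ _ <- _]] := crossP (k + 1) n; rewrite lf_rt addrK.
Qed.

Lemma oxS m n : ox (cr f (m + 1) n) = ~~ ox (cr f m n).
Proof.
by have [_ [_ -> _ _]] := vwallP (m + 1) n; rewrite addrK.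
Qed.

Lemma oyS m n : oy (cr f m (n + 1)) = ~~ oy (cr f m n).
Proof.
by have [_ [_ -> _ _ _]] := hwallP m (n + 1); rewrite addrK.
Qed.

Lemma ox2 m n : ox (cr f (2 * m) n) = ox (cr f 0 n).
Proof.
rewrite -[in RHS](mulr0 2); apply: (int_step_eq (s := fun m => ox (cr f (2 * m) n))) => k.
by rewrite -[RHS]negbK -2!oxS; congr (ox (cr _ _ _)); lia.
Qed.

Lemma oy2 m n : oy (cr f m (2 * n)) = oy (cr f m 0).
Proof.
rewrite -[in RHS](mulr0 2); apply: (int_step_eq (s := fun n => oy (cr f m (2 * n)))) => k.
by rewrite -[RHS]negbK -2!oyS; congr (oy (cr _ _ _)); lia.
Qed.

(* Facing crosses mark the cross columns and rows of the next level. *)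
Lemma crossed_dec : exists p q : bool, crossed (shift p%:Z q%:Z (dec f)).
Proof.
pose p := ~~ ox (cr f 0 0); pose q := ~~ oy (cr f 0 0).
have oxp m n : ox (cr f (2 * m + p%:Z) n) = true.
  rewrite (@ox_col _ n 0) /p; case o: (ox (cr f 0 0)) => /=.
    by rewrite [2 * m + _](_ : _ = 2 * m) ?ox2 //; lia.
  by rewrite [2 * m + _](_ : _ = 2 * m + 1) // oxS ox2 o.
have oyq m n : oy (cr f m (2 * n + q%:Z)) = true.
  rewrite (@oy_row _ 0) /q; case o: (oy (cr f 0 0)) => /=.
    by rewrite [2 * n + _](_ : _ = 2 * n) ?oy2 //; lia.
  by rewrite [2 * n + _](_ : _ = 2 * n + 1) // oyS oy2 o.
exists p, q => m n; rewrite /shift /dec.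
pose M := 2 * m + p%:Z; pose N := 2 * n + q%:Z.
have [_ _ _ [K1 K2 K3 _ _]] := crossP M N.
have [_ _ _ [B1 B2 B3 _ _]] := crossP M (N - 1).
have [_ _ _ [F1 F2 F3 _ _]] := crossP (M - 1) N.
have oyN x : oy (cr f x (N - 1)) = false.
  by apply/negbTE; rewrite -oyS subrK oyq.
have oxM y : ox (cr f (M - 1) y) = false.
  by apply/negbTE; rewrite -oxS subrK oxp.
rewrite /M /N in oyN oxM.
move: K1 K2 K3 B1 B2 B3 F1 F2 F3; rewrite !oxp !oyq !oyN !oxM /=.
move=> K1 K2 K3 B1 B2 B3 F1 F2 F3.
have S1 : sym (f (2 * (M + 1)) (2 * (N + 1))) = None.
  by rewrite -K1; symmetry; apply: cornerE.
have E1 : 2 * m + 1 + p%:Z = M + 1 by rewrite /M; lia.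
have E2 : 2 * n + 1 + q%:Z = N + 1 by rewrite /N; lia.
rewrite E1 E2; split => //.
- by rewrite -B3; symmetry; apply: cornerE => /=; rewrite ?/M ?/N; lia.
- by rewrite -F2; symmetry; apply: cornerE => /=; rewrite ?/M ?/N; lia.
(* the label of the new cross at its corners is inherited from its children *)
pose P := hl (f (2 * (M + 1)) (2 * (N + 1))).
have [hlP _ _ _] : [/\ hl (f (2 * M + 1) (2 * (N + 1))) = P, True, True & True].
  split=> //; have := @ruledE f (2 * (M + 1)) (2 * (N + 1)) (2 * M + 1) (2 * (N + 1) - 1) Rf
    ltac:(lia) ltac:(lia).
  by rewrite /tile_rule S1; case.
have [hlR [_ _ _ _ inhR]] := hwallP (M + 1) (N + 1).
have [hlL [_ _ _ _ inhL]] := hwallP M (N + 1).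
rewrite -hlL hlP in inhL; rewrite -/P in inhR.
move: inhR inhL; rewrite !addrK.
have -> : oy (cr f (M + 1) N) = true by apply: oyq.
have -> : oy (cr f M N) = true by apply: oyq.
move=> /(_ isT) [[R1 _] [R2 _]] /(_ isT) [[I1 _] [I2 _]].
have ox1 y : ox (cr f (M + 1) y) = false by rewrite oxS oxp.
have oy1 x : oy (cr f x (N + 1)) = false by rewrite oyS oyq.
move: R1 R2 I1 I2; rewrite !ox1 !oy1 !oxp !oyq /= => R1 R2 I1 I2.
move=> [] [] /=; rewrite -/P -?R1 -?R2 -?I1 -?I2; apply: cornerE => /=; rewrite /sgn ?/M ?/N; lia.
Qed.

End Valid.
End Hier.

(** * Reading a run of the machine in a tiling *)

Section Chains.
Variable W : trisys.
Local Notation tile := (tile W).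
Implicit Types f g : int -> int -> tile.

Lemma cross_orient (c : label W) a b : cross_rule c ->
  corner c a b = None -> corner c (~~ a) b = Some false ->
  corner c a (~~ b) = Some true -> ox c = a /\ oy c = b.
Proof.
case=> + + + _ _.
by case: (ox c) (oy c) a b => [] [] [] [] //= *; congruence.
Qed.

(** The orientation of crosses is read back from the symbols at the next level, without knowing how
    [p] was chosen. *)
Lemma facing f (p q : bool) a n : ruled f -> crossed f ->
  crossed (shift p%:Z q%:Z (dec f)) ->
  ox (cr f (2 * a + p%:Z) n) = true.
Proof.
move=> Rf Zf Zg; rewrite (@ox_col _ f Rf Zf _ _ (q%:Z)).
have [S1 S2 _ _] := Zg a 0; have [_ _ S3 _] := Zg a 0.
have [_ _ _ C] := crossP Rf Zf (2 * a + p%:Z) q%:Z.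
move: S1 S2 S3; rewrite /shift /dec => S1 S2 S3.
suff [//] : ox (cr f (2 * a + p%:Z) q%:Z) = true /\ oy (cr f (2 * a + p%:Z) q%:Z) = true.
apply: (cross_orient C).
- by rewrite -S1; apply: cornerE => //=; lia.
- by rewrite -S3; apply: cornerE => //=; lia.
- by rewrite -S2; apply: cornerE => //=; lia.
Qed.

Definition chain (F : nat -> int -> int -> tile) (p q : nat -> bool) : Prop :=
  forall i, [/\ ruled (F i), crossed (F i) &
                F i.+1 = shift (p i)%:Z (q i)%:Z (dec (F i))].

Lemma exists_chain f : ruled f -> crossed f ->
  exists F p q, F 0%N = f /\ chain F p q.
Proof.
move=> Rf Zf.
pose D := {g : int -> int -> tile | ruled g /\ crossed g}.
have next (x : D) : {pq : bool * bool |
    crossed (shift pq.1%:Z pq.2%:Z (dec (sval x)))}.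
  apply: cid; case: x => g [Rg Zg] /=.
  by have [p [q Z]] := crossed_dec Rg Zg; exists (p, q).
have nextR (x : D) : ruled (shift (sval (next x)).1%:Z (sval (next x)).2%:Z (dec (sval x))).
  by apply: ruled_shift; apply: ruled_dec; case: (svalP x).
pose nx (x : D) : D := exist _ _ (conj (nextR x) (svalP (next x))).
pose S i : D := iter i nx (exist _ f (conj Rf Zf)).
exists (fun i => sval (S i)), (fun i => (sval (next (S i))).1), (fun i => (sval (next (S i))).2).
by split=> // i; case: (svalP (S i)).
Qed.

(** The tape cell of column [2 * m] at the level of [f], read from a cross on its left; by [rt_col]
    every row gives the same one. *)
Definition tape f m : W := rt (cr f (m - 1) 0).

Lemma tape_rt f m n : ruled f -> crossed f -> rt (cr f (m - 1) n) = tape f m.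
Proof. by move=> R Z; apply: rt_col. Qed.

Lemma tape_lf f m n : ruled f -> crossed f -> lf (cr f m n) = tape f m.
Proof. by move=> R Z; rewrite lf_rt // tape_rt. Qed.

Section Step.
Variables (f g : int -> int -> tile) (p q : bool).
Hypotheses (Rf : ruled f) (Zf : crossed f).
Hypotheses (gE : g = shift p%:Z q%:Z (dec f)) (Zg : crossed g).

Let Rg : ruled g.
Proof. by rewrite gE; apply: ruled_shift; apply: ruled_dec. Qed.

Lemma cr_next m n :
  cr g m n = hl (f (2 * (2 * m + 1 + p%:Z)) (2 * (2 * n + 1 + q%:Z))).
Proof. by rewrite /cr gE. Qed.

(** Column [2 * (2 * m + p)] of [f] is column [2 * m] of [g], so these are consecutive cells of a
    single tape. A cross of [f] on the right of this column and its parent relate them through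
    [parent_rule]. *)
Lemma tadj_tape m : tadj (tape f (2 * m + p%:Z)) (tape g m).
Proof.
rewrite -(tape_lf _ 0 Rg Zg) -(tape_lf _ (q%:Z + 1) Rf Zf).
have oxE : ox (cr f (2 * m + p%:Z) (q%:Z + 1)) by rewrite (@facing _ _ q) // -gE.
have S0 : sym (f (2 * (2 * m + 1 + p%:Z)) (2 * (2 * 0 + 1 + q%:Z))) = None.
  by have [+ _ _ _] := Zg m 0; rewrite gE.
have [_ [_ _ _ _ inh]] := hwallP Rf Zf (2 * m + p%:Z) (q%:Z + 1).
have hE : hl (f (2 * (2 * m + p%:Z)) (2 * (q%:Z + 1))) = cr g m 0.
  have [<- _] := hwallP Rf Zf (2 * m + p%:Z) (q%:Z + 1).
  have := @ruledE _ f (2 * (2 * m + 1 + p%:Z)) (2 * (2 * 0 + 1 + q%:Z))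
    (2 * (2 * m + p%:Z) + 1) (2 * (2 * 0 + 1 + q%:Z) - 1) Rf ltac:(lia) ltac:(lia).
  rewrite /tile_rule S0 cr_next => -[<- _ _ _].
  by congr (hl (f _ _)); lia.
(* the lower child of the cross row faces up *)
have oyq : oy (cr f (2 * m + p%:Z) (q%:Z + 1 - 1)) = true.
  have [S1 S2 S3 _] := Zg m 0.
  have [_ _ _ C] := crossP Rf Zf (2 * m + p%:Z) q%:Z.
  move: S1 S2 S3; rewrite gE /shift /dec => S1 S2 S3.
  rewrite addrK.
  suff [//] : ox (cr f (2 * m + p%:Z) q%:Z) = true /\ oy (cr f (2 * m + p%:Z) q%:Z) = true.
  apply: (cross_orient C).
  - by rewrite -S1; apply: cornerE => //=; lia.
  - by rewrite -S3; apply: cornerE => //=; lia.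
  - by rewrite -S2; apply: cornerE => //=; lia.
have [_ [_ +]] := inh oyq.
by rewrite hE; apply.
Qed.

Lemma tlast_tape m : tlast (tape f (2 * m + 1 + p%:Z)).
Proof.
have [_ _ _ [_ _ _ _]] := crossP Rf Zf (2 * m + p%:Z) 0.
rewrite (@facing _ _ q) -?gE // => /(_ isT).
by rewrite /tape; have -> : 2 * m + 1 + p%:Z - 1 = 2 * m + p%:Z by lia.
Qed.

End Step.

(* Row [w] starts a message at the cross in column [m1], which column [m2] receives. *)
Definition sends g m1 m2 w : Prop :=
  [/\ m1 < m2, sym (g m1 w) = None, ox (hl (g m1 w)),
      forall m, m1 < m < m2 -> sym (g m w) = Some true &
      sym (g m2 w) = Some false].

(** The columns that appear at the finer level have the lowest valuation, so the message goes
    through them. *)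
Lemma sends_refine f (p q m1 m2 w : int) : ruled f -> crossed f ->
  sends (shift p q (dec f)) m1 m2 w -> sends f (2 * (m1 + p)) (2 * (m2 + p)) (2 * (w + q)).
Proof.
move=> Rf Zf [lt s1 o1 s s2]; split => // [|m /andP[l1 l2]]; first by lia.
have [[k e]|[k ->]] := int_even_odd m; last by case: (Zf k (w + q)).
by have := s (k - p); rewrite /shift /dec subrK e; apply; lia.
Qed.

Lemma tstep_tape f (y1 y2 z : int) : ruled f -> crossed f ->
  sends f (2 * y1) (2 * y2) (2 * z) -> tstep (tape f y1) (tape f y2).
Proof.
move=> Rf Zf [lt s1 o1 s s2].
have cornE y : corner (cr f (y - 1) (z - 1)) true true = sym (f (2 * y) (2 * z)).
  by apply: cornerE => //=; lia.
have start : msg (cr f y1 (z - 1)) = Some (tape f y1).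
  have [vE [_ _ _]] := vwallP Rf Zf y1 (z - 1).
  rewrite /msg_rule cornE s1 -vE => ->.
  have := @ruledE _ f (2 * y1) (2 * z) (2 * y1 - 1) (2 * (z - 1) + 1) Rf
    ltac:(lia) ltac:(lia).
  by rewrite /tile_rule s1 => -[_ _ -> _]; rewrite o1 tape_rt.
have pass d : y1 + d%:Z < y2 -> msg (cr f (y1 + d%:Z) (z - 1)) = Some (tape f y1).
  elim: d => [|d IH] l; first by rewrite addr0.
  have [_ [_ _ _]] := vwallP Rf Zf (y1 + d.+1%:Z) (z - 1).
  rewrite /msg_rule cornE s; last by lia.
  have -> : y1 + d.+1%:Z - 1 = y1 + d%:Z by lia.
  by move=> ->; apply: IH; lia.
have [_ [_ _ _]] := vwallP Rf Zf y2 (z - 1).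
rewrite /msg_rule cornE s2 => -[_]; rewrite tape_rt //; apply.
rewrite -(pass (absz (y2 - 1 - y1)%R)); last by lia.
by congr (msg (cr _ _ _)); lia.
Qed.

Definition level0 f : Prop := forall m n,
  tleft (rt (cr f m n)) /\ (ox (cr f m n) -> tini (rt (cr f m n))).

Definition level_bit (F : nat -> int -> int -> tile) i : bool :=
  tbit (rt (cr (F i) 0 0)).

Section Array.
Variables (F : nat -> int -> int -> tile) (p q : nat -> bool).
Hypotheses (FC : chain F p q) (F0 : level0 (F 0%N)).

(** Coordinate at level [i] of a line whose coordinate at level [i + d] is [x]. *)
Fixpoint up i d (r : nat -> bool) (x : int) : int :=
  if d is d'.+1 then 2 * (up i.+1 d' r x + (r i)%:Z) else x.

(* Coordinate, at level [J - d], of the column of valuation [J - d] in the chain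
   of left children ending at column [1] of level [J]. *)
Fixpoint left_child J d : int :=
  if d is d'.+1 then 2 * (left_child J d' + (p (J - d)%N)%:Z) - 1 else 1.

Lemma left_child_odd J d : exists z, left_child J d = 2 * z + 1.
Proof.
case: d => [|d] /=; first by exists 0.
by exists (left_child J d + (p (J - d.+1)%N)%:Z - 1); lia.
Qed.

(** Going down from level [J], each column of valuation j + 1 gets as left neighbour a column of
    valuation j that sends it a message; their tapes are the successive times. This descent has to
    start somewhere, hence one array for each height. *)
Lemma chain_array J : exists t : nat -> nat -> W, tri_array (level_bit F) J t.
Proof.
pose c j := left_child J (J - j).
(* At level [i] the column of time [j] has coordinate [2 * y i j]. *)
pose y i j := up i.+1 (j - i.+1) p (c j) + (p i)%:Z.
have cS j : (j < J)%N -> c j = 2 * (c j.+1 + (p j)%:Z) - 1.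
  move=> lt; rewrite {1}/c; case E: (J - j)%N => [|d]; first by lia.
  rewrite [LHS]/= /c.
  have -> : (J - d.+1)%N = j by lia.
  by have -> : (J - j.+1)%N = d by lia.
have cO j : exists z, c j = 2 * z + 1 by apply: left_child_odd.
exists (fun i j => tape (F i) (y i j)); split.
- by move=> i j _; rewrite /level_bit /tape; case: (FC i) => R Z _; apply: tbit_cr.
- move=> j lt; split; first by case: (F0 (y 0%N j - 1) 0).
  rewrite /y; have -> : (j - j.-1.+1 = 0)%N by lia.
  rewrite /=; have [z ->] := cO j.
  by case: (FC j.-1) => R Z E; apply: (tlast_tape R Z E); case: (FC j.-1.+1).
- move=> J0; have [R Z E] := FC 0%N; have [R1 Z1 E1] := FC 1%N.
  rewrite /y /=; have [z ->] := cO 1%N.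
  rewrite /tape; apply: (F0 _ 0).2.
  have -> : 2 * z + 1 + (p 0%N)%:Z - 1 = 2 * z + (p 0%N)%:Z by lia.
  by rewrite (@facing _ _ (q 0%N)) // -E.
- move=> i j lt; have [R Z E] := FC i; have [R1 Z1 E1] := FC i.+1.
  have -> : y i j = 2 * y i.+1 j + (p i)%:Z.
    rewrite {1}/y; case D: (j - i.+1)%N => [|d]; first by lia.
    by rewrite /= /y; have -> : (j - i.+2)%N = d by lia.
  exact: (tadj_tape R Z E Z1).
- move=> i j lt; have [R Z E] := FC i.
  (* the message is visible at level [j] and refines down to level [i] *)
  have H d k : (d + k)%N = j ->
      exists w, sends (F k) (up k d p (c j)) (up k d.+1 p (c j.+1)) w.
    elim: d k => [|d IH] k e.
      exists 1; rewrite /= -e !add0n cS; last by lia.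
      have [Rk Zk Ek] := FC k; have [_ Zk1 _] := FC k.+1.
      set u := c k.+1 + _.
      split; first by lia.
      + by have [+ _ _ _] := Zk (u - 1) 0; rewrite (_ : 2 * (u - 1) + 1 = 2 * u - 1) //; lia.
      + have -> : 2 * u - 1 = 2 * (u - 1) + 1 by lia.
        rewrite -[hl _]/(cr (F k) (u - 1) 0) /u.
        have [z ->] := cO k.+1.
        have -> : 2 * z + 1 + (p k)%:Z - 1 = 2 * z + (p k)%:Z by lia.
        by rewrite (@facing _ _ (q k)) // -Ek.
      + by move=> m; lia.
      + by have [_ _ + _] := Zk u 0.
    have [Rk Zk Ek] := FC k.
    have [w Hw] := IH k.+1 ltac:(lia).
    exists (2 * (w + (q k)%:Z)).
    by apply: sends_refine => //; rewrite -Ek.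
  have D1 : (j - i = (j - i.+1).+1)%N by lia.
  have [w Hw] := H (j - i.+1)%N i.+1 ltac:(lia).
  have Hw' : sends (F i) (2 * y i j) (2 * y i j.+1) (2 * (w + (q i)%:Z)).
    rewrite {2}/y subSS D1 /y.
    by apply: sends_refine => //; rewrite -E.
  exact: (tstep_tape R Z Hw').
Qed.

End Array.
End Chains.

(** * Local rules, phases, and rigidity of tiled squares *)

Section Levels.
Variable W : trisys.
Local Notation tile := (tile W).
Implicit Types f g : int -> int -> tile.

(** Parity bits impose the first level of the hierarchy; the further ones are forced by
    [crossed_dec]. Level 0 carries the left end of each tape, and a column on the right of a level-0
    cross with [ox] has valuation 1, the initial time. *)
Definition base_rule f : Prop :=
  [/\ [/\ px (f 1 0) = ~~ px (f 0 0), py (f 1 0) = py (f 0 0),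
          px (f 0 1) = px (f 0 0) & py (f 0 1) = ~~ py (f 0 0)],
      tile_rule (f 0 0) (f (-1) 0) (f 0 (-1)),
      px (f 0 0) -> py (f 0 0) ->
        [/\ sym (f 0 0) = None,
            forall a b, corner (hl (f 0 0)) a b = sym (f (sgn a) (sgn b)),
            tleft (rt (hl (f 0 0))) & ox (hl (f 0 0)) -> tini (rt (hl (f 0 0)))],
      px (f 0 0) -> ~~ py (f 0 0) -> sym (f 0 0) = Some true &
      ~~ px (f 0 0) -> py (f 0 0) -> sym (f 0 0) = Some false].

Definition valid f : Prop := forall m n, base_rule (shift m n f).

Lemma base_rule_local f g :
  (forall i j : int, -1 <= i <= 1 -> -1 <= j <= 1 -> f i j = g i j) ->
  base_rule f -> base_rule g.
Proof.
by move=> E; rewrite /base_rule !E // => -[? ? H ? ?]; split=> // p q;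
  have [? H' ? ?] := H p q; split=> // a b; rewrite H' E //; case: a b => [] [].
Qed.

Definition even_origin f := px (f 0 0) = false /\ py (f 0 0) = false.

Lemma valid_shift f p q : valid f -> valid (shift p q f).
Proof.
move=> V m n; have := V (m + p) (n + q).
by apply: base_rule_local => i j _ _; rewrite !shiftE !addrA.
Qed.

Lemma valid_parity f m n : valid f ->
  [/\ px (f (m + 1) n) = ~~ px (f m n), py (f (m + 1) n) = py (f m n),
      px (f m (n + 1)) = px (f m n) & py (f m (n + 1)) = ~~ py (f m n)].
Proof.
move=> /(_ m n) [] [] + + + + _ _ _ _; rewrite !shiftE !add0r ![1 + _]addrC.
by move=> -> -> -> ->.
Qed.

Lemma valid_even f : valid f -> exists p q : bool, even_origin (shift p%:Z q%:Z f).
Proof.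
move=> V; exists (px (f 0 0)), (py (f 0 0)); rewrite /even_origin !shiftE !add0r.
have [a b c d] := valid_parity 0 0 V; have [a' b' c' d'] := valid_parity 0 1 V.
rewrite !add0r in a b c d a' b' c' d'.
by case p: (px (f 0 0)); case q: (py (f 0 0)); rewrite ?(a,b,c,d,a',b',c',d') ?p ?q.
Qed.

Lemma parity_agree f g m n : valid f -> valid g ->
  px (f 0 0) = px (g 0 0) -> py (f 0 0) = py (g 0 0) ->
  px (f m n) = px (g m n) /\ py (f m n) = py (g m n).
Proof.
move=> V V' ex ey.
pose s m n := (px (f m n) == px (g m n)) && (py (f m n) == py (g m n)).
suff /andP[/eqP -> /eqP ->] : s m n by [].
have -> : s m n = s 0 n.
  apply: (int_step_eq (s := fun m => s m n)) => k; rewrite /s.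
  have [-> -> _ _] := valid_parity k n V; have [-> -> _ _] := valid_parity k n V'.
  by rewrite (inj_eq negb_inj).
have -> : s 0 n = s 0 0.
  apply: (int_step_eq (s := fun n => s 0 n)) => k; rewrite /s.
  have [_ _ -> ->] := valid_parity 0 k V; have [_ _ -> ->] := valid_parity 0 k V'.
  by rewrite (inj_eq negb_inj).
by rewrite /s ex ey !eqxx.
Qed.

Lemma valid_ruled f : valid f -> ruled f.
Proof. by move=> V m n; have [_ + _ _ _] := V m n; rewrite !shiftE !add0r ![-1 + _]addrC. Qed.

Lemma valid_crossed f : valid f -> even_origin f -> crossed f /\ level0 f.
Proof.
move=> V [ex ey].
have pxE m n : px (f (2 * m) n) = false.
  rewrite -(int_step_eq (s := fun n => px (f (2 * m) n)) _ 0); last first.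
    by move=> k; have [_ _ -> _] := valid_parity (2 * m) k V.
  rewrite -ex -(int_step_eq (s := fun m => px (f (2 * m) 0)) _ 0 m) // => k.
  have -> : 2 * (k + 1) = 2 * k + 1 + 1 by lia.
  have [-> _ _ _] := valid_parity (2 * k + 1) 0 V.
  by have [-> _ _ _] := valid_parity (2 * k) 0 V; rewrite negbK.
have pyE m n : py (f m (2 * n)) = false.
  rewrite -(int_step_eq (s := fun m => py (f m (2 * n))) _ 0); last first.
    by move=> k; have [_ -> _ _] := valid_parity k (2 * n) V.
  rewrite -ey -(int_step_eq (s := fun n => py (f 0 (2 * n))) _ 0 n) // => k.
  have -> : 2 * (k + 1) = 2 * k + 1 + 1 by lia.
  have [_ _ _ ->] := valid_parity 0 (2 * k + 1) V.
  by have [_ _ _ ->] := valid_parity 0 (2 * k) V; rewrite negbK.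
have pxO m n : px (f (2 * m + 1) n) = true.
  by have [-> _ _ _] := valid_parity (2 * m) n V; rewrite pxE.
have pyO m n : py (f m (2 * n + 1)) = true.
  by have [_ _ _ ->] := valid_parity m (2 * n) V; rewrite pyE.
have VE m n := V m n; rewrite /base_rule in VE.
split=> m n.
- have [_ _ + _ _] := VE (2 * m + 1) (2 * n + 1).
  rewrite !shiftE !add0r pxO pyO => /(_ isT isT) [s1 s4 _ _].
  have [_ _ _ + _] := VE (2 * m + 1) (2 * n).
  rewrite !shiftE !add0r pxO pyE => /(_ isT isT) s2.
  have [_ _ _ _ +] := VE (2 * m) (2 * n + 1).
  rewrite !shiftE !add0r pxE pyO => /(_ isT isT) s3.
  by split=> // a b; rewrite s4 !shiftE ![sgn _ + _]addrC.
- have [_ _ + _ _] := VE (2 * m + 1) (2 * n + 1).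
  by rewrite !shiftE !add0r pxO pyO => /(_ isT isT) [_ _ ? ?].
Qed.

(* [g] has its first [k] levels of hierarchy in phase with the origin, with bits [b]. *)
Fixpoint levels k (b : nat -> bool) g : Prop :=
  if k is k'.+1 then
    [/\ ruled g, crossed g, tbit (rt (cr g 0 0)) = b 0%N & levels k' (b \o succn) (dec g)]
  else ruled g.

Lemma levels_shift k b g i j : levels k b g ->
  levels k b (shift (2 ^+ k * i) (2 ^+ k * j) g).
Proof.
elim: k b g => [|k IH] b g /=; first exact: ruled_shift.
move=> [R Z B L]; rewrite !exprS -!mulrA.
have Z' : crossed (shift (2 * (2 ^+ k * i)) (2 * (2 ^+ k * j)) g).
  move=> m n; rewrite !shiftE.
  have E x y : 2 * x + 2 * y = 2 * (x + y) :> int by lia.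
  have E' x y : 2 * x + 1 + 2 * y = 2 * (x + y) + 1 :> int by lia.
  rewrite !E !E'; have [-> -> -> C] := Z (m + 2 ^+ k * i) (n + 2 ^+ k * j).
  by split=> // a c; rewrite C shiftE; congr (sym (g _ _)); lia.
split=> //; first exact: ruled_shift.
- rewrite -B /cr shiftE -/(cr g _ _).
  by have := tbit_cr R Z (2 ^+ k * i) (2 ^+ k * j) 0 0; rewrite /cr => <-;
    congr (tbit (rt (hl (g _ _)))); lia.
- have := IH _ _ L; congr (levels _ _ _).
  by apply/funext => m; apply/funext => n; rewrite /dec !shiftE !mulrDr.
Qed.

(** The phases add up to the sum over i < k of 2^(i+1) p_i, which is at most 2^(k+1) - 2. *)
Lemma chain_levels (F : nat -> int -> int -> tile) p q k : chain F p q ->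
  exists a c : nat, [/\ (a.+2 <= 2 ^ k.+1)%N, (c.+2 <= 2 ^ k.+1)%N &
    levels k (level_bit F) (shift a%:Z c%:Z (F 0%N))].
Proof.
elim: k F p q => [|k IH] F p q C.
  by exists 0%N, 0%N; split=> //=; apply: ruled_shift; case: (C 0%N).
have [a [c [la lc L]]] := IH (F \o succn) (p \o succn) (q \o succn) (fun i => C i.+1).
have [R Z E] := C 0%N.
exists (2 * (a + p 0%N))%N, (2 * (c + q 0%N))%N.
have EX : shift (2 * (a + p 0%N))%N%:Z (2 * (c + q 0%N))%N%:Z (F 0%N) =
    shift (2 ^+ 1 * (a + p 0%N)%N%:Z) (2 ^+ 1 * (c + q 0%N)%N%:Z) (F 0%N).
  by rewrite !PoszM expr1.
have [] : levels 1 (level_bit F)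
    (shift (2 * (a + p 0%N))%N%:Z (2 * (c + q 0%N))%N%:Z (F 0%N)).
  by rewrite EX; apply: levels_shift; split=> //=; apply: ruled_dec.
move=> R' Z' B' _; split; [rewrite expnS | rewrite expnS | split=> //].
- by move: (p 0%N) => [] /=; lia.
- by move: (q 0%N) => [] /=; lia.
have := L; congr (levels _ _ _).
by apply/funext => m; apply/funext => n; rewrite /= E /dec !shiftE; congr (F _ _ _); lia.
Qed.

Definition agree f g m n : Prop :=
  [/\ sym (f m n) = sym (g m n), hl (f m n) = hl (g m n) & vl (f m n) = vl (g m n)].

Lemma label_ext (c c' : label W) : cross_rule c -> cross_rule c' ->
  (forall a b, corner c a b = corner c' a b) -> rt c = rt c' -> lf c = lf c' ->
  msg c = msg c' -> c = c'.
Proof.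
move=> C C' K r l m.
have [eo eo'] : ox c = ox c' /\ oy c = oy c'.
  by apply: (cross_orient C); rewrite K; case: C'.
case: c c' K r l m eo eo' {C C'} => [[[[a b] k] [x y]] z] [[[[a' b'] k'] [x' y']] z'].
rewrite /corner /rt /lf /msg /ox /oy /= => K -> -> -> -> ->.
by congr (_, _, _, _); apply/ffunP => -[u v]; apply: K.
Qed.

Lemma tile_ext (t t' : tile) : px t = px t' -> py t = py t' -> sym t = sym t' ->
  hl t = hl t' -> vl t = vl t' -> t = t'.
Proof.
by case: t t' => [[[[a b] s] h] v] [[[[a' b'] s'] h'] v']; rewrite /px /py /sym /hl /vl /=
  => -> -> -> -> ->.
Qed.

(** By induction the frame determines the even sites, and these give the corners of the crosses at
    odd sites. The tape cells of these crosses are constant along columns, hence read on the lower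
    side, and their messages propagate from the left side by [msg_rule], which is deterministic from
    left to right. *)
Lemma frame_determines k b b' f g : levels k b f -> levels k b' g ->
  (forall m n, 0 <= m <= 2 ^+ k -> 0 <= n <= 2 ^+ k ->
     [\/ m = 0, m = 2 ^+ k, n = 0 | n = 2 ^+ k] -> agree f g m n) ->
  forall m n, 0 <= m <= 2 ^+ k -> 0 <= n <= 2 ^+ k -> agree f g m n.
Proof.
elim: k b b' f g => [|k IH] b b' f g /=.
  move=> _ _ H m n lm ln; apply: H => //; rewrite expr0 in lm *.
  have [->|->] : m = 0 \/ m = 1 by lia.
    by constructor 1.
  by constructor 2.
move=> [Rf Zf _ Lf] [Rg Zg _ Lg]; rewrite exprS; set D : int := 2 ^+ k => Fr.
have D0 : 0 < D by rewrite exprn_gt0.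
have dE m n : 0 <= m <= D -> 0 <= n <= D -> agree f g (2 * m) (2 * n).
  apply: (IH _ _ _ _ Lf Lg) => {}m {}n lm ln H.
  apply: Fr; [lia | lia | ].
  by case: H => ->; [constructor 1 | constructor 2 | constructor 3 | constructor 4]; lia.
have crE m n : 0 <= m < D -> 0 <= n < D -> cr f m n = cr g m n.
  move=> lm ln.
  have [_ _ _ Cf] := crossP Rf Zf m n; have [_ _ _ Cg] := crossP Rg Zg m n.
  have KE m' a c : 0 <= m' < D -> corner (cr f m' n) a c = corner (cr g m' n) a c.
    move=> lm'; rewrite (@cornerE _ f Zf _ _ _ _ (m' + a%:Z) (n + c%:Z)) //.
    rewrite (@cornerE _ g Zg _ _ _ _ (m' + a%:Z) (n + c%:Z)) //.
    by case: (dE (m' + a%:Z) (n + c%:Z)) => //; case: a; case: c => /=; lia.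
  have VE m' : 0 <= m' < D -> rt (cr f m' n) = rt (cr g m' n) /\ lf (cr f m' n) = lf (cr g m' n).
    move=> lm'.
    have [_ _ cf _] := crossP Rf Zf m' 0; have [_ _ cg _] := crossP Rg Zg m' 0.
    have E0 : cr f m' 0 = cr g m' 0.
      by rewrite -cf -cg; case: (Fr (2 * m' + 1) (2 * 0) ltac:(lia) ltac:(lia) ltac:(constructor 3; exact: mulr0)).
    rewrite (rt_col Rf Zf _ _ 0) (rt_col Rg Zg _ _ 0) E0; split=> //.
    rewrite (lf_rt Rf Zf) (lf_rt Rg Zg) (rt_col Rf Zf _ _ 0) (rt_col Rg Zg _ _ 0).
    by rewrite -(lf_rt Rf Zf) -(lf_rt Rg Zg) E0.
  have [rE lE] := VE m lm.
  apply: label_ext => //; first by move=> *; apply: KE.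
  have : forall d : nat, d%:Z < D -> msg (cr f d%:Z n) = msg (cr g d%:Z n).
    elim=> [|d IHd] ld.
      have [<- _ _ _] := crossP Rf Zf 0 n; have [<- _ _ _] := crossP Rg Zg 0 n.
      have l0 : (0 : int) <= 2 * 0 <= 2 * D by rewrite mulr0 lexx mulr_ge0 ?ltW.
      by case: (Fr (2 * 0) (2 * n + 1) l0 ltac:(lia) ltac:(constructor 1; exact: mulr0)) => _ -> _.
    have [vf [_ _ _ Mf]] := vwallP Rf Zf d.+1%:Z n.
    have [vg [_ _ _ Mg]] := vwallP Rg Zg d.+1%:Z n.
    have [_ _ vE] := dE d.+1%:Z n ltac:(lia) ltac:(lia).
    have e : d.+1%:Z - 1 = d%:Z by lia.
    move: Mf Mg; rewrite /msg_rule e KE; last by lia.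
    rewrite vE (VE d%:Z _).1; last by lia.
    rewrite IHd; last by lia.
    by case: (corner _ _ _) => [[]|]; [move=> -> -> | move=> [-> _] [-> _] | move=> -> ->].
  move=> /(_ (absz m)); have -> : (absz m)%:Z = m by lia.
  by apply; lia.
move=> m n lm ln.
have [e|NF] := pselect [\/ m = 0, m = 2 * D, n = 0 | n = 2 * D]; first exact: Fr.
have lm' : 0 < m < 2 * D.
  have : m <> 0 by move=> e; apply: NF; constructor 1.
  have : m <> 2 * D by move=> e; apply: NF; constructor 2.
  by lia.
have ln' : 0 < n < 2 * D.
  have : n <> 0 by move=> e; apply: NF; constructor 3.
  have : n <> 2 * D by move=> e; apply: NF; constructor 4.
  by lia.
have [[x ex]|[x ex]] := int_even_odd m; have [[y ey]|[y ey]] := int_even_odd n; subst m n.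
- by apply: dE; lia.
- have [_ _ vE] := dE x y ltac:(lia) ltac:(lia).
  have [_ _ s _] := Zf x y; have [_ _ s' _] := Zg x y.
  have [v _] := vwallP Rf Zf x y; have [v' _] := vwallP Rg Zg x y.
  have [h _ _ _] := crossP Rf Zf x y; have [h' _ _ _] := crossP Rg Zg x y.
  by split; rewrite ?s ?s' ?v ?v' ?h ?h' // crE //; lia.
- have [_ hE _] := dE x y ltac:(lia) ltac:(lia).
  have [_ s _ _] := Zf x y; have [_ s' _ _] := Zg x y.
  have [v _] := hwallP Rf Zf x y; have [v' _] := hwallP Rg Zg x y.
  have [_ _ h _] := crossP Rf Zf x y; have [_ _ h' _] := crossP Rg Zg x y.
  by split; rewrite ?s ?s' ?v ?v' ?h ?h' // crE //; lia.
- have [s _ _ _] := Zf x y; have [s' _ _ _] := Zg x y.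
  have [_ h _ _] := crossP Rf Zf x y; have [_ h' _ _] := crossP Rg Zg x y.
  have c : cr f x y = cr g x y by apply: crE; lia.
  by split; rewrite ?s ?s' ?h ?h'.
Qed.

Definition row_bit (t : tile) : bool := tbit (rt (hl t)).

Lemma levels_row_bit k b g m (n : nat) : levels k b g -> (0 < n < 2 ^ k)%N ->
  row_bit (g m n%:Z) = b (logn 2 n).
Proof.
rewrite /row_bit; elim: k b g m n => [|k IH] b g m n /=; first by case: n => [|[]].
move=> [R Z B L] /andP[n0 ln].
have [e|e] : n = (2 * n./2)%N \/ n = (2 * n./2).+1%N by lia.
  have n2 : (0 < n./2)%N by lia.
  have -> : logn 2 n = (logn 2 n./2).+1.
    by rewrite {1}e lognM // (@pfactorK 2 1).
  rewrite -[b _]/((b \o succn) (logn 2 n./2)).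
  rewrite -(IH (b \o succn) (dec g) (if odd (absz m) then (m - 1) %/ 2 else m %/ 2)%Z n./2 L);
    last by rewrite n2 /=; move: ln; rewrite expnS; lia.
  have {1}-> : n%:Z = 2 * n./2%:Z by lia.
  rewrite /dec; have [[x ->]|[x ->]] := int_even_odd m.
  - by congr (tbit (rt (hl (g _ _)))); case: ifP; lia.
  - have [-> _] := hwallP R Z x n./2%:Z.
    by congr (tbit (rt (hl (g _ _)))); case: ifP; lia.
have -> : logn 2 n = 0%N.
  by rewrite lognE; case: ifP => // /and3P[_ _]; rewrite dvdn2 e /= oddM.
rewrite -B; have {1}-> : n%:Z = 2 * n./2%:Z + 1 by lia.
have [[x ->]|[x ->]] := int_even_odd m.
- by have [-> _ _ _] := crossP R Z x n./2%:Z; apply: tbit_cr.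
- by apply: (tbit_cr R Z x n./2%:Z 0 0).
Qed.

End Levels.

(** * A valid tiling from a triangular array *)

Section Explicit.

(* The 2-adic valuation of [x - 1/3], finite for every integer [x]. *)
Definition vv (x : int) : nat := logn 2 (absz (3 * x - 1)%R).

Local Notation D i := (2 ^+ i : int).

Lemma D_gt0 i : 0 < D i. Proof. by rewrite exprn_gt0. Qed.

Lemma vvP i x : reflect (exists k, 3 * x - 1 = D i * k) (i <= vv x)%N.
Proof.
rewrite /vv -pfactor_dvdn //; last by rewrite absz_gt0; lia.
apply: (iffP idP) => [|[k ->]]; last by rewrite abszM abszX dvdn_mulr.
have -> : (2 ^ i)%N = absz (D i) by rewrite abszX.
by rewrite -dvdzE => /dvdzP[k ->]; exists k; rewrite mulrC.
Qed.

Lemma vv_add i x k : (i <= vv x)%N -> (i <= vv (x + D i * k))%N.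
Proof.
by move=> /vvP[c e]; apply/vvP; exists (c + 3 * k); rewrite [RHS]mulrDr -e; ring.
Qed.

Lemma vv_sub i x y : (i <= vv x)%N -> (i <= vv y)%N -> exists k, y = x + D i * k.
Proof.
move=> /vvP[c e] /vvP[c' e'].
have : (D i %| 3 * (y - x))%Z.
  by apply/dvdzP; exists (c' - c); rewrite mulrBl ![_ * D i]mulrC -e -e'; lia.
rewrite Gauss_dvdzr; last by rewrite coprimezE abszX coprimeXl.
by move=> /dvdzP[k]; exists k; lia.
Qed.

Lemma vv_flip i x : (i <= vv x)%N ->
  (i < vv (x + D i))%N = ~~ (i < vv x)%N.
Proof.
move=> /vvP[c e]; have D0 := D_gt0 i.
apply/vvP/negP => [[k h] /vvP[k' h']|h].
- have : D i * (3 - 2 * k + 2 * k') = 0.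
    by move: h h'; rewrite !exprS => h h'; lia.
  by move/eqP; rewrite mulf_eq0 gt_eqF //=; lia.
- have [[k ek]|[k ek]] := int_even_odd c.
    by case: h; apply/vvP; exists k; rewrite e ek exprS; lia.
  by exists (k + 2); rewrite exprS; move: e; rewrite ek; lia.
Qed.

Lemma vv_flipN i x : (i <= vv x)%N ->
  (i < vv (x - D i))%N = ~~ (i < vv x)%N.
Proof.
move=> h; rewrite -{2}(subrK (D i) x) vv_flip ?negbK //.
by have := vv_add (-1) h; rewrite mulrN1.
Qed.

Lemma vv_le i x : (i <= vv x)%N -> (i <= vv (x + D i))%N /\ (i <= vv (x - D i))%N.
Proof.
move=> h; have := vv_add 1 h; have := vv_add (-1) h.
by rewrite mulr1 mulrN1.
Qed.

Lemma vv_lt i x : (i < vv x)%N -> vv (x + D i) = i /\ vv (x - D i) = i.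
Proof.
move=> h; have h' := ltnW h.
have := vv_flip h'; have := vv_flipN h'; have := vv_le h'; rewrite h; lia.
Qed.

Lemma vv_eq i x : vv x = i ->
  [/\ (i < vv (x + D i))%N, (i < vv (x - D i))%N &
      (vv (x - D i) == i.+1) = ~~ (vv (x + D i) == i.+1)].
Proof.
move=> h; have h' : (i <= vv x)%N by rewrite h.
have := vv_flip h'; have := vv_flipN h'; rewrite h ltnn /= => l1 l2.
split=> //; have := vv_flip l1; rewrite exprS.
have -> : x - D i + 2 * D i = x + D i by lia.
lia.
Qed.

Lemma vv_face i x : vv x = i -> let o := vv (x + D i) == i.+1 in
  vv (x + sgn o * D i) = i.+1 /\ (i.+1 < vv (x + sgn (~~ o) * D i))%N.
Proof.
move=> /vv_eq[h1 h2 h3] /=; case: (vv (x + D i) =P i.+1) h3 => h /= h3; rewrite /sgn /= ?mul1r ?mulN1r.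
  by rewrite ltn_neqAle eq_sym h3 h.
by rewrite ltn_neqAle h1 eq_sym (introF eqP h) (eqP h3).
Qed.

(** The greatest [y <= x] with [i <= vv y]; such integers form a class modulo 2^i. *)
Fixpoint lo i (x : int) : int :=
  if i is i'.+1 then
    let y := lo i' x in if (i <= vv y)%N then y else y - D i'
  else x.

Lemma loP i x : [/\ (i <= vv (lo i x))%N, lo i x <= x & x < lo i x + D i].
Proof.
elim: i => [|i [h l1 l2]] /=; first by rewrite expr0; split=> //; lia.
have D0 := D_gt0 i.
case: ifP => [h'|h']; rewrite exprS; split=> //; try lia.
by rewrite vv_flipN // h'.
Qed.

Lemma loE i x y : (i <= vv y)%N -> y <= x -> x < y + D i -> lo i x = y.
Proof.
move=> h l1 l2; have [h' l1' l2'] := loP i x; have D0 := D_gt0 i.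
have [k e] := vv_sub h h'.
have [lt|gt|k0] := ltgtP k 0; last by rewrite e k0; lia.
- have : D i * k <= D i * -1 by rewrite ler_pM2l //; lia.
  by lia.
- have : D i * 1 <= D i * k by rewrite ler_pM2l //; lia.
  by lia.
Qed.

(* The centre of the level-[i] arm covering the edge from [x] to [x + 1]. *)
Definition cu i x : int := let y := lo i x in if vv y == i then y else y + D i.

Lemma cuE i x u : vv u = i -> u - D i <= x -> x < u + D i -> cu i x = u.
Proof.
move=> e l1 l2; have [h1 h2 _] := vv_eq e; have D0 := D_gt0 i; rewrite /cu.
have [le|lt] := lerP u x.
  by rewrite (@loE _ _ u) ?e ?eqxx.
rewrite (@loE _ _ (u - D i)) //; [|exact: ltnW|lia].
by rewrite gtn_eqF //; lia.
Qed.

Lemma cuP i x : [/\ vv (cu i x) = i, cu i x - D i <= x & x < cu i x + D i].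
Proof.
have [h1 h2 h3] := loP i x; have D0 := D_gt0 i; rewrite /cu.
case: eqP => [e|ne]; first by split=> //; lia.
split; try lia.
by case: (@vv_lt i (lo i x)); first by lia.
Qed.

Definition cmp (a b : nat) : option bool :=
  if a == b then None else Some (a < b)%N.

Lemma vv0 x : (vv (x + 1) == 0%N) = ~~ (vv x == 0%N).
Proof. by have := @vv_flip 0%N x (leq0n _); rewrite expr0 !lt0n => /negb_inj ->. Qed.

Section Structure.
Variables (W : trisys) (b : nat -> bool) (t : nat -> nat -> W).
Hypothesis tA : forall J, tri_array b J t.

(** Label of the cross centred at [(u, y)], when [vv u = vv y]. The row above it has valuation [j],
    and [x0] is the last column up to [u] of valuation at least [j]: a message is under way when
    [x0] has valuation [j] and the next such column [j + 1]. *)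
Definition mkl (u y : int) : label W :=
  let i := vv u in
  ((vv (u + D i) == i.+1, vv (y + D i) == i.+1),
   [ffun ab : bool * bool => cmp (vv (u + sgn ab.1 * D i)) (vv (y + sgn ab.2 * D i))],
   (t i (vv (u - D i)), t i (vv (u + D i))),
   let j := vv (y + D i) in let x0 := lo j u in
   if (vv x0 == j) && (vv (x0 + D j) == j.+1) then Some (t i j) else None).

Definition structure (x y : int) : tile W :=
  ((vv x == 0%N, vv y == 0%N), cmp (vv x) (vv y), mkl (cu (vv y) x) y, mkl x (cu (vv x) y)).

Lemma mkl_corner u y a c :
  corner (mkl u y) a c = cmp (vv (u + sgn a * D (vv u))) (vv (y + sgn c * D (vv u))).
Proof. by rewrite /corner /mkl /= ffunE. Qed.

Lemma ox_mkl u y : ox (mkl u y) = (vv (u + D (vv u)) == (vv u).+1). Proof. by []. Qed.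
Lemma oy_mkl u y : oy (mkl u y) = (vv (y + D (vv u)) == (vv u).+1). Proof. by []. Qed.
Lemma rt_mkl u y : rt (mkl u y) = t (vv u) (vv (u + D (vv u))). Proof. by []. Qed.
Lemma lf_mkl u y : lf (mkl u y) = t (vv u) (vv (u - D (vv u))). Proof. by []. Qed.
Lemma msg_mkl u y : msg (mkl u y) =
  let j := vv (y + D (vv u)) in let x0 := lo j u in
  if (vv x0 == j) && (vv (x0 + D j) == j.+1) then Some (t (vv u) j) else None.
Proof. by []. Qed.

Lemma tbit_t i j : (i < j)%N -> tbit (t i j) = b i.
Proof. by move=> l; case: (tA j) => -> // *; rewrite l leqnn. Qed.

Lemma mkl_cross x y : vv x = vv y -> cross_rule (mkl x y).
Proof.
move=> e.
have [x1 x2] := vv_face (erefl (vv x)); have [y1 y2] := vv_face (esym e).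
split; rewrite ?mkl_corner ?ox_mkl ?oy_mkl ?rt_mkl ?lf_mkl.
- by rewrite x1 y1 /cmp eqxx.
- by rewrite y1 /cmp gtn_eqF //; congr Some; apply/negbTE; rewrite -leqNgt ltnW.
- by rewrite x1 /cmp ltn_eqF // y2.
- by have [h1 h2 _] := vv_eq (erefl (vv x)); rewrite !tbit_t.
- by move=> /eqP ->; have [_ + _ _ _] := tA (vv x).+1; case/(_ (vv x).+1 (leqnn _)).
Qed.

Lemma mkl_hwall x y : (vv x < vv y)%N ->
  hwall_rule (mkl (cu (vv y) x) y) (mkl x (y - D (vv x))) (mkl x (y + D (vv x))).
Proof.
set i := vv x => lt; have D0 := D_gt0 i.
have [x1 x2 x3] := vv_eq (erefl i : vv x = i).
have f1 := vv_flip lt.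
split; rewrite ?ox_mkl ?oy_mkl -/i //.
  rewrite subrK; move: f1; rewrite exprS.
  have -> : y + 2 * D i = y + D i + D i by lia.
  have := (vv_le lt).1; rewrite exprS.
  have -> : y + 2 * D i = y + D i + D i by lia.
  lia.
rewrite subrK => /eqP ey; rewrite ey.
case ho: (vv (x + D i) == i.+1) x3 => x3.
  have -> : cu i.+1 x = x + D i.
    by apply: cuE; rewrite ?exprS ?(eqP ho) //; lia.
  split; split; rewrite ?mkl_corner ?ox_mkl ?oy_mkl ?lf_mkl -/i ?subrK ?ho ?ey ?eqxx /=
    ?(eqP ho).
  - by rewrite /sgn /=; congr cmp; congr vv; rewrite exprS; lia.
  - move=> _; have -> : x + D i - D i.+1 = x - D i by rewrite exprS; lia.
    by case: (tA (vv (x - D i))) => _ _ _ + _; apply; rewrite leqnn andbT; lia.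
  - have -> : (vv (y + D i + D i) == i.+1) = false.
      move: f1; rewrite exprS ey.
      have -> : y + 2 * D i = y + D i + D i by lia.
      lia.
    by rewrite /sgn /=; congr cmp; congr vv; rewrite exprS; lia.
  - move=> _; have -> : x + D i - D i.+1 = x - D i by rewrite exprS; lia.
    by case: (tA (vv (x - D i))) => _ _ _ + _; apply; rewrite leqnn andbT; lia.
have hn : vv (x - D i) = i.+1 by lia.
have -> : cu i.+1 x = x - D i.
  by apply: cuE; rewrite ?exprS ?hn //; lia.
split; split; rewrite ?mkl_corner ?ox_mkl ?oy_mkl ?lf_mkl -/i ?subrK ?ho ?ey ?eqxx /= ?hn //.
- by rewrite /sgn /=; congr cmp; congr vv; rewrite exprS; lia.
- have -> : (vv (y + D i + D i) == i.+1) = false.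
    move: f1; rewrite exprS ey.
    have -> : y + 2 * D i = y + D i + D i by lia.
    lia.
  by rewrite /sgn /=; congr cmp; congr vv; rewrite exprS; lia.
Qed.

Lemma mkl_vwall x y : (vv y < vv x)%N ->
  vwall_rule (mkl x (cu (vv x) y)) (mkl (x - D (vv y)) y) (mkl (x + D (vv y)) y).
Proof.
set i := vv y => lt; have D0 := D_gt0 i.
have [xp xm] := vv_lt lt.
have f1 := vv_flip lt.
have [y1 y2 y3] := vv_eq (erefl i : vv y = i).
split; rewrite ?ox_mkl ?oy_mkl ?rt_mkl ?lf_mkl ?xp ?xm ?subrK ?addrK //.
  move: f1; rewrite exprS.
  have -> : x + 2 * D i = x + D i + D i by lia.
  have := (vv_le lt).1; rewrite exprS.
  have -> : x + 2 * D i = x + D i + D i by lia.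
  lia.
rewrite /msg_rule mkl_corner !msg_mkl rt_mkl xm xp ox_mkl /sgn !mul1r subrK.
set J := vv (y + D i); have DJ : D i.+1 <= D J by rewrite ler_eXn2l.
have DJ0 := D_gt0 J; rewrite exprS in DJ.
rewrite /cmp; case: eqP => [eJ|nJ].
  rewrite (@loE _ _ x) ?eJ ?eqxx //; lia.
case: ltnP => h.
  have [h1 h2 h3] := loP J (x - D i).
  (* Between the two crosses only column [x] has valuation above [i], and it stays below [J]: both
     crosses see the same [x0]. *)
  have no z : (J <= vv z)%N -> x - D i < z -> z <= x + D i -> False.
    move=> hz l1 l2; have hz' : (i < vv z)%N by lia.
    have [k e] := vv_sub lt hz'; rewrite exprS in e.
    have k0 : k = 0.
      have [k1|k1|//] := ltgtP k 0.
      - have : D i * k <= D i * -1 by rewrite ler_pM2l //; lia.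
        by lia.
      - have : D i * 1 <= D i * k by rewrite ler_pM2l //; lia.
        by lia.
    by move: hz; rewrite e k0 mulr0 addr0; lia.
  suff -> : lo J (x + D i) = lo J (x - D i) by [].
  apply: loE => //; first by lia.
  rewrite ltNge; apply/negP => h4.
  by apply: (no _ (vv_le h1).1) => //; lia.
have hJ : (J < vv x)%N by lia.
rewrite (@loE _ (x + D i) x); [|lia|lia|lia].
rewrite gtn_eqF //; split=> // s.
rewrite (@loE _ _ (x - D J)); [|by rewrite (vv_lt hJ).2|lia|lia].
rewrite subrK; case: ifP => // /andP[_ /eqP eJ] [<-].
by rewrite eJ; case: (tA J.+1) => _ _ _ _; apply; rewrite y1 ltnSn.
Qed.

Lemma structure_ruled x y :
  tile_rule (structure x y) (structure (x - 1) y) (structure x (y - 1)).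
Proof.
rewrite /tile_rule /= {1}/sym /= /cmp; case: eqP => [e|ne].
  have Dx := D_gt0 (vv x).
  have c1 : cu (vv y) x = x by apply: cuE; rewrite -?e //; lia.
  have c2 : cu (vv y) (x - 1) = x by apply: cuE; rewrite -?e //; lia.
  have c3 : cu (vv x) y = y by apply: cuE; rewrite ?e //; rewrite -e; lia.
  have c4 : cu (vv x) (y - 1) = y by apply: cuE; rewrite ?e //; rewrite -e; lia.
  by rewrite /hl /vl /= c1 c2 c3 c4; split=> //; apply: mkl_cross.
case: ltnP => h; rewrite /hl /vl /=.
- have D0 := D_gt0 (vv x).
  have [cv cl cr] := cuP (vv y) x; have [_ v2 _] := vv_eq cv.
  have -> : cu (vv y) (x - 1) = cu (vv y) x.
    apply: cuE => //; last by lia.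
    suff : cu (vv y) x - D (vv y) <> x by lia.
    by move=> e; move: v2; rewrite e; lia.
  have [v1 v1'] := vv_lt h.
  have -> : cu (vv x) (y - 1) = y - D (vv x) by apply: cuE => //; lia.
  have -> : cu (vv x) y = y + D (vv x) by apply: cuE => //; lia.
  by split=> //; apply: mkl_hwall.
- have lt : (vv y < vv x)%N by lia.
  have D0 := D_gt0 (vv y).
  have [cv cl cr] := cuP (vv x) y; have [_ v2 _] := vv_eq cv.
  have -> : cu (vv x) (y - 1) = cu (vv x) y.
    apply: cuE => //; last by lia.
    suff : cu (vv x) y - D (vv x) <> y by lia.
    by move=> e; move: v2; rewrite e; lia.
  have [v1 v1'] := vv_lt lt.
  have -> : cu (vv y) (x - 1) = x - D (vv y) by apply: cuE => //; lia.
  have -> : cu (vv y) x = x + D (vv y) by apply: cuE => //; lia.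
  by split=> //; apply: mkl_vwall.
Qed.

Lemma structure_valid : valid structure.
Proof.
move=> x y; split; rewrite ?shiftE ?add0r.
- by rewrite /px /py /= ![1 + _]addrC !vv0.
- by rewrite ![-1 + _]addrC; apply: structure_ruled.
- rewrite /px /py /= => /eqP x0 /eqP y0; rewrite {1}/sym /= x0 y0 /hl /=.
  have -> : cu (vv y) x = x by apply: cuE; rewrite y0 //; lia.
  have [x1 x2 _] := vv_eq x0.
  split=> // [a c||].
  + by rewrite mkl_corner x0 /sym /= expr0 !mulr1 ![sgn _ + _]addrC.
  + by rewrite rt_mkl x0; case: (tA (vv (x + D 0%N))) => _ /(_ (vv (x + D 0%N))) [] // *;
      rewrite x1 leqnn.
  + rewrite ox_mkl rt_mkl x0 => /eqP ->.
    by case: (tA 1%N) => _ _ + _ _; apply.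
- rewrite /px /py /= => /eqP x0 y0; by rewrite /sym /= /cmp x0 eq_sym (negbTE y0) lt0n y0.
- rewrite /px /py /= => x0 /eqP y0; by rewrite /sym /= /cmp y0 (negbTE x0).
Qed.

Lemma structure_row_bit x y : row_bit (structure x y) = b (vv y).
Proof.
rewrite /row_bit /hl /= rt_mkl; have [e _ _] := cuP (vv y) x.
by rewrite e tbit_t //; case: (vv_eq e).
Qed.

End Structure.

End Explicit.

(** * Simulation over the given alphabet *)

Lemma int_ind_step (P : int -> Prop) : P 0 -> (forall m, P m -> P (m + 1)) ->
  (forall m, P m -> P (m - 1)) -> forall m, P m.
Proof.
move=> P0 Pp Pm m; have [le|lt] := lerP 0 m.
  have -> : m = (absz m)%:Z by lia.
  elim: (absz m) => // n /Pp; congr P; lia.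
have -> : m = - (absz m)%:Z by lia.
elim: (absz m) => // n /Pm; congr P; lia.
Qed.

Lemma pow2z k : (2 ^ k)%N%:Z = 2 ^+ k :> int.
Proof. by elim: k => // k IH; rewrite exprS expnS PoszM IH. Qed.

Section Macro.
Variables (W : trisys) (A : finType) (a0 a1 : A) (L np : nat).
Hypothesis a01 : a0 != a1.
Local Notation T := (tile W).
Local Notation C := #|T|.
Hypothesis L3 : (2 < L)%N.
Hypothesis room : (C + np <= L.-1 * (L - 2))%N.

(* Every L x L cell has a bottom row of [a1] and above it a row with a single [a0]; these
   mark the origin of the cell.  The column above this [a0] is constant, and the remaining
   positions carry a one-hot code of the tile followed by the payload. *)
Definition inner_pos (i j : nat) : nat := ((j - 2) * L.-1 + i.-1)%N.

Definition cellok (t : T) (i j : nat) (c : A) : bool :=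
  if j == 0%N then c == a1
  else if j == 1%N then c == (if i == 0%N then a0 else a1)
  else if i == 0%N then c == a0
  else let k := inner_pos i j in
    if (k < C)%N then c == (if k == enum_rank t then a1 else a0)
    else if (k < C + np)%N then row_bit t || (c == a0) else c == a0.

Definition cellval (t : T) (p : nat -> A) (i j : nat) : A :=
  if j == 0%N then a1
  else if j == 1%N then (if i == 0%N then a0 else a1)
  else if i == 0%N then a0
  else let k := inner_pos i j in
    if (k < C)%N then (if k == enum_rank t then a1 else a0)
    else if (k < C + np)%N then (if row_bit t then p (k - C)%N else a0) else a0.

Lemma cellvalP t p i j : cellok t i j (cellval t p i j).
Proof. by rewrite /cellok /cellval; do ! case: ifP => //=; rewrite eqxx // orbT. Qed.

Implicit Types y : int -> int -> A.

Definition block y (X Y : int) (t : T) : Prop :=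
  forall i j : nat, (i < L)%N -> (j < L)%N -> cellok t i j (y (X + i%:Z) (Y + j%:Z)).

Definition mark y (X Y : int) : Prop :=
  (forall i : nat, (i < L)%N -> y (X + i%:Z) Y = a1) /\ y X (Y + 1) = a0.

(** A mark in every window excludes configurations without cells. Around a mark the nine cells must
    decode, and a decoded cell carries a mark itself, so the grid of cells spreads to the whole
    plane. *)
Definition local_ok y : Prop :=
  (exists i j : nat, [/\ (i < L)%N, (j < L)%N & mark y i%:Z j%:Z]) /\
  (mark y 0 0 -> exists g : int -> int -> T, base_rule g /\
     forall i j : int, -1 <= i <= 1 -> -1 <= j <= 1 -> block y (i * L%:Z) (j * L%:Z) (g i j)).

Definition macro_sft y : Prop := forall m n, local_ok (shift m n y).

Lemma local_ok_local y y' :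
  (forall i j : int, `|i| <= 2 * L%:Z -> `|j| <= 2 * L%:Z -> y i j = y' i j) ->
  local_ok y -> local_ok y'.
Proof.
move=> E [[i [j [il jl [M1 M2]]]] G]; split.
  exists i, j; split=> //; split=> [k kl|]; first by rewrite -E ?M1 //; lia.
  by rewrite -E //; lia.
move=> [M1' M2']; have [|g [B gb]] := G.
  by split=> [k kl|]; rewrite E ?M1' //; lia.
have near (m : int) (k : nat) : -1 <= m <= 1 -> (k < L)%N -> `|m * L%:Z + k%:Z| <= 2 * L%:Z.
  move=> lm lk; have : `|m * L%:Z| <= L%:Z by rewrite normrM ler_piMl //; lia.
  by have := ler_normD (m * L%:Z) k%:Z; lia.
exists g; split=> // m n lm ln k l lk ll; rewrite -E; first exact: gb.
- by apply: near.
- by apply: near.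
Qed.

Lemma inner_posK k : (k < L.-1 * (L - 2))%N -> exists i j : nat,
  [/\ (i < L)%N, (j < L)%N, (0 < i)%N, (1 < j)%N & inner_pos i j = k].
Proof.
move=> lt; exists (k %% L.-1).+1, (k %/ L.-1).+2.
have L1 : (0 < L.-1)%N by lia.
have := ltn_pmod k L1 => h.
have : (k %/ L.-1 < L - 2)%N by rewrite ltn_divLR // mulnC.
split=> //; try lia.
by rewrite /inner_pos subn2 /= -divn_eq.
Qed.

Lemma block_inj y X Y t t' : block y X Y t -> block y X Y t' -> t = t'.
Proof.
move=> B B'; have lC : (enum_rank t < C)%N := ltn_ord _.
have [|i [j [il jl i0 j1 e]]] := @inner_posK (enum_rank t); first by lia.
have [nj0 nj1 ni0] : [/\ (j == 0) = false, (j == 1) = false & (i == 0) = false]%N.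
  by split; lia.
have := B i j il jl; have := B' i j il jl; rewrite /cellok e nj0 nj1 ni0 lC eqxx.
move=> /[swap] /eqP ->; case: (nat_of_ord (enum_rank t) =P _) => [e' _|_].
  by apply: enum_rank_inj; apply: val_inj.
by rewrite eq_sym (negbTE a01).
Qed.

Lemma block_mark y X Y t : block y X Y t -> mark y X Y.
Proof.
move=> B; split=> [i il|].
  by have := B i 0%N il ltac:(lia); rewrite /cellok /= addr0 => /eqP.
by have := B 0%N 1%N ltac:(lia) ltac:(lia); rewrite /cellok /= addr0 => /eqP.
Qed.

Lemma mark_shift y m n X Y : mark (shift m n y) X Y <-> mark y (X + m) (Y + n).
Proof.
have e : Y + 1 + n = Y + n + 1 by rewrite addrAC.
rewrite /mark !shiftE e; split=> -[H ->]; split=> // i il.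
  by rewrite -(H i il) shiftE addrAC.
by rewrite shiftE addrAC H.
Qed.

Lemma block_shift y m n X Y t : block (shift m n y) X Y t <-> block y (X + m) (Y + n) t.
Proof.
split=> H i j il jl; have := H i j il jl.
  by rewrite shiftE addrAC (addrAC Y).
by rewrite shiftE (addrAC X) (addrAC Y).
Qed.

Theorem macro_decode y : macro_sft y -> exists (i j : nat) (f : int -> int -> T),
  [/\ (i < L)%N, (j < L)%N, valid f &
      forall m n, block y (i%:Z + m * L%:Z) (j%:Z + n * L%:Z) (f m n)].
Proof.
move=> H; have [[i [j [il jl M0]]] _] := H 0 0.
have {}M0 : mark y i%:Z j%:Z by move: M0; rewrite mark_shift !addr0.
have G X Y : mark y X Y -> exists g : int -> int -> T, base_rule g /\
    forall i j : int, -1 <= i <= 1 -> -1 <= j <= 1 -> block y (X + i * L%:Z) (Y + j * L%:Z) (g i j).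
  move=> M; have [_] := H X Y; rewrite mark_shift !add0r => /(_ M) [g [B gb]].
  exists g; split=> // m n lm ln; have := gb m n lm ln.
  by rewrite block_shift ![_ * _ + _]addrC.
have Mall m n : mark y (i%:Z + m * L%:Z) (j%:Z + n * L%:Z).
  have Mrow : forall m, mark y (i%:Z + m * L%:Z) j%:Z.
    apply: int_ind_step => [|{}m /G[g [_ gb]]|{}m /G[g [_ gb]]]; first by rewrite mul0r addr0.
    - have := block_mark (gb 1 0 isT isT); congr mark; lia.
    - have := block_mark (gb (-1) 0 isT isT); congr mark; lia.
  move: n; apply: int_ind_step => [|n /G[g [_ gb]]|n /G[g [_ gb]]].
  - by rewrite mul0r addr0.
  - have := block_mark (gb 0 1 isT isT); congr mark; lia.
  - have := block_mark (gb 0 (-1) isT isT); congr mark; lia.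
have tileE m n : {t : T | block y (i%:Z + m * L%:Z) (j%:Z + n * L%:Z) t}.
  apply: cid; have [g [_ gb]] := G _ _ (Mall m n).
  by exists (g 0 0); have := gb 0 0 isT isT; rewrite !mul0r !addr0.
exists i, j, (fun m n => sval (tileE m n)); split=> // [m n|m n]; last by case: tileE.
have [g [B gb]] := G _ _ (Mall m n).
apply: base_rule_local B => k l lk ll; rewrite shiftE.
apply: block_inj (gb k l lk ll) _; case: tileE => t /=.
by rewrite -!addrA -!mulrDl ![_ + k]addrC ![_ + l]addrC.
Qed.

Section Encode.
Variables (f : int -> int -> T) (pay : int -> int -> nat -> A).
Hypothesis Vf : valid f.

Definition encode (x z : int) : A :=
  let m := (x %/ L%:Z)%Z in let n := (z %/ L%:Z)%Z in
  cellval (f m n) (pay m n) (absz (x %% L%:Z)%Z) (absz (z %% L%:Z)%Z).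

Lemma divzL (m : int) (i : nat) : (i < L)%N ->
  ((m * L%:Z + i%:Z)%R %/ L%:Z)%Z = m /\ absz ((m * L%:Z + i%:Z)%R %% L%:Z)%Z = i.
Proof.
move=> il; rewrite divzMDl; last by lia.
by rewrite modzMDl divz_small ?modz_small ?addr0 //=; lia.
Qed.

Lemma encodeE m n (i j : nat) : (i < L)%N -> (j < L)%N ->
  encode (m * L%:Z + i%:Z) (n * L%:Z + j%:Z) = cellval (f m n) (pay m n) i j.
Proof. by move=> il jl; rewrite /encode; have [-> ->] := divzL m il; have [-> ->] := divzL n jl. Qed.

Lemma split_int (x : int) : exists (m : int) (i : nat), (i < L)%N /\ x = m * L%:Z + i%:Z.
Proof.
exists (x %/ L%:Z)%Z, (absz (x %% L%:Z)%Z).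
have := divz_eq x L%:Z; have := @modz_ge0 x L%:Z; have := @ltz_pmod x L%:Z.
by move=> h1 h2 h3; split; lia.
Qed.

Lemma encode_block m n : block encode (m * L%:Z) (n * L%:Z) (f m n).
Proof. by move=> i j il jl; rewrite encodeE //; apply: cellvalP. Qed.

(** A column of zero offset shows [a1] only at the bottom of a cell, so [L] consecutive [a1] lie on
    bottom rows; the [a0] above then fixes the horizontal phase. *)
Lemma encode_mark X Y : mark encode X Y -> exists m n, X = m * L%:Z /\ Y = n * L%:Z.
Proof.
have [m [i [il eX]]] := split_int X; have [n [j [jl eY]]] := split_int Y.
move=> [M1 M2]; exists m, n.
have j0 : j = 0%N.
  (* the window of [L] cells meets a column with zero offset *)
  have [m' [k [kl e]]] : exists (m' : int) (k : nat), (k < L)%N /\ X + k%:Z = m' * L%:Z.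
    have [i0|i0] := posnP i; first by exists m, 0%N; split; lia.
    by exists (m + 1), (L - i)%N; split; lia.
  have := M1 k kl; rewrite e eY.
  have := @encodeE m' n 0%N j ltac:(lia) jl; rewrite addr0 => ->.
  rewrite /cellval; case: eqP => // _; rewrite eqxx; case: eqP => _ /eqP;
    by rewrite (negbTE a01).
split; last by lia.
move: M2; rewrite eX eY j0.
have -> : n * L%:Z + 0%:Z + 1 = n * L%:Z + 1%:Z by lia.
rewrite encodeE //; last by lia.
by rewrite /cellval /=; case: eqP => [->|_ /eqP]; rewrite ?addr0 // eq_sym (negbTE a01).
Qed.

Theorem encode_sft : macro_sft encode.
Proof.
move=> X Y; split.
  have near (x : int) : exists (m : int) (i : nat), (i < L)%N /\ i%:Z + x = m * L%:Z.
    have [m [i [il e]]] := split_int x.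
    have [i0|i0] := posnP i; first by exists m, 0%N; split; lia.
    by exists (m + 1), (L - i)%N; split; lia.
  have [m [i [il ei]]] := near X; have [n [j [jl ej]]] := near Y.
  exists i, j; split=> //; rewrite mark_shift ei ej.
  exact: block_mark (encode_block m n).
rewrite mark_shift !add0r => /encode_mark[m [n [-> ->]]].
exists (shift m n f); split; first exact: Vf.
move=> i j _ _; rewrite block_shift -!mulrDl; exact: encode_block.
Qed.

End Encode.

(* [y] is tiled by cells in phase with the origin, whose tiles are hierarchically in phase
   with the origin up to level [k]. *)
Definition aligned k b y : Prop := exists f : int -> int -> T,
  [/\ valid f, levels k b f & forall m n, block y (m * L%:Z) (n * L%:Z) (f m n)].

Lemma aligned_shift k b y i j : aligned k b y ->
  aligned k b (shift (2 ^+ k * L%:Z * i) (2 ^+ k * L%:Z * j) y).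
Proof.
move=> [f [V Lv B]]; exists (shift (2 ^+ k * i) (2 ^+ k * j) f); split.
- exact: valid_shift.
- exact: levels_shift.
- move=> m n; rewrite block_shift shiftE; have := B (m + 2 ^+ k * i) (n + 2 ^+ k * j).
  by congr block; ring.
Qed.

Theorem macro_aligned y k : macro_sft y -> exists (b : nat -> bool) (s1 s2 : nat),
  [/\ (s1 <= 3 * (2 ^ k * L))%N, (s2 <= 3 * (2 ^ k * L))%N,
      aligned k b (shift (- s1%:Z) (- s2%:Z) y) &
      forall J, exists t : nat -> nat -> W, tri_array b J t].
Proof.
move=> /macro_decode[i [j [f [il jl V B]]]].
have [p [q ev]] := valid_even V; have V' := valid_shift p%:Z q%:Z V.
have [Z L0] := valid_crossed V' ev.
have [F [P [Q [F0 FC]]]] := exists_chain (valid_ruled V') Z.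
have [a [c [la lc Lv]]] := chain_levels k FC.
have P0 := expn_gt0 2 k; rewrite /= in P0; rewrite expnS in la lc.
(* Three periods [2 ^ k * L] exceed any offset; subtracting them makes the shift negative, so that
   patterns start at nonnegative bounded coordinates in the grid of blocks. *)
have aux (u : nat) (e : bool) (r : nat) : (u.+2 <= 2 * 2 ^ k)%N -> (r < L)%N ->
    exists s : nat, (s <= 3 * (2 ^ k * L))%N /\
      - s%:Z = r%:Z + (u + e)%N%:Z * L%:Z + 2 ^+ k * L%:Z * (-3).
  move=> hu hr; exists (3 * (2 ^ k * L) - (r + (u + e) * L))%N; split; first by lia.
  have h : (r + (u + e) * L <= 3 * (2 ^ k * L))%N.
    have : ((u + e) * L <= (2 * 2 ^ k - 1) * L)%N by rewrite leq_mul2r; case: e; lia.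
    have : ((1 + 2 ^ k) * L <= (2 * 2 ^ k) * L)%N by rewrite leq_mul2r; lia.
    by rewrite mulnBl !mulnDl; lia.
  rewrite -pow2z.
  by rewrite -subzn // !PoszD !PoszM !PoszD; ring.
have [s1 [ls1 e1]] := aux a p i la il; have [s2 [ls2 e2]] := aux c q j lc jl.
exists (level_bit F), s1, s2; split=> //; last by apply: chain_array => //; rewrite F0.
rewrite e1 e2.
have -> : shift (i%:Z + (a + p)%N%:Z * L%:Z + 2 ^+ k * L%:Z * (-3))
    (j%:Z + (c + q)%N%:Z * L%:Z + 2 ^+ k * L%:Z * (-3)) y =
  shift (2 ^+ k * L%:Z * (-3)) (2 ^+ k * L%:Z * (-3))
    (shift (i%:Z + (a + p)%N%:Z * L%:Z) (j%:Z + (c + q)%N%:Z * L%:Z) y).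
  by apply/funext => u; apply/funext => v; rewrite !shiftE; congr y; ring.
apply: aligned_shift; exists (shift a%:Z c%:Z (shift p%:Z q%:Z f)); split.
- exact: valid_shift.
- by rewrite -F0.
- move=> m n; rewrite block_shift !shiftE.
  have := B (m + a%:Z + p%:Z) (n + c%:Z + q%:Z).
  by congr block; rewrite PoszD; ring.
Qed.

End Macro.

(** * Counting patterns *)

Section Counting.
Local Open Scope nat_scope.

(** The data attached to a pattern come from existential choices; it is enough that they determine
    the pattern. *)
Lemma card_le_rel (T1 T2 : finType) (B : {set T1}) (Q : {set T2}) (R : T1 -> T2 -> Prop) :
  (forall p, p \in B -> exists2 q, q \in Q & R p q) ->
  (forall p p' q, p \in B -> p' \in B -> R p q -> R p' q -> p = p') -> #|B| <= #|Q|.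
Proof.
move=> H inj; have [->|[p0 Bp0]] := set_0Vmem B; first by rewrite cards0.
have [q0 _ _] := H p0 Bp0.
have F p : {q | p \in B -> q \in Q /\ R p q}.
  apply: cid; have [/H[q Qq Rq]|] := boolP (p \in B); first by exists q.
  by exists q0.
rewrite -(@card_in_imset _ _ (fun p => sval (F p)) B) => [|p p' Bp Bp' e].
  apply/subset_leq_card/fintype.subsetP => q /imsetP[p Bp ->].
  by case: (F p) => q' /= /(_ Bp)[].
case: (F p) (F p') e => q /= /(_ Bp)[_ Rq] [q' /= /(_ Bp')[_ Rq']] e.
by apply: (inj p p' q) => //; rewrite e.
Qed.

Definition patterns (A : finType) (X : (int -> int -> A) -> Prop) n :
    {set {ffun 'I_n * 'I_n -> A}} :=
  [set p : {ffun 'I_n * 'I_n -> A} | `[< exists2 y, X y & forall ij : 'I_n * 'I_n, y (ij.1 : nat)%:Z (ij.2 : nat)%:Z = p ij >]].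

Lemma logn2_period k j m : 0 < m < 2 ^ k -> logn 2 (2 ^ k * j + m) = logn 2 m.
Proof.
move=> /andP[m0 mk]; set i := logn 2 m.
have im : 2 ^ i %| m by rewrite pfactor_dvdn.
have ik : i < k.
  by rewrite -(@ltn_exp2l 2) //; apply: leq_ltn_trans mk; apply: dvdn_leq.
have dk e : e <= k -> 2 ^ e %| 2 ^ k * j by move=> ?; rewrite dvdn_mulr // dvdn_exp2l.
have s0 : 0 < 2 ^ k * j + m by rewrite addn_gt0 m0 orbT.
apply/eqP; rewrite eqn_leq; apply/andP; split.
  rewrite leqNgt; apply/negP; rewrite -pfactor_dvdn // dvdn_addr ?dk //.
  by rewrite pfactor_dvdn // ltnn.
by rewrite -pfactor_dvdn // dvdn_add // dk // ltnW.
Qed.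

(** Row 0 of a block of side 2^k has an unknown valuation, at least k. It is left out here, for
    lower bounds, and counted in [free_row], for upper bounds, so the default value of [logn 2 0]
    never matters. *)
Definition set_row (b : nat -> bool) r := (0 < r) && b (logn 2 r).

Lemma count_set_row_shift b k j P : {subset P <= iota 1 (2 ^ k).-1} ->
  count (set_row b \o addn (2 ^ k * j)) P = count (set_row b) P.
Proof.
move=> sub; apply: eq_in_count => m /sub; rewrite mem_iota => h.
rewrite /set_row /= logn2_period; last by lia.
have m0 : 0 < m by lia.
by rewrite addn_gt0 m0 orbT.
Qed.

Lemma iota_pow k : iota 0 (2 ^ k) = 0 :: iota 1 (2 ^ k).-1.
Proof. by rewrite -{1}(prednK (expn_gt0 2 k)). Qed.

(** Doubling the range repeats the valuations below [k] and adds the row [2 ^ k], of valuation [k]: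
    this is the recursion of [prefix_code]. *)
Lemma count_set_row b k : count (set_row b) (iota 0 (2 ^ k)) = prefix_code b k.
Proof.
elim: k => [|k IH] //; rewrite expnS mul2n -addnn iotaD count_cat IH /= add0n.
rewrite -{1}[2 ^ k]addn0 iotaDl count_map iota_pow /=.
have := @count_set_row_shift b k 1 (iota 1 (2 ^ k).-1) (fun _ h => h).
rewrite muln1 => ->; have : count (set_row b) (iota 1 (2 ^ k).-1) = prefix_code b k.
  by rewrite -IH iota_pow.
move=> ->; rewrite /set_row addn0 expn_gt0 /= pfactorK //; lia.
Qed.

Lemma count_set_row_mul b k j : j * prefix_code b k <= count (set_row b) (iota 0 (2 ^ k * j)).
Proof.
elim: j => [|j IH] //; rewrite mulSn mulnS addnC [2 ^ k + _]addnC iotaD count_cat leq_add //.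
rewrite add0n -{1}[2 ^ k * j]addn0 iotaDl count_map iota_pow /=.
have := @count_set_row_shift b k j (iota 1 (2 ^ k).-1) (fun _ h => h) => ->.
by rewrite -count_set_row iota_pow /=; lia.
Qed.

Lemma vv_origin K (r : int) n : K <= vv r -> 0 < n < 2 ^ K -> vv (r + n%:Z)%R = logn 2 n.
Proof.
move=> Kr /andP[n0 nK]; set i := logn 2 n.
have iK : i < K.
  rewrite -(@ltn_exp2l 2) //; apply: leq_ltn_trans nK; apply: dvdn_leq => //.
  by rewrite pfactor_dvdn.
apply/eqP; rewrite eqn_leq; apply/andP; split.
  rewrite leqNgt; apply/negP => h.
  have [c /addrI e] := @vv_sub i.+1 r (r + n%:Z)%R ltac:(lia) h.
  have : 2 ^ i.+1 %| n.
    have -> : n = absz n%:Z by [].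
    by rewrite e -pow2z abszM dvdn_mulr.
  by rewrite pfactor_dvdn // ltnn.
have : 2 ^ i %| n by rewrite pfactor_dvdn.
move=> /dvdnP[c ->]; rewrite mulnC PoszM pow2z; apply: vv_add; lia.
Qed.

Section Count.
Variables (W : trisys) (A : finType) (a0 a1 : A) (L np : nat).
Hypothesis a01 : a0 != a1.
Local Notation T := (tile W).
Local Notation C := #|T|.
Hypothesis L3 : (2 < L)%N.
Hypothesis room : (C + np <= L.-1 * (L - 2))%N.
Local Notation X := (@macro_sft W A a0 a1 L np).
Local Notation aligned := (@aligned W A a0 a1 L np).

Definition array_bits (b : nat -> bool) : Prop :=
  forall J, exists t : nat -> nat -> W, tri_array b J t.

Definition block_patterns k : {set {ffun 'I_(2 ^ k * L) * 'I_(2 ^ k * L) -> A}} :=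
  patterns (fun y => exists2 b, aligned k b y & array_bits b) (2 ^ k * L).

Lemma patterns_blocks k n (E := 2 ^ k * L) :
  #|patterns X n| <= (3 * E).+1 ^ 2 * #|block_patterns k| ^ ((n %/ E + 4) ^ 2).
Proof.
(* Blocks per side: three for the offset, at most [3 * E], and one for the incomplete last block. *)
set Q := n %/ E + 4.
have E0 : 0 < E by rewrite muln_gt0 expn_gt0; lia.
pose S := [set s : 'I_(3 * E).+1 * 'I_(3 * E).+1 *
    {ffun 'I_Q * 'I_Q -> {ffun 'I_E * 'I_E -> A}} | s.2 \in ffun_on (mem (block_patterns k))].
have cS : #|S| = (3 * E).+1 ^ 2 * #|block_patterns k| ^ (Q ^ 2).
  have -> : S = finset.setX [set: 'I_(3 * E).+1 * 'I_(3 * E).+1] [set q | q \in ffun_on (mem (block_patterns k))].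
    by apply/finset.setP => s; rewrite !inE.
  rewrite cardsX cardsT card_prod card_ord cardsE card_ffun_on card_prod card_ord.
  by rewrite !mulnn.
have nQ (i s : nat) : i < n -> s <= 3 * E -> i + s < Q * E.
  move=> lt le; have := ltn_ceil n E0; rewrite /Q mulnDl mulSn; lia.
rewrite -cS; apply: (@card_le_rel _ _ (patterns X n) S (fun p s => forall (i j : 'I_n) (u v : 'I_Q) (w z : 'I_E),
    u * E + w = i + s.1.1 -> v * E + z = j + s.1.2 -> p (i, j) = s.2 (u, v) (w, z))).
- move=> p; rewrite inE => /asboolP[y Xy yp].
  have [b [s1 [s2 [l1 l2 al tb]]]] := macro_aligned a01 L3 room k Xy.
  rewrite -/E in l1 l2; pose y' := shift (- s1%:Z)%R (- s2%:Z)%R y.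
  pose q := [ffun uv : 'I_Q * 'I_Q => [ffun wz : 'I_E * 'I_E =>
    y' (uv.1 * E + wz.1)%N%:Z (uv.2 * E + wz.2)%N%:Z]].
  exists (Ordinal (l1 : s1 < (3 * E).+1), Ordinal (l2 : s2 < (3 * E).+1), q).
    rewrite inE; apply/ffun_onP => uv; rewrite inE; apply/asboolP.
    exists (shift (2 ^+ k * L%:Z * (uv.1 : nat)%:Z)%R (2 ^+ k * L%:Z * (uv.2 : nat)%:Z)%R y').
      by exists b => //; apply: aligned_shift.
    move=> wz; rewrite !ffunE shiftE -pow2z -!PoszM -!PoszD.
    by rewrite -/E ![E * _]mulnC ![_ + _ * E]addnC.
  move=> i j u v w z /= e1 e2; rewrite !ffunE /= e1 e2 /y' shiftE -(yp (i, j)) /= !PoszD.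
  by rewrite !addrK.
- move=> p p' [[s1 s2] q] _ _ H H'; apply/ffunP => -[i j].
  have ex (h : 'I_n) (s : 'I_(3 * E).+1) : exists (u : 'I_Q) (w : 'I_E), u * E + w = h + s.
    have lt := nQ h s (ltn_ord h) (ltn_ord s : s <= 3 * E).
    have uQ : (h + s) %/ E < Q by rewrite ltn_divLR.
    by exists (Ordinal uQ), (Ordinal (ltn_pmod (h + s) E0)); rewrite /= -divn_eq.
  have [u [w e1]] := ex i s1; have [v [z e2]] := ex j s2.
  by rewrite (H i j u v w z e1 e2) (H' i j u v w z e1 e2).
Qed.

Definition free_row (b : nat -> bool) r := (r == 0) || b (logn 2 r).

Lemma count_free_row b k : count (free_row b) (iota 0 (2 ^ k)) = (prefix_code b k).+1.
Proof.
rewrite -count_set_row iota_pow /= add0n; congr _.+1.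
by apply: eq_in_count => r; rewrite mem_iota /free_row /set_row; case: r.
Qed.

Lemma logn2_lt k r : 0 < r < 2 ^ k -> logn 2 r < k.
Proof.
move=> /andP[r0 rk]; rewrite -(@ltn_exp2l 2) //; apply: leq_ltn_trans rk.
by apply: dvdn_leq => //; rewrite pfactor_dvdn.
Qed.

Lemma eq_free_row (b b' : nat -> bool) k : (forall i : 'I_k, b i = b' i) ->
  forall r, r < 2 ^ k -> free_row b r = free_row b' r.
Proof.
move=> e r rk; rewrite /free_row; case: r rk => [|r] // rk.
by rewrite (e (Ordinal (logn2_lt (rk : 0 < r.+1 < 2 ^ k)))).
Qed.

Definition free_rank b r := count (free_row b) (iota 0 r).

Lemma free_rank_lt b k r : r < 2 ^ k -> free_row b r -> free_rank b r < (prefix_code b k).+1.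
Proof.
move=> rk fr; rewrite -count_free_row.
have -> : 2 ^ k = r + (1 + (2 ^ k - r.+1)) by lia.
by rewrite iotaD count_cat add0n iotaD count_cat /= fr /free_rank /=; lia.
Qed.

Lemma card_block_data (U V : finType) k D r M : #|[set: ({ffun 'I_k -> bool} *
    ({ffun 'I_4 * 'I_D.+1 -> U} * {ffun 'I_M.+1 -> {ffun 'I_D * 'I_r -> V}}))%type]| =
  2 ^ k * (#|U| ^ (4 * D.+1) * #|V| ^ (D * r * M.+1)).
Proof. by rewrite cardsT !card_prod !card_ffun !card_prod card_bool !card_ord -expnM. Qed.

(** A block is determined by [k] bits, the tiles of its frame and the payload of its free rows, at
    most [M] of them besides row 0. Payloads are indexed by the rank of a row among the free ones,
    whence the exponent [M.+1] in place of the number of rows. *)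
Lemma block_patterns_bound k M : (forall b, array_bits b -> prefix_code b k <= M) ->
  #|block_patterns k| <= 2 ^ k * (C ^ (4 * (2 ^ k).+1) * #|A| ^ (2 ^ k * np * M.+1)).
Proof.
move=> bM; set D := 2 ^ k.
pose S : finType := ({ffun 'I_k -> bool} * ({ffun 'I_4 * 'I_D.+1 -> T} *
  {ffun 'I_M.+1 -> {ffun 'I_D * 'I_np -> A}}))%type.
have cS : #|[set: S]| = D * (C ^ (4 * D.+1) * #|A| ^ (D * np * M.+1)).
  exact: card_block_data.
rewrite -cS; pose spec (p : {ffun 'I_(D * L) * 'I_(D * L) -> A}) (s : S) (y : int -> int -> A)
    (f : int -> int -> T) (b : nat -> bool) :=
  [/\ [/\ valid f, levels k b f & forall m n, block a0 a1 L np y (m * L%:Z)%R (n * L%:Z)%R (f m n)],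
      forall ij : 'I_(D * L) * 'I_(D * L), y (ij.1 : nat)%:Z (ij.2 : nat)%:Z = p ij,
      forall i : 'I_k, s.1 i = b i,
      forall m : 'I_D.+1, [/\ f (m : nat)%:Z 0%R = s.2.1 (inord 0, m),
        f (m : nat)%:Z D%:Z = s.2.1 (inord 1, m), f 0%R (m : nat)%:Z = s.2.1 (inord 2, m) &
        f D%:Z (m : nat)%:Z = s.2.1 (inord 3, m)] &
      forall (m n : 'I_D) (i j : 'I_L) (x : 'I_np), 0 < i -> 1 < j -> inner_pos L i j = C + x ->
        free_row b n -> y (m * L + i)%N%:Z (n * L + j)%N%:Z = s.2.2 (inord (free_rank b n)) (m, x)].
apply: (@card_le_rel _ _ (block_patterns k) [set: S]
  (fun p s => exists y f b, spec p s y f b)).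
- move=> p; rewrite inE => /asboolP[y [b [f [V Lv B]] tb] yp].
  pose fr := [ffun cm : 'I_4 * 'I_D.+1 => let m := (cm.2 : nat)%:Z in
    if cm.1 == 0 :> nat then f m 0%R else if cm.1 == 1 :> nat then f m D%:Z
    else if cm.1 == 2 :> nat then f 0%R m else f D%:Z m].
  have cell_ex (x : 'I_np) : exists ij : nat * nat,
      [/\ (ij.1 < L)%N, (ij.2 < L)%N, (0 < ij.1)%N, (1 < ij.2)%N & inner_pos L ij.1 ij.2 = C + x].
    have [|i [j H]] := inner_posK a01 L3 room (k := C + x); last by exists (i, j).
    by have := ltn_ord x; move: room; lia.
  have row_ex (g : 'I_M.+1) : exists n : nat, forall n' : nat, n' < D -> free_row b n' ->
      free_rank b n' = g -> n' = n.
    have mono n n' : free_row b n -> n < n' -> free_rank b n < free_rank b n'.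
      move=> fn lt; rewrite /free_rank.
      have -> : n' = n + (1 + (n' - n.+1)) by lia.
      by rewrite iotaD count_cat add0n iotaD count_cat /= fn /=; lia.
    have [[n [fn gn]]|no] := pselect (exists n, free_row b n /\ free_rank b n = g).
      exists n => n' _ fn' gn'; have [lt|lt|//] := ltngtP n' n.
        by have := mono _ _ fn' lt; lia.
      by have := mono _ _ fn lt; lia.
    by exists 0 => n' _ fn' gn'; case: no; exists n'.
  pose pay := [ffun g : 'I_M.+1 => [ffun mx : 'I_D * 'I_np =>
     y ((mx.1 : nat) * L + (sval (cid (cell_ex mx.2))).1)%N%:Z
       (sval (cid (row_ex g)) * L + (sval (cid (cell_ex mx.2))).2)%N%:Z]].
  exists ([ffun i : 'I_k => b i], (fr, pay)); first by rewrite inE.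
  exists y, f, b; split=> //.
  + by move=> i; rewrite ffunE.
  + by move=> m; rewrite !ffunE /= !inordK.
  + move=> m n i j x i0 j1 e fn; rewrite !ffunE /=.
    have lt : free_rank b n < M.+1.
      by have := free_rank_lt (ltn_ord n) fn; have := bM _ tb; lia.
    case: (cid (row_ex _)) => n' /= /(_ n (ltn_ord n) fn); rewrite inordK // => /(_ erefl) <-.
    case: (cid (cell_ex x)) => -[i' j'] /= [i'L j'L i'0 j'1]; rewrite -e /inner_pos => e'.
    have iL := ltn_ord i; have jL := ltn_ord j.
    have L1 : 0 < L.-1 by lia.
    have ei : i = i' :> nat.
      have := congr1 (modn^~ L.-1) e'; rewrite /= !modnMDl !modn_small; lia.
    have ej : j = j' :> nat.
      have := congr1 (divn^~ L.-1) e'; rewrite /= !divnMDl // !divn_small; lia.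
    by rewrite ei ej.
- move=> p p' s _ _ [y [f [b [[V Lv B] yp sb fr pay]]]] [y' [f' [b' [[V' Lv' B'] yp' sb' fr' pay']]]].
  have eb (i : 'I_k) : b i = b' i by rewrite -sb -sb'.
  have fE (m n : nat) : m <= D -> n <= D -> f m%:Z n%:Z = f' m%:Z n%:Z.
    move=> lm ln.
    have Fr (u v : nat) : u <= D -> v <= D -> [\/ u = 0, u = D, v = 0 | v = D] ->
        f u%:Z v%:Z = f' u%:Z v%:Z.
      move=> lu lv; rewrite -ltnS in lu; rewrite -ltnS in lv.
      have [/= b1 b2 _ _] := fr (Ordinal lu); have [/= b1' b2' _ _] := fr' (Ordinal lu).
      have [/= _ _ b3 b4] := fr (Ordinal lv); have [/= _ _ b3' b4'] := fr' (Ordinal lv).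
      by case=> ->; rewrite ?b1 ?b2 ?b3 ?b4 ?b1' ?b2' ?b3' ?b4'.
    have o := Fr 0 0 isT isT (Or41 _ _ _ erefl).
    have [ex ey] := @parity_agree _ f f' m%:Z n%:Z V V' (congr1 (@px W) o) (congr1 (@py W) o).
    have DZ : (2 ^+ k = D%:Z)%R by rewrite -pow2z.
    have [es eh ev] : agree f f' m%:Z n%:Z.
      apply: (frame_determines Lv Lv'); rewrite DZ; [|lia|lia].
      move=> u v lu lv H.
      have -> : u = (absz u)%:Z by lia.
      have -> : v = (absz v)%:Z by lia.
      have := Fr (absz u) (absz v); rewrite /agree => -> //; try lia.
      by case: H => ->; [constructor 1 | constructor 2 | constructor 3 | constructor 4].
    exact: tile_ext.
  apply/ffunP => -[i j]; rewrite -yp -yp' /=.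
  have L0 : 0 < L by lia.
  pose m := (i : nat) %/ L; pose n := (j : nat) %/ L.
  have mD : m < D by rewrite ltn_divLR.
  have nD : n < D by rewrite ltn_divLR.
  have iL := ltn_pmod i L0; have jL := ltn_pmod j L0.
  have ei : (i : nat)%:Z = (m%:Z * L%:Z + (i %% L)%N%:Z)%R by rewrite {1}(divn_eq i L) PoszD PoszM.
  have ej : (j : nat)%:Z = (n%:Z * L%:Z + (j %% L)%N%:Z)%R by rewrite {1}(divn_eq j L) PoszD PoszM.
  have := B m%:Z n%:Z _ _ iL jL; have := B' m%:Z n%:Z _ _ iL jL; rewrite -ei -ej.
  rewrite -(fE m n (ltnW mD) (ltnW nD)) /cellok.
  case: ifP => j0; first by move=> /eqP -> /eqP ->.
  case: ifP => j1; first by move=> /eqP -> /eqP ->.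
  case: ifP => i0; first by move=> /eqP -> /eqP ->.
  case: ltnP => kC; first by move=> /eqP -> /eqP ->.
  case: ltnP => kP; last by move=> /eqP -> /eqP ->.
  have [fn|nf] := boolP (free_row b n).
    move=> _ _; have xn : inner_pos L (i %% L) (j %% L) - C < np by lia.
    have hi : 0 < i %% L by lia.
    have hj : 1 < j %% L by lia.
    have e : inner_pos L (i %% L) (j %% L) = C + (inner_pos L (i %% L) (j %% L) - C).
      by rewrite subnKC.
    have fn' : free_row b' n by rewrite -(eq_free_row eb).
    have H := pay (Ordinal mD) (Ordinal nD) (Ordinal iL) (Ordinal jL) (Ordinal xn) hi hj e fn.
    have H' := pay' (Ordinal mD) (Ordinal nD) (Ordinal iL) (Ordinal jL) (Ordinal xn) hi hj e fn'.
    rewrite /= -!divn_eq in H H'; rewrite H H'.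
    congr (s.2.2 (inord _) _); apply: eq_in_count => r; rewrite mem_iota => /andP[_ hr].
    by apply: (eq_free_row eb); apply: ltn_trans hr _.
  have n0 : 0 < n by move: nf; rewrite /free_row; case: n {nD ej}.
  have -> : row_bit (f m%:Z n%:Z) = false.
    rewrite (levels_row_bit _ Lv) ?n0 //; apply/negbTE; move: nf.
    by rewrite /free_row negb_or => /andP[].
  by move=> /eqP -> /eqP ->.
Qed.

(** Over one fixed tiling, the payloads of the set rows are arbitrary and can be read back. *)
Lemma patterns_lower b (t : nat -> nat -> W) k n (q := n %/ L) :
  (forall J, tri_array b J t) ->
  #|A| ^ (q * (q %/ 2 ^ k * prefix_code b k) * np) <= #|patterns X n|.
Proof.
move=> tA.
pose Z : finType := {r : 'I_q | set_row b r}.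
have cZ : q %/ 2 ^ k * prefix_code b k <= #|Z|.
  rewrite card_sig; apply: leq_trans (count_set_row_mul b k (q %/ 2 ^ k)) _.
  have -> : #|[pred r : 'I_q | set_row b r]| = count (set_row b) (iota 0 q).
    by rewrite -val_enum_ord count_map cardE enumT /enum_mem size_filter; apply: eq_count.
  have le : 2 ^ k * (q %/ 2 ^ k) <= q by rewrite mulnC leq_trunc_div.
  by rewrite -{2}(subnKC le) iotaD count_cat leq_addr.
have A0 : 0 < #|A| by apply/card_gt0P; exists a0.
apply: (@leq_trans #|[set: {ffun 'I_q * Z * 'I_np -> A}]|).
  rewrite cardsT card_ffun !card_prod !card_ord leq_pexp2l // leq_mul2r leq_mul2l.
  by rewrite cZ !orbT.
(* Since [q < 2 ^ q], the rows at distance [0 < u < q] above a row of valuation at least [q] have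
   valuation [logn 2 u]. *)
pose K := q; pose r := lo K 0.
have Kr : K <= vv r by case: (loP K 0).
pose f := shift 0%R r (structure t).
have Vf : valid f by exact: valid_shift (structure_valid tA).
have fbit (m : int) (u : nat) : 0 < u < q -> row_bit (f m u%:Z) = b (logn 2 u).
  move=> lt; rewrite /f shiftE (structure_row_bit tA) addrC (@vv_origin K) //.
  by have := ltn_expl K (isT : 1 < 2); rewrite /K; lia.
pose P (g : {ffun 'I_q * Z * 'I_np -> A}) (m n : int) (x : nat) : A :=
  if pselect (exists c : 'I_q * Z * 'I_np, [/\ (c.1.1 : nat)%:Z = m,
      (sval c.1.2 : nat)%:Z = n & (c.2 : nat) = x]) is left H then g (sval (cid H)) else a0.
have PE (g : {ffun 'I_q * Z * 'I_np -> A}) (m : 'I_q) (z : Z) (x : 'I_np) :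
    P g (m : nat)%:Z (sval z : nat)%:Z x = g (m, z, x).
  rewrite /P; case: pselect => [H|[]]; last by exists (m, z, x).
  case: (cid H) => -[[m' z'] x'] /= [[em] [ez] ex]; congr (g (_, _, _)).
  - exact: val_inj.
  - by apply: val_inj; apply: val_inj.
  - exact: val_inj.
apply: (@card_le_rel _ _ _ (patterns X n) (fun g (p : {ffun 'I_n * 'I_n -> A}) =>
   forall ij : 'I_n * 'I_n, encode a0 a1 L np f (P g) (ij.1 : nat)%:Z (ij.2 : nat)%:Z = p ij)).
- move=> g _; exists [ffun ij : 'I_n * 'I_n =>
      encode a0 a1 L np f (P g) (ij.1 : nat)%:Z (ij.2 : nat)%:Z].
    rewrite inE; apply/asboolP; exists (encode a0 a1 L np f (P g)).
      exact: (encode_sft a01 L3 room).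
    by move=> ij; rewrite ffunE.
  by move=> ij; rewrite ffunE.
- move=> g g' p _ _ H H'; apply/ffunP => -[[m z] x].
  have [|i [j [il jl i0 j1 e]]] := inner_posK a01 L3 room (k := C + x).
    by have := ltn_ord x; move: room; lia.
  have inn (u : 'I_q) (v : nat) : v < L -> u * L + v < n.
    move=> vL; have : u.+1 * L <= q * L by rewrite leq_mul2r ltn_ord orbT.
    by have := leq_trunc_div n L; rewrite mulSn /q; lia.
  pose ij := (Ordinal (inn m i il), Ordinal (inn (sval z) j jl)).
  have := H ij; rewrite -(H' ij) /= !PoszD !PoszM !(encodeE a01 L3 room) //.
  rewrite /cellval.
  have [nj0 nj1 ni0] : [/\ (j == 0) = false, (j == 1) = false & (i == 0) = false] by split; lia.
  have /andP[z0 zb] : set_row b (sval z) := svalP z.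
  rewrite nj0 nj1 ni0 e ltnNge leq_addr /= ltn_add2l ltn_ord addKn !PE fbit ?zb //.
  by rewrite z0 ltn_ord.
Qed.

End Count.

End Counting.

(** * Higher dimensions *)

Section Slices.
Variables (A : finType) (d : nat).
Local Notation conf := (configuration A d.+2).

Definition extend X (i j : X) (r : 'rV[X]_d) : 'rV[X]_d.+2 :=
  \row_k (if unlift ord0 k is Some k' then
            if unlift ord0 k' is Some k'' then r 0 k'' else j
          else i).

Definition c0 : 'I_d.+2 := ord0.
Definition c1 : 'I_d.+2 := lift ord0 ord0.
Definition rest X (v : 'rV[X]_d.+2) : 'rV[X]_d := \row_k v 0 (lift ord0 (lift ord0 k)).

Lemma extend0 X (i j : X) r : extend i j r 0 c0 = i.
Proof. by rewrite mxE unlift_none. Qed.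

Lemma extend1 X (i j : X) r : extend i j r 0 c1 = j.
Proof. by rewrite mxE liftK unlift_none. Qed.

Lemma rest_extend X (i j : X) r : rest (extend i j r) = r.
Proof. by apply/rowP => k; rewrite !mxE !liftK. Qed.

Lemma extendK X (v : 'rV[X]_d.+2) : extend (v 0 c0) (v 0 c1) (rest v) = v.
Proof.
apply/rowP => k; rewrite mxE; case: unliftP => [k' ->|-> //].
by case: unliftP => [k'' ->|-> //]; rewrite mxE.
Qed.

Lemma extendD (i j i' j' : int) r r' :
  extend i j r + extend i' j' r' = extend (i + i') (j + j') (r + r').
Proof. by apply/rowP => k; rewrite !mxE; case: unlift => // k'; case: unlift => // k''; rewrite mxE. Qed.

Definition slice (x : conf) (u : 'rV[int]_d.+2) (i j : int) : A := x (u + extend i j 0).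

Lemma slice_shift x u m n : shift m n (slice x u) = slice x (u + extend m n 0).
Proof.
apply/funext => i; apply/funext => j; rewrite /shift /slice -addrA extendD addr0.
by rewrite ![_ + m]addrC ![_ + n]addrC.
Qed.

Variable P : (int -> int -> A) -> Prop.

Definition sliced : set conf := [set x | forall u, P (slice x u)]%classic.

Section Sft.
Variable w : nat.
Hypothesis P_local : forall y y',
  (forall i j : int, `|i| <= w%:Z -> `|j| <= w%:Z -> y i j = y' i j) -> P y -> P y'.
Local Notation I := 'I_(2 * w).+1.

(** Outside the window [inord] yields arbitrary values, harmless because [P] is local. *)
Definition clamp (i : int) : I := inord (absz (i + w%:Z)).

Definition window_conf (g : {ffun I * I -> A}) : conf :=
  fun v => g (clamp (v 0 c0), clamp (v 0 c1)).

Definition window : {fset 'rV[int]_d.+2} :=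
  [fset v in [seq extend ((ij.1 : nat)%:Z - w%:Z) ((ij.2 : nat)%:Z - w%:Z) 0 | ij : I * I]]%fset.

Definition window_pattern (g : {ffun I * I -> A}) : pattern A d.+2 :=
  [fmap v : window => window_conf g (val v)]%fmap.

Lemma in_window (i j : int) : `|i| <= w%:Z -> `|j| <= w%:Z -> extend i j 0 \in window.
Proof.
move=> li lj; rewrite /window inE /=; apply/mapP.
exists (clamp i, clamp j); rewrite ?mem_enum //=.
by rewrite !inordK; [congr extend; lia | lia | lia].
Qed.

Lemma appears_window g x u : appears_at (window_pattern g) x u ->
  forall i j : int, `|i| <= w%:Z -> `|j| <= w%:Z -> slice x u i j = slice (window_conf g) 0 i j.
Proof.
move=> H i j li lj; have := H [` in_window li lj]%fset.
by rewrite /slice /= => ->; rewrite ffunE /= add0r.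
Qed.

Lemma window_appears (x : conf) u : appears_at
  (window_pattern [ffun ij : I * I => x (u + extend ((ij.1 : nat)%:Z - w%:Z) ((ij.2 : nat)%:Z - w%:Z) 0)]) x u.
Proof.
move=> [z zw]; rewrite ffunE /=; move: zw.
rewrite inE /= => /mapP[[i j] _ ->] /=.
have e (k : I) : clamp ((k : nat)%:Z - w%:Z) = k.
  by rewrite /clamp subrK; apply: val_inj; rewrite /= inordK.
by rewrite /window_conf extend0 extend1 !e ffunE.
Qed.

Lemma sliced_sft : is_sft sliced.
Proof.
exists [seq window_pattern g | g <- enum {ffun I * I -> A} & `[< ~ P (slice (window_conf g) 0) >]].
apply/seteqP; split=> x /= Hx.
- move=> p /mapP[g]; rewrite mem_filter => /andP[/asboolP nP _] -> u ap.
  by apply: nP; apply: P_local (Hx u); apply: appears_window ap.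
- move=> u; apply: contrapT => nP.
  have ap := @window_appears x u; apply: (Hx _ _ u ap); apply: map_f.
  rewrite mem_filter mem_enum andbT; apply/asboolP => Pg; apply: nP.
  apply: P_local Pg => i j li lj; symmetry; exact: (appears_window ap).
Qed.

End Sft.

Let X2 (y : int -> int -> A) : Prop := forall m n, P (shift m n y).

Lemma slicedP x : sliced x <-> forall u, X2 (slice x u).
Proof.
split=> [H u m n|H u]; first by rewrite slice_shift.
have := H u 0 0; rewrite slice_shift; congr P; congr slice.
by rewrite -[RHS]addr0; congr (_ + _); apply/rowP => k; rewrite !mxE; case: unlift => // k'; case: unlift => // k''; rewrite mxE.
Qed.

Lemma X2_shift y m n : X2 y -> X2 (shift m n y).
Proof.
move=> H k l; have := H (k + m) (l + n); congr P.
by apply/funext => i; apply/funext => j; rewrite /shift !addrA.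
Qed.

Lemma cube_extend n (i j : 'I_n) r :
  cube_point (extend i j r) = extend (i : nat)%:Z (j : nat)%:Z (cube_point r).
Proof. by apply/rowP => k; rewrite !mxE; case: unlift => // k'; case: unlift => // k''; rewrite mxE. Qed.

Lemma cube_point_inj n : injective (@cube_point d n).
Proof.
move=> r r' /rowP e; apply/rowP => k; have := e k; rewrite !mxE => -[h].
exact: val_inj.
Qed.

(** A cube meets [n ^ d] slices along the first two axes, which can be filled independently. *)
Lemma pattern_count_sliced n : (exists y, X2 y) ->
  pattern_count sliced n = (#|patterns X2 n| ^ (n ^ d))%N.
Proof.
move=> [y0 Xy0].
pose Q := {ffun 'rV['I_n]_d -> {ffun 'I_n * 'I_n -> A}}.
pose Phi (p : cube_pattern A d.+2 n) : Q := [ffun r => [ffun ij => p (extend ij.1 ij.2 r)]].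
have inj : injective Phi.
  move=> p p' /ffunP e; apply/ffunP => k; have /ffunP/(_ (k 0 c0, k 0 c1)) := e (rest k).
  by rewrite !ffunE /= extendK.
have card : #|[set q : Q | q \in ffun_on (mem (patterns X2 n))]%SET| = (#|patterns X2 n| ^ (n ^ d))%N.
  by rewrite cardsE card_ffun_on card_mx card_ord mul1n.
rewrite /pattern_count -card -(card_imset _ inj); congr (#|pred_of_set _|).
apply/finset.setP => q; apply/imsetP/idP => [[p + ->]|].
  rewrite inE => /asboolP[x /slicedP Xx [u xp]]; rewrite inE; apply/ffun_onP => r.
  rewrite inE; apply/asboolP; exists (slice x (u + extend 0 0 (cube_point r))) => //.
  move=> [i j] /=; rewrite !ffunE /= -xp /slice -addrA extendD cube_extend !add0r addr0.
  by [].
rewrite inE => /ffun_onP Hq.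
exists [ffun k => q (rest k) (k 0 c0, k 0 c1)]; last first.
  by apply/ffunP => r; apply/ffunP => -[i j]; rewrite !ffunE rest_extend extend0 extend1.
rewrite inE; apply/asboolP.
have Y r : {y | X2 y /\ forall ij : 'I_n * 'I_n, y (ij.1 : nat)%:Z (ij.2 : nat)%:Z = q r ij}.
  by apply: cid; have := Hq r; rewrite inE => /asboolP[y Xy yq]; exists y.
(* Slices that miss the cube receive [y0]. *)
pose Z (s : 'rV[int]_d) : int -> int -> A :=
  if pselect (exists r, cube_point r = s) is left H then sval (Y (sval (cid H))) else y0.
have ZX s : X2 (Z s) by rewrite /Z; case: pselect => // H; case: (Y _) => y [].
have Zr r : Z (cube_point r) = sval (Y r).
  rewrite /Z; case: pselect => [H|[]]; last by exists r.
  by case: (cid H) => r' /= /cube_point_inj ->.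
exists (fun v => Z (rest v) (v 0 c0) (v 0 c1)).
  apply/slicedP => u.
  have -> : slice (fun v => Z (rest v) (v 0 c0) (v 0 c1)) u = shift (u 0 c0) (u 0 c1) (Z (rest u)).
    apply/funext => i; apply/funext => j; rewrite /slice /shift -{1 2 3}[u]extendK extendD.
    by rewrite addr0 rest_extend extend0 extend1 ![_ + i]addrC ![_ + j]addrC.
  exact: X2_shift.
exists 0 => k; rewrite add0r ffunE -{1 2 3}[k]extendK cube_extend rest_extend extend0 extend1 Zr.
by case: (Y _) => y /= [_ /(_ (k 0 c0, k 0 c1))].
Qed.

End Slices.

(** * Entropy *)

Local Open Scope classical_set_scope.

Section Reals.
Variable R : realType.

Lemma small_inv (K e : R) : 0 < e -> exists N : nat, forall n : nat, (N < n)%N -> K / n%:R <= e.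
Proof.
move=> e0; exists (Num.bound (`|K| / e)) => n lt.
have n0 : 0 < n%:R :> R by rewrite ltr0n; lia.
have : `|K| / e < n%:R.
  apply: lt_trans (archi_boundP _) _; first by rewrite divr_ge0 // ltW.
  by rewrite ltr_nat.
rewrite ltr_pdivrMr // ler_pdivrMr // => h.
by apply: le_trans (ler_norm K) _; rewrite ltW // mulrC.
Qed.

(** [K] may depend on [k]: the block size is fixed before [n] tends to infinity. The upper bound is
    around [q k], which is what the [k]-th test gives. *)
Lemma cvg_double_bounds (u q : nat -> R) (h c : R) : 0 <= c -> q @ \oo --> h ->
  (forall k : nat, exists K : R, forall n : nat, (0 < n)%N ->
     h - c / (2 ^ k)%:R - K / n%:R <= u n <= q k + c / (2 ^ k)%:R + K / n%:R) ->
  u @ \oo --> h.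
Proof.
move=> c0 qh H; apply/cvgrPdist_le => e e0.
have e4 : 0 < e / 4%:R by rewrite divr_gt0.
move/cvgrPdist_le: qh => /(_ _ e4)[N1 _ q1].
have [N2 c2] := small_inv c e4.
pose k := (N1 + N2.+1)%N.
have qk := q1 k (leq_addr _ _ : (N1 <= k)%N).
have ck : c / (2 ^ k)%:R <= e / 4%:R.
  have lt := ltn_expl k (isT : (1 < 2)%N); apply: c2; rewrite /k in lt *; lia.
have [K HK] := H k; have [N3 K3] := small_inv K e4.
near=> n.
have n0 : (0 < n)%N by near: n; exists 1%N.
have nN : (N3 < n)%N by near: n; exists N3.+1.
have /andP[l1 l2] := HK n n0; have kn := K3 n nN.
have /andP[qk1 qk2] : - (e / 4%:R) <= h - q k <= e / 4%:R by rewrite -ler_norml; exact: qk.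
by rewrite ler_norml; apply/andP; split; lra.
Unshelve. all: by end_near.
Qed.

Definition lg (n : nat) : R := ln n%:R / ln 2.

Lemma ln2_gt0 : 0 < ln 2 :> R.
Proof. by rewrite ln_gt0 // ltr1n. Qed.

Lemma lg2 : lg 2 = 1.
Proof. by rewrite /lg divff // gt_eqF ?ln2_gt0. Qed.

Lemma lgM m n : (0 < m)%N -> (0 < n)%N -> lg (m * n) = lg m + lg n.
Proof. by move=> m0 n0; rewrite /lg natrM lnM ?posrE ?ltr0n // mulrDl. Qed.

Lemma lgX m e : (0 < m)%N -> lg (m ^ e) = e%:R * lg m.
Proof. by move=> m0; rewrite /lg natrX lnXn ?ltr0n // -[ln _ *+ e]mulr_natl -mulrA. Qed.

Lemma lg_le m n : (0 < m)%N -> (m <= n)%N -> lg m <= lg n.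
Proof.
move=> m0 mn; rewrite /lg ler_pM2r ?invr_gt0 ?ln2_gt0 // ler_ln ?posrE ?ltr0n ?ler_nat //.
exact: leq_trans mn.
Qed.

Lemma lg_le_inv m n : (0 < m)%N -> (0 < n)%N -> (lg m <= lg n) = (m <= n)%N.
Proof.
by move=> m0 n0; rewrite /lg ler_pM2r ?invr_gt0 ?ln2_gt0 // ler_ln ?posrE ?ltr0n ?ler_nat.
Qed.

Lemma lg_ge0 n : 0 <= lg n.
Proof.
case: n => [|n]; first by rewrite /lg ln0 // mul0r.
by rewrite /lg divr_ge0 ?ln_ge0 ?ler1n // ltW ?ln2_gt0.
Qed.

End Reals.

Section Bounds.
Variables (R : realType) (W : trisys) (A : finType) (a0 a1 : A) (L np : nat).
Hypothesis a01 : a0 != a1.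
Hypothesis L3 : (2 < L)%N.
Hypothesis room : (#|tile W| + np <= L.-1 * (L - 2))%N.
Local Notation lg := (@lg R).
Local Notation X := (@macro_sft W A a0 a1 L np).
Local Notation N2 n := #|patterns X n|.
Local Notation beta := (lg #|A|).

Lemma lg_patterns_upper k M : (forall n, (0 < N2 n)%N) ->
  (forall b, array_bits W b -> (prefix_code b k <= M)%N) ->
  exists K : R, forall n, (0 < n)%N -> lg (N2 n) / n%:R ^+ 2 <=
    (k%:R + (4 * (2 ^ k).+1)%:R * lg #|tile W| + (2 ^ k * np * M.+1)%:R * beta)
      / (2 ^ k * L)%:R ^+ 2 + K / n%:R.
Proof.
move=> N0 bM; set E := (2 ^ k * L)%N; set G := k%:R + _ + _.
have E0 : (0 < E)%N by rewrite muln_gt0 expn_gt0; lia.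
have A0 : (0 < #|A|)%N by apply/card_gt0P; exists a0.
have T0 : (0 < #|tile W|)%N.
  case: (posnP #|tile W|) => // z; have /card_gt0P[p] := N0 1%N.
  rewrite inE => /asboolP[y Xy _].
  have [i [j [f _]]] := macro_decode a01 L3 room Xy.
  by have := fintype0 (f 0 0) z.
pose B := (2 ^ k * (#|tile W| ^ (4 * (2 ^ k).+1) * #|A| ^ (2 ^ k * np * M.+1)))%N.
have B0 : (0 < B)%N by rewrite !muln_gt0 !expn_gt0 T0 A0.
have lgB : lg B = G.
  by rewrite /B !lgM ?lgX ?lg2 ?mulr1 ?addrA // ?muln_gt0 !expn_gt0 ?T0 ?A0.
have lgB0 : 0 <= G by rewrite -lgB lg_ge0.
exists (2 * lg (3 * E).+1 + 24 * G) => n n0.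
have nR : 1 <= n%:R :> R by rewrite ler1n.
have nR0 : 0 < n%:R :> R by apply: lt_le_trans nR.
have ER : 1 <= E%:R :> R by rewrite ler1n.
have ER0 : 0 < E%:R :> R by apply: lt_le_trans ER.
have le : (N2 n <= (3 * E).+1 ^ 2 * B ^ ((n %/ E + 4) ^ 2))%N.
  apply: leq_trans (patterns_blocks a01 L3 room k n) _.
  by rewrite leq_mul2l leq_exp2r ?expn_gt0 ?addn_gt0 ?orbT // block_patterns_bound // orbT.
have := lg_le R (N0 n) le.
rewrite lgM ?expn_gt0 ?B0 // !lgX // lgB => {}le.
rewrite ler_pdivrMr ?exprn_gt0 //; apply: le_trans le _.
have x0 : n%:R / E%:R <= n%:R :> R by rewrite ler_pdivrMr // ler_peMr // ltW.
have fl : (n %/ E)%:R <= n%:R / E%:R :> R.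
  by rewrite ler_pdivlMr // -natrM ler_nat leq_trunc_div.
(* By [(x + 4) ^ 2 = x ^ 2 + 8 * x + 16], with [x <= n] and [1 <= n]. *)
have sq : ((n %/ E + 4) ^ 2)%:R <= n%:R ^+ 2 / E%:R ^+ 2 + 24 * n%:R :> R.
  rewrite natrX natrD -expr_div_n; set x := n%:R / E%:R in x0 fl *.
  have f0 : 0 <= (n %/ E)%:R :> R by rewrite ler0n.
  by nra.
have -> : (G / E%:R ^+ 2 + (2 * lg (3 * E).+1 + 24 * G) / n%:R) * n%:R ^+ 2 =
    G * (n%:R ^+ 2 / E%:R ^+ 2 + 24 * n%:R) + 2 * lg (3 * E).+1 * n%:R :> R.
  by field; rewrite !gt_eqF.
rewrite addrC lerD //.
  by rewrite mulrC ler_wpM2l.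
by rewrite ler_peMr // mulr_ge0 // lg_ge0.
Qed.

Lemma lg_patterns_lower b (t : nat -> nat -> W) k : (forall J, tri_array b J t) ->
  exists K : R, forall n, (0 < n)%N ->
    np%:R / L%:R ^+ 2 * beta * ((prefix_code b k)%:R / (2 ^ k)%:R) - K / n%:R
    <= lg (N2 n) / n%:R ^+ 2.
Proof.
move=> tA; set m := prefix_code b k; set D := (2 ^ k)%N.
have A0 : (0 < #|A|)%N by apply/card_gt0P; exists a0.
have LR : 0 < L%:R :> R by rewrite ltr0n; lia.
have D0 : (0 < D)%N by rewrite expn_gt0.
have DR : 0 < D%:R :> R by rewrite ltr0n.
exists ((2 + D%:R) / (L%:R * D%:R) * (m%:R * np%:R * beta)) => n n0.
have nR : 0 < n%:R :> R by rewrite ltr0n.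
have := lg_le R _ (patterns_lower a01 L3 room k n tA).
rewrite expn_gt0 A0 => /(_ isT); rewrite lgX // => le.
rewrite ler_pdivlMr ?exprn_gt0 //; apply: le_trans le; rewrite -/m -/D.
set q := (n %/ L)%N; set p := (q %/ D)%N.
set x : R := n%:R / L%:R.
have x0 : 0 <= x by rewrite divr_ge0 // ltW.
have qx : x - 1 <= q%:R.
  rewrite /x lerBlDr ler_pdivrMr // natr1 -natrM ler_nat ltnW //.
  by rewrite ltn_ceil //; lia.
have pq : q%:R - D%:R <= p%:R * D%:R :> R.
  rewrite lerBlDr -natrM -natrD ler_nat ltnW // -mulSnr ltn_ceil //.
have q0 : 0 <= q%:R :> R by [].
have p0 : 0 <= p%:R * D%:R :> R by rewrite mulr_ge0.
(* Rounding loses 1 on [q] and [D + 1] on [p * D]. Multiplying these bounds needs nonnegative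
   factors; when [x < 2 + D] the left side is nonpositive instead. *)
have key : x ^+ 2 - x * (2 + D%:R) <= q%:R * p%:R * D%:R.
  rewrite -mulrA; set P := p%:R * D%:R in pq p0 *.
  have [lt|ge] := ltrP x (2 + D%:R).
    apply: le_trans (mulr_ge0 q0 p0); rewrite expr2 -mulrBr.
    by rewrite mulr_ge0_le0 // subr_le0 ltW.
  have h1 : 0 <= x - 1 by have := DR; lra.
  have h2 : 0 <= x - 1 - D%:R by lra.
  have : (x - 1) * (x - 1 - D%:R) <= q%:R * P by apply: ler_pM => //; lra.
  by have := DR; nra.
have -> : (q * (p * m) * np)%:R * beta = (q%:R * p%:R * D%:R) * (m%:R * np%:R * beta / D%:R) :> R.
  by rewrite !natrM; field; rewrite gt_eqF.
have c0 : 0 <= m%:R * np%:R * beta / D%:R :> R.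
  by apply: divr_ge0 => //; rewrite mulr_ge0 ?lg_ge0 // mulr_ge0.
apply: le_trans (ler_wpM2r c0 key); rewrite le_eqVlt; apply/orP; left; apply/eqP.
by rewrite /x; field; rewrite !gt_eqF.
Qed.

End Bounds.

Section Entropy.
Variables (R : realType) (A : finType) (d : nat).
Local Notation lg := (@lg R).

Lemma log2E n : (0 < n)%N -> log2 (n%:R%:E : \bar R) = (lg n)%:E.
Proof. by move=> n0; rewrite /log2 /lne leNgt ltr0n n0 /= -EFinM. Qed.

Lemma entropy_real (X : set (configuration A d)) (h : R) :
  (forall n, (0 < pattern_count X n)%N) ->
  (fun n => lg (pattern_count X n) / n%:R ^+ d) @ \oo --> h ->
  has_topological_entropy X h%:E.
Proof.
move=> X0 H; apply: cvg_EFin.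
  by apply: nearW => n; rewrite log2E // -EFinM.
apply: cvg_trans H; apply: near_eq_cvg; apply: nearW => n /=.
by rewrite log2E.
Qed.

Lemma full_shift_entropy : (0 < #|A|)%N ->
  has_topological_entropy (sft_of (A := A) (d := d) [::]) (lg #|A|)%:E.
Proof.
move=> /[dup] A0 /card_gt0P[a _].
have cE n : pattern_count (sft_of (A := A) (d := d) [::]) n = (#|A| ^ (n ^ d))%N.
  rewrite /pattern_count -[RHS](_ : #|[set: cube_pattern A d n]%SET| = _); last first.
    by rewrite cardsT card_ffun card_mx card_ord mul1n.
  congr (#|pred_of_set _|); apply/finset.setP => p; rewrite !inE; apply/asboolP.
  exists (fun v => if pselect (exists k, cube_point k = v) is left H then p (sval (cid H)) else a) => //.
  exists 0 => k; rewrite add0r; case: pselect => [H|[]]; last by exists k.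
  case: (cid H) => k' /= e; congr (p _); apply/rowP => i.
  by move/rowP/(_ i): e; rewrite !mxE => -[e]; apply: val_inj.
apply: entropy_real => [n|]; first by rewrite cE expn_gt0 A0.
apply: cvg_near_cst; exists 1%N => // n /= n0.
rewrite cE lgX // natrX mulrAC divff ?mul1r // expf_eq0 pnatr_eq0.
by case: n n0 => // n _; rewrite andbF.
Qed.

End Entropy.

Section Digits.
Variables (R : realType) (theta : R).
Hypotheses (theta0 : 0 <= theta) (theta1 : theta < 1).

Definition digits (k : nat) : bool := odd (Num.truncn (theta * (2 ^ k.+1)%:R)).

(** The truncations of [theta * 2 ^ k] obey the doubling recursion of [prefix_code], and [theta < 1]
    starts it at 0. *)
Lemma prefix_digits k : prefix_code digits k = Num.truncn (theta * (2 ^ k)%:R).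
Proof.
have ge0 j : 0 <= theta * (2 ^ j)%:R by rewrite mulr_ge0.
elim: k => [|k IH] /=.
  by apply/esym/eqP; rewrite -leqn0 truncn_le_nat expn0 mulr1.
rewrite IH /digits.
have /andP[l1 l2] := truncn_itv (ge0 k); have /andP[l3 l4] := truncn_itv (ge0 k.+1).
set m := Num.truncn _ in l1 l2 *; set m' := Num.truncn _ in l3 l4 *.
rewrite expnS natrM in l3 l4.
have h1 : (2 * m < m'.+1)%N by rewrite -(ltr_nat R) natrM; lra.
have h2 : (m' < 2 * m.+1)%N by rewrite -(ltr_nat R) natrM; lra.
by have := odd_double_half m'; lia.
Qed.

End Digits.

(** Clearing denominators and exponentiating replaces the real number [lg R al] by integer powers,
    which makes the test computable. By [b n <= a n] the subtraction of naturals is exact. *)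
Lemma exceedsP (R : realType) al u w a b c n x (q : R) : (1 < al)%N -> (0 < w)%N ->
  (b n <= a n)%N -> q = ((a n)%:R - (b n)%:R) / (c n).+1%:R ->
  (exceeds al u w a b c n x = 0)%N <->
  x%:R / (2 ^ n)%:R * (u%:R / w%:R * lg R al) <= q.
Proof.
move=> al1 w0 ba ->; rewrite /exceeds; apply: (iff_trans (rwP eqP)).
have al0 : (0 < al)%N by lia.
rewrite subn_eq0 -(lg_le_inv R) ?expn_gt0 ?al0 // !lgX // lg2 mulr1 !natrM natrB //.
have c0 : 0 < (c n).+1%:R :> R by rewrite ltr0n.
have p0 : 0 < (2 ^ n)%:R :> R by rewrite ltr0n expn_gt0.
have w0' : 0 < w%:R :> R by rewrite ltr0n.
set lhs := x%:R / _ * _; set rhs := _ / (c n).+1%:R.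
rewrite -[lhs <= rhs](ler_pM2r (mulr_gt0 (mulr_gt0 p0 w0') c0)).
have -> : lhs * ((2 ^ n)%:R * w%:R * (c n).+1%:R) = x%:R * u%:R * (c n).+1%:R * lg R al.
  by rewrite /lhs; field; rewrite !gt_eqF.
have -> : rhs * ((2 ^ n)%:R * w%:R * (c n).+1%:R) = ((a n)%:R - (b n)%:R) * (2 ^ n)%:R * w%:R.
  by rewrite /rhs; field; rewrite gt_eqF.
by [].
Qed.

(** As soon as u + 1 > be / (be - h), the ratio u / (u + 1) exceeds h / be. *)
Lemma rational_margin (R : realType) (be h : R) : 0 < be -> h < be ->
  exists u : nat, 0 < u%:R / u.+1%:R :> R /\ h < u%:R / u.+1%:R * be.
Proof.
move=> be0 lt; have d0 : 0 < be - h by rewrite subr_gt0.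
pose u := (Num.bound (be / (be - h))).+1; exists u.
have w0 : 0 < u.+1%:R :> R by rewrite ltr0n.
split; first by rewrite divr_gt0 // ltr0n.
have : be / (be - h) < u.+1%:R.
  apply: lt_trans (archi_boundP _) _; first by rewrite divr_ge0 // ltW.
  by rewrite ltr_nat /u.
rewrite ltr_pdivrMr // mulrAC ltr_pdivlMr // -natr1 => h1.
by lra.
Qed.

(** With [L = u.+1 * l] the proportion u / (u + 1) of free positions is exact, and
    [L * l = L * (C + 3)] positions remain, enough for the code and the marks. *)
Lemma cell_room (C u : nat) : exists L np : nat,
  [/\ (2 < L)%N, (C + np <= L.-1 * (L - 2))%N & (np * u.+1 = u * L ^ 2)%N].
Proof.
pose l := (C + 3)%N; exists (u.+1 * l)%N, (u * u.+1 * l ^ 2)%N.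
have l3 : (l <= u.+1 * l)%N by rewrite leq_pmull.
have L3 : (2 < u.+1 * l)%N by rewrite /l in l3 *; lia.
split=> //; last by rewrite expnMn; ring.
have : (C <= u.+1 * l * C)%N by rewrite leq_pmull //; lia.
have : (u.+1 * l * (u.+1 * l) = u * u.+1 * l ^ 2 + u.+1 * l * C + 3 * (u.+1 * l))%N.
  by rewrite /l; ring.
set L := (u.+1 * l)%N in L3 *.
have : (L.-1 * (L - 2) + 3 * L = L * L + 2)%N by nia.
lia.
Qed.

(** * Choice of the parameters and entropy of the construction *)

Section Construction.
Variables (R : realType) (A : finType) (d : nat) (h : R).
Hypotheses (h_re : right_recursively_enumerable h) (h_ge0 : 0 <= h).
Hypothesis h_lt : h < lg R #|A|.

Lemma small_entropy_sft : exists X : set (configuration A d.+2),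
  is_sft X /\ has_topological_entropy X h%:E.
Proof.
pose be := lg R #|A|; have hbe' : h < be := h_lt.
have al1 : (1 < #|A|)%N.
  rewrite ltnNge; apply/negP => le1; move: hbe'; rewrite ltNge => /negP; apply.
  apply: le_trans h_ge0; rewrite /be /lg; case: #|A| le1 => [|[|//]] _.
    by rewrite ln0 // mul0r.
  by rewrite ln1 mul0r.
have [a0 [a1 [_ _ a01]]] := card_gt1P al1.
have be0 : 0 < be by apply: le_lt_trans hbe'.
have [q [[a [b [c [ra rb rc qE]]]] qni qh]] := h_re.
pose Q n : R := ratr (q n).
have Qh n : h <= Q n.
  have -> : h = limn Q by apply/esym/cvg_lim.
  apply: nonincreasing_cvgn_ge; last by apply/cvg_ex; exists h.
  by move=> i j ij; rewrite /Q ler_rat; apply: qni.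
have QE n : Q n = ((a n)%:R - (b n)%:R) / (c n).+1%:R.
  by rewrite /Q qE fmorph_div rmorphB /= !ratr_nat.
have ba n : (b n <= a n)%N.
  have := le_trans h_ge0 (Qh n); rewrite QE pmulr_lge0 ?invr_gt0 ?ltr0n //.
  by rewrite subr_ge0 ler_nat.
have [u [rho0 hrho]] := rational_margin be0 h_lt.
set w := u.+1 in rho0 hrho; set rho : R := u%:R / w%:R in rho0 hrho.
have w0 : 0 < w%:R :> R by rewrite ltr0n.
have rb0 : 0 < rho * be by rewrite mulr_gt0.
have [W HW] := oracle_system (recursive_exceeds #|A| u w ra rb rc).
have test n x : exceeds #|A| u w a b c n x = 0%N <-> x%:R / (2 ^ n)%:R * (rho * be) <= Q n.
  by apply: exceedsP => //; rewrite QE.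
have [L [np [L3 room npE]]] := cell_room #|tile W| u.
have LR : 1 <= L%:R :> R by rewrite ler1n (leq_trans _ L3).
have npL : np%:R = rho * L%:R ^+ 2 :> R.
  apply: (mulIf (lt0r_neq0 w0)); rewrite -natrM npE natrM natrX /rho.
  by rewrite mulrAC divfK ?gt_eqF.
pose theta := h / (rho * be).
have theta0 : 0 <= theta by rewrite divr_ge0 // ltW.
have theta1 : theta < 1 by rewrite ltr_pdivrMr // mul1r.
have thE : theta * (rho * be) = h by rewrite /theta divfK // gt_eqF.
have p2 k : 0 < (2 ^ k)%:R :> R by rewrite ltr0n expn_gt0.
(* Truncated expansions of [theta] are at most [theta], and [theta * (rho * be) = h <= Q n], so no
   test fails. *)
have [_ /(_ _)[|t tA]] := HW (digits theta).
  move=> n; rewrite prefix_digits //; apply/test; apply: le_trans (Qh n).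
  rewrite -[leRHS]thE ler_pM2r // ler_pdivrMr //.
  by have /andP[] := truncn_itv (mulr_ge0 theta0 (ltW (p2 n))).
pose X2 := @macro_sft W A a0 a1 L np.
have N0 n : (0 < #|patterns X2 n|)%N.
  by apply: leq_trans (patterns_lower a01 L3 room 0 n tA); rewrite expn_gt0 (ltnW al1).
exists (sliced (d := d) (@local_ok W A a0 a1 L np)); split.
  apply: (@sliced_sft _ _ _ (2 * L)%N) => y y' E; apply: (local_ok_local a01 L3 room).
  by move=> i j li lj; apply: E; rewrite PoszM.
have y0 : exists y, X2 y.
  by have /card_gt0P[p] := N0 1%N; rewrite inE => /asboolP[y Xy _]; exists y.
have cE n : pattern_count (sliced (d := d) (@local_ok W A a0 a1 L np)) n =
    (#|patterns X2 n| ^ (n ^ d))%N by apply: pattern_count_sliced.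
apply: entropy_real => [n|]; first by rewrite cE expn_gt0 N0.
have : (fun n => lg R #|patterns X2 n| / n%:R ^+ 2) @ \oo --> h.
  (* Error terms of a block: [k <= D] for the bits, [4 * D.+1 <= 8 * D] for the frame, and
     [rho * be] for row 0 above and the truncation of [theta] below. *)
  apply: (@cvg_double_bounds _ _ Q h (1 + 8 * lg R #|tile W| + rho * be)) => //.
    by have := lg_ge0 R #|tile W|; have := rb0; lra.
  move=> k; set D := (2 ^ k)%N.
  have DR : 1 <= D%:R :> R by rewrite ler1n expn_gt0.
  have D0 := p2 k; rewrite -/D in D0.
  have QD0 : 0 <= Q k * D%:R / (rho * be).
    apply: divr_ge0; last exact: ltW.
    by apply: mulr_ge0; [exact: le_trans h_ge0 (Qh k) | exact: ltW].
  (* The largest prefix code of length [k] that the [k]-th test accepts. *)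
  pose M := Num.truncn (Q k * D%:R / (rho * be)).
  have bM b' : array_bits W b' -> (prefix_code b' k <= M)%N.
    move=> /(HW b').1/(_ k)/test hq; rewrite truncn_ge_nat // ler_pdivlMr //.
    by move: hq; rewrite mulrAC ler_pdivrMr.
  have [K1 H1] := lg_patterns_upper R a01 L3 room N0 bM.
  have [K2 H2] := lg_patterns_lower R a01 L3 room k tA.
  exists (`|K1| + `|K2|) => n n0.
  have nR : 0 < n%:R :> R by rewrite ltr0n.
  have KK : K1 / n%:R <= (`|K1| + `|K2|) / n%:R /\ K2 / n%:R <= (`|K1| + `|K2|) / n%:R.
    rewrite !ler_pM2r ?invr_gt0 //; have := ler_norm K1; have := ler_norm K2.
    by have := normr_ge0 K1; have := normr_ge0 K2; split; lra.
  apply/andP; split.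
    apply: le_trans (H2 n n0); rewrite -/D lerB ?KK.2 //.
    rewrite prefix_digits // npL mulfK; last by rewrite expf_neq0 // gt_eqF // (lt_le_trans ltr01).
    have /andP[_] := truncn_itv (mulr_ge0 theta0 (ltW (p2 k))).
    rewrite -/D -natr1 => lt.
    rewrite lerBlDr -(ler_pM2r D0) mulrDl divfK ?gt_eqF // mulrA divfK ?gt_eqF //.
    have : h * D%:R <= rho * be * ((Num.truncn (theta * D%:R))%:R + 1).
      rewrite -thE mulrAC mulrC ler_pM2l //; exact: ltW.
    have : 0 <= lg R #|tile W| by apply: lg_ge0.
    by rewrite mulrDr mulr1 -/be; lra.
  apply: le_trans (H1 n n0) _; rewrite lerD ?KK.1 //.
  rewrite -/D -/be.
  have L0 : 0 < L%:R :> R by apply: lt_le_trans LR.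
  have DL0 : 0 < (D * L)%:R ^+ 2 :> R by rewrite exprn_gt0 // natrM mulr_gt0.
  rewrite ler_pdivrMr //.
  have MQ : M%:R * (rho * be) <= Q k * D%:R.
    by rewrite -ler_pdivlMr //; have /andP[] := truncn_itv QD0.
  have kD : k%:R <= D%:R :> R by rewrite ler_nat ltnW // ltn_expl.
  have lC : 0 <= lg R #|tile W| by apply: lg_ge0.
  have -> : (Q k + (1 + 8 * lg R #|tile W| + rho * be) / D%:R) * (D * L)%:R ^+ 2 =
      L%:R ^+ 2 * D%:R * (Q k * D%:R + (1 + 8 * lg R #|tile W|) + rho * be).
    by rewrite natrM; field; rewrite gt_eqF.
  have -> : (D * np * M.+1)%:R * be = L%:R ^+ 2 * D%:R * (M%:R * (rho * be) + rho * be) :> R.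
    by rewrite !natrM npL -natr1; ring.
  have LD : D%:R <= L%:R ^+ 2 * D%:R :> R by rewrite ler_peMl ?(ltW D0) // exprn_ege1.
  have s1 : L%:R ^+ 2 * D%:R * (M%:R * (rho * be)) <= L%:R ^+ 2 * D%:R * (Q k * D%:R).
    by rewrite ler_pM2l // mulr_gt0 // exprn_gt0.
  have s2 : k%:R + (4 * D.+1)%:R * lg R #|tile W| <= L%:R ^+ 2 * D%:R * (1 + 8 * lg R #|tile W|).
    apply: (@le_trans _ _ (D%:R * (1 + 8 * lg R #|tile W|))).
      rewrite natrM -natr1; have : lg R #|tile W| <= D%:R * lg R #|tile W| by rewrite ler_peMl.
      by lra.
    by rewrite ler_wpM2r // addr_ge0 // mulr_ge0.
  by lra.
move=> H; apply: cvg_trans H; apply: near_eq_cvg; exists 1%N => // n /= n0.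
rewrite cE lgX // natrX (_ : n%:R ^+ d.+2 = n%:R ^+ d * n%:R ^+ 2); last by rewrite -exprD addn2.
have n0' : n%:R != 0 :> R by rewrite pnatr_eq0 -lt0n.
by field; rewrite ?n0' ?expf_neq0.
Qed.

End Construction.

Theorem corollary3p8 (R : realType) (A : finType) (hA : (0 < #|A|)%N)
    (d : nat) (hd : (2 <= d)%N) (h : R)
    (h_re : right_recursively_enumerable h)
    (h_ge0 : 0 <= h) (h_le : (h%:E <= log2 (#|A|%:R)%:E)%E) :
  exists X : set (configuration A d),
    is_sft X /\ has_topological_entropy X h%:E.
Proof.
case: d hd => [|[|d]] // _.
move: h_le; rewrite log2E // lee_fin le_eqVlt => /predU1P[->|lt].
  exists (sft_of [::]); split; first by exists [::].
  exact: full_shift_entropy.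
exact: small_entropy_sft.
Qed.
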